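(* Let $1\le m\le n$ be integers and let $\varepsilon_0,b>0$. Kusner-Sullivan's energy $E_{KS}$, restricted to $\mathcal{M}(2,\varepsilon_0,b,+\infty)$, is self-repulsive with respect to the $C^2$-topology. That is: if $M_k$ $(k\in\mathbb{N})$ is a sequence of embedded oriented $m$-dimensional closed submanifolds of class $C^2$ of $\mathbb{R}^n$ belonging to $\mathcal{M}(2,\varepsilon_0,b,+\infty)$ which converges with respect to the $C^2$-topology to an immersed submanifold $M_\infty\in\mathcal{M}(2,\varepsilon_0,b,+\infty)$ with a double point, then $E_{KS}(M_k)\to+\infty$ as $k\to\infty$.
   Context: $B_r(x)$ is the ball in $\mathbb{R}^n$ with center $x$ and radius $r$. Closed means compact without boundary. The class $\mathcal{M}(2,\varepsilon_0,b,+\infty)$: the set of $m$-dimensional closed immersed submanifolds $M'$ in $\mathbb{R}^n$ (with no restriction on the volume) such that for each $M'$ there are a closed manifold $M$ of class $C^2$ and an immersion $f\colon M\to M'=f(M)$ of class $C^2$ satisfying: (i) for any point $x$ of $M'$, $f^{-1}(B_{\varepsilon_0}(x)\cap M')$ is a disjoint union of $W_1,\dots,W_\ell$; (ii) each $W_i$ is $C^2$-diffeomorphic to an $m$-ball; (iii) the restriction of $f$ to $W_i$ is a $C^2$-diffeomorphism onto $W_i'=f(W_i)\subset M'$ for each $i$; (iv) each $W_i'$ can be expressed as a graph of a function of class $C^2$, $h_i\colon U_i\to (T_xW_i')^\perp\cong\mathbb{R}^{n-m}$ with $U_i\subset T_xW_i'$, that satisfies $|\partial^\mu h_i|\le b$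 on $U_i$ for any orthogonal axes for $T_xW_i'$ and any multi-index $\mu$ with $0\le|\mu|\le 2$. $C^2$-topology: for an $m$-dimensional closed manifold $M$, the set $\mathrm{Imm}(M,\mathbb{R}^n)$ of $C^2$-immersions carries the compact-open $C^2$-topology (uniform closeness, in charts on compact sets, of all partial derivatives of order at most 2); the group $\mathrm{Diff}(M)$ of $C^2$-diffeomorphisms acts by composition, and the space of immersed closed submanifolds is the disjoint union over diffeomorphism types of $M$ of the quotient spaces $\mathrm{Imm}(M,\mathbb{R}^n)/\mathrm{Diff}(M)$. Combined angle: let $M$ be an $m$-dimensional oriented closed submanifold of class $C^2$ in $\mathbb{R}^n$. For $x\neq y$ in $M$, let $\Sigma_x(y)$ be the unique $m$-sphere (possibly degenerating to an $m$-plane) tangent to $M$ at $x$ and passing through $y$, with the orientation that coincides with that of $M$ at $x$. Let $\Pi_y=T_yM$ and $\Pi_x=T_y\Sigma_x(y)$, and let $u_1,\dots,u_m$ and $v_1,\dots,v_m$ be positively oriented ordered orthonormal bases of $\Pi_x$ and $\Pi_y$, respectively. The combined angle $\theta_M(x,y)\in[0,\pi]$ is defined by $\cos\theta_M(x,y)=\det(\langle u_i,v_j\rangle)_{1\le i,j\le m}$. Kusner-Sullivan's energy: $$E_{KS}(M)=\iint_{M\times M}\frac{(1-\cos\theta_M(x,y))^m}{|x-y|^{2m}}\,dx\,dy.$$ *)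

(* Defs.v *)
From HB Require Import structures.
From mathcomp Require Import all_boot all_order all_algebra.
From mathcomp Require Import all_classical all_reals all_analysis.

Set Implicit Arguments.
Unset Strict Implicit.
Unset Printing Implicit Defensive.

Import Order.TTheory GRing.Theory Num.Theory.
Import numFieldNormedType.Exports.

Local Open Scope classical_set_scope.
Local Open Scope ring_scope.

(* Points of R^n are row vectors.  The library norm of ['rV[R]_n] is the sup
   norm (same topology), hence the explicit Euclidean norm.                   *)
Definition enorm (R : realType) n (v : 'rV[R]_n) : R :=
  Num.sqrt (\sum_i v ord0 i ^+ 2).

Definition eball (R : realType) n (x : 'rV[R]_n) (r : R) : set 'rV[R]_n :=
  [set y | enorm (y - x) < r].

Definition orthonormal_rows (R : realType) m n (V : 'M[R]_(m, n)) : Prop :=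
  V *m V^T = 1%:M.

(* [partial [:: i1; ..; il] g] is d_{i1} .. d_{il} g.  For C^2 maps and
   l <= 2 these are exactly the d^mu g with |mu| <= 2.                        *)
Definition partial (R : realType) m n (s : seq 'I_m)
    (g : 'rV[R]_m -> 'rV[R]_n) : 'rV[R]_m -> 'rV[R]_n :=
  foldr (fun i h => 'D_(delta_mx ord0 i) h) g s.

Definition C2_on (R : realType) m n (U : set 'rV[R]_m)
    (g : 'rV[R]_m -> 'rV[R]_n) : Prop :=
  [/\ open U,
      forall (s : seq 'I_m) (i : 'I_m) t, (size s < 2)%N -> U t ->
        derivable (partial s g) t (delta_mx ord0 i) &
      forall (s : seq 'I_m) t, (size s <= 2)%N -> U t ->
        {for t, continuous (partial s g)}].

Record chart (R : realType) (m : nat) (M : topologicalType) := Chart {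
  cdom : set M ;
  cfun : M -> 'rV[R]_m ;
  cinv : 'rV[R]_m -> M ;
  cdom_open : open cdom ;
  cimg_open : open (cfun @` cdom) ;
  cfunK : forall p, cdom p -> cinv (cfun p) = p ;
  cfun_continuous : forall p, cdom p -> {for p, continuous cfun} ;
  cinv_continuous : forall t, (cfun @` cdom) t -> {for t, continuous cinv} }.

Definition cimg (R : realType) m (M : topologicalType) (c : chart R m M) :
  set 'rV[R]_m := cfun c @` cdom c.

Definition C2_compatible (R : realType) m (M : topologicalType)
    (c d : chart R m M) : Prop :=
  C2_on (cfun c @` (cdom c `&` cdom d)) (cfun d \o cinv c) /\
  C2_on (cfun d @` (cdom c `&` cdom d)) (cfun c \o cinv d).

(* The carrier is pointed because the library's Borel sigma-algebras need a
   pointed type: closed manifolds are nonempty (not necessarily connected).   *)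
Record closed_manifold (R : realType) (m : nat) := ClosedManifold {
  carrier :> ptopologicalType ;
  atlas : set (chart R m carrier) ;
  carrier_hausdorff : hausdorff_space carrier ;
  carrier_compact : compact [set: carrier] ;
  atlas_cover : forall p, exists2 c, atlas c & cdom c p ;
  atlas_compatible : forall c d, atlas c -> atlas d -> C2_compatible c d }.

(* An orientation is a C^2-compatible atlas with positive transition
   Jacobians.                                                                 *)
Record orientation (R : realType) m (M : closed_manifold R m) := Orientation {
  ocharts : set (chart R m M) ;
  ocharts_compatible : forall c d, ocharts c -> atlas d -> C2_compatible c d ;
  ocharts_cover : forall p, exists2 c, ocharts c & cdom c p ;
  ocharts_positive : forall c d p, ocharts c -> ocharts d ->
    cdom c p -> cdom d p -> 0 < \det ('J (cfun d \o cinv c) (cfun c p)) }.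

Definition C2_mapping (R : realType) m (M N : closed_manifold R m)
    (phi : M -> N) : Prop :=
  continuous phi /\
  forall (c : chart R m M) (d : chart R m N), atlas c -> atlas d ->
    C2_on (cfun c @` (cdom c `&` phi @^-1` cdom d))
          (cfun d \o phi \o cinv c).

Definition C2_diffeo (R : realType) m (M N : closed_manifold R m)
    (phi : M -> N) : Prop :=
  C2_mapping phi /\
  exists psi : N -> M, [/\ C2_mapping psi, cancel phi psi & cancel psi phi].

(* The rows are the d_i (f o c^-1) at c(p): a basis of df(T_pM) if f is an
   immersion.                                                                 *)
Definition tangent_mx (R : realType) m n (M : topologicalType)
    (c : chart R m M) (f : M -> 'rV[R]_n) (p : M) : 'M[R]_(m, n) :=
  'J (f \o cinv c) (cfun c p).

Definition immersion (R : realType) m n (M : closed_manifold R m)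
    (f : M -> 'rV[R]_n) : Prop :=
  forall c : chart R m M, atlas c ->
    C2_on (cimg c) (f \o cinv c) /\
    forall p, cdom c p -> row_free (tangent_mx c f p).

Definition embedding (R : realType) m n (M : closed_manifold R m)
    (f : M -> 'rV[R]_n) : Prop :=
  [/\ immersion f, injective f &
      forall A : set M, open A ->
        exists2 B : set 'rV[R]_n, open B & f @` A = B `&` range f].

(* [f] restricted to [cdom c] is a C^2-diffeomorphism onto its image, as a
   subset of R^n: the inverse, read in the chart [c], has local C^2
   extensions to open subsets of R^n.                                         *)
Definition diffeo_onto_image (R : realType) m n (M : topologicalType)
    (c : chart R m M) (f : M -> 'rV[R]_n) : Prop :=
  [/\ C2_on (cimg c) (f \o cinv c),
      forall p q, cdom c p -> cdom c q -> f p = f q -> p = q &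
      forall p, cdom c p -> exists (B : set 'rV[R]_n)
        (g : 'rV[R]_n -> 'rV[R]_m),
        [/\ B (f p), C2_on B g &
            forall q, cdom c q -> B (f q) -> g (f q) = cfun c q]].

(* [S] is the graph, over a subset [U] of the m-plane through [x] directed by
   the row space of [T], of a C^2 function [h] with values orthogonal to [T]
   whose partial derivatives of order <= 2 with respect to every orthonormal
   system of axes [E] of [T] are bounded by [b].                              *)
Definition bounded_C2_graph (R : realType) m n (b : R) (x : 'rV[R]_n)
    (T : 'M[R]_(m, n)) (S : set 'rV[R]_n) : Prop :=
  exists (U : set 'rV[R]_n) (h : 'rV[R]_n -> 'rV[R]_n),
    [/\ forall u, U u -> (u <= T)%MS,
        forall u, U u -> h u *m T^T = 0,
        S = [set x + u + h u | u in U] &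
        forall E : 'M[R]_(m, n), orthonormal_rows E -> (E == T)%MS ->
          let hE := fun t : 'rV[R]_m => h (t *m E) in
          let UE := [set t : 'rV[R]_m | U (t *m E)] in
          C2_on UE hE /\
          forall (s : seq 'I_m) t, (size s <= 2)%N -> UE t ->
            enorm (partial s hE t) <= b].

(* A C^2-diffeomorphism from W_i to the open unit m-ball is the same as a
   compatible chart with domain W_i and that ball as image.  The tangent plane
   at [x] of a sheet f(W_i) exists only if the sheet passes through [x]; the
   graph condition is imposed on these sheets.                                *)
Definition class_M2 (R : realType) (m n : nat) (eps0 b : R)
    (M' : set 'rV[R]_n) : Prop :=
  exists (M : closed_manifold R m) (f : M -> 'rV[R]_n),
    [/\ immersion f, range f = M' &
    forall x, M' x -> exists (l : nat) (W : 'I_l -> set M),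
      [/\ f @^-1` (eball x eps0 `&` M') = \bigcup_i W i,
          trivIset setT W &
          forall i, exists c : chart R m M,
            [/\ cdom c = W i,
                (forall d, atlas d -> C2_compatible c d),
                cimg c = eball 0 1,
                diffeo_onto_image c f &
                forall p, W i p -> f p = x ->
                  bounded_C2_graph b x (tangent_mx c f p) (f @` W i)]]].

Definition C2_close (R : realType) m n (M : topologicalType)
    (c : chart R m M) (K : set M) (e : R) (f g : M -> 'rV[R]_n) : Prop :=
  forall p (s : seq 'I_m), K p -> (size s <= 2)%N ->
    enorm (partial s (f \o cinv c) (cfun c p) -
           partial s (g \o cinv c) (cfun c p)) < e.

(* Open subsets of Imm(M, R^n) in the compact-open C^2-topology. *)
Definition C2_open (R : realType) m n (M : closed_manifold R m)
    (V : set (M -> 'rV[R]_n)) : Prop :=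
  V `<=` @immersion R m n M /\
  forall f, V f -> exists (l : nat) (c : 'I_l -> chart R m M)
      (K : 'I_l -> set M) (e : 'I_l -> R),
    (forall i, [/\ atlas (c i), compact (K i), K i `<=` cdom (c i)
                 & 0 < e i]) /\
    forall g, immersion g ->
      (forall i, C2_close (c i) (K i) (e i) f g) -> V g.

Definition Diff_invariant (R : realType) m n (M : closed_manifold R m)
    (V : set (M -> 'rV[R]_n)) : Prop :=
  forall f (phi : M -> M), V f -> C2_diffeo phi -> V (f \o phi).

(* Convergence of the classes of the immersions [f k] to the class of [g] in
   the disjoint union of the quotients Imm(M, R^n)/Diff(M): the open sets of
   the quotient are the images of the Diff(M)-invariant open sets [V], and the
   class of [f k] lies in Imm(M, R^n)/Diff(M) iff [N k] is diffeomorphic to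
   [M], in which case it is that of [f k \o phi].                             *)
Definition C2_converges (R : realType) m n
    (N : nat -> closed_manifold R m) (f : forall k, N k -> 'rV[R]_n)
    (M : closed_manifold R m) (g : M -> 'rV[R]_n) : Prop :=
  forall V : set (M -> 'rV[R]_n), C2_open V -> Diff_invariant V -> V g ->
    \forall k \near \oo,
      exists phi : M -> N k, C2_diffeo phi /\ V (@f k \o phi).

Definition positive_tangent_frame (R : realType) m n
    (M : closed_manifold R m) (o : orientation M) (f : M -> 'rV[R]_n) (p : M)
    (V : 'M[R]_(m, n)) : Prop :=
  orthonormal_rows V /\
  exists c, [/\ ocharts o c, cdom c p &
    exists A : 'M[R]_m, 0 < \det A /\ V = A *m tangent_mx c f p].

(* [RoundSphere z r B]: the sphere of centre [z] and radius [r] in the affine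
   (m+1)-space through [z] directed by the rows of [B], oriented as the
   boundary of the ball by the orientation of the basis [B] (outward normal
   first).  [Plane z B]: the m-plane through [z] oriented by the basis [B].   *)
Inductive oriented_sphere (R : realType) (m n : nat) :=
| RoundSphere (z : 'rV[R]_n) (r : R) (B : 'M[R]_(1 + m, n))
    of 0 < r & row_free B
| Plane (z : 'rV[R]_n) (B : 'M[R]_(m, n)) of row_free B.

Definition sphere_points (R : realType) m n (S : oriented_sphere R m n) :
    set 'rV[R]_n :=
  match S with
  | RoundSphere z r B _ _ => [set y | (y - z <= B)%MS /\ enorm (y - z) = r]
  | Plane z B _ => [set y | (y - z <= B)%MS]
  end.

Definition positive_sphere_frame (R : realType) m n
    (S : oriented_sphere R m n) (y : 'rV[R]_n) (U : 'M[R]_(m, n)) : Prop :=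
  orthonormal_rows U /\
  match S with
  | RoundSphere z r B _ _ => U *m (y - z)^T = 0 /\
      exists A : 'M[R]_(1 + m), 0 < \det A /\ col_mx (y - z) U = A *m B
  | Plane z B _ => exists A : 'M[R]_m, 0 < \det A /\ U = A *m B
  end.

Definition is_tangent_sphere (R : realType) m n (M : closed_manifold R m)
    (o : orientation M) (f : M -> 'rV[R]_n) (p q : M)
    (S : oriented_sphere R m n) : Prop :=
  [/\ sphere_points S (f p), sphere_points S (f q) &
      forall U, positive_sphere_frame S (f p) U <->
                positive_tangent_frame o f p U].

Definition combined_angle (R : realType) m n (M : closed_manifold R m)
    (o : orientation M) (f : M -> 'rV[R]_n) (p q : M) : R :=
  get [set theta : R | 0 <= theta <= pi /\
    exists (S : oriented_sphere R m n) (U V : 'M[R]_(m, n)),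
      [/\ is_tangent_sphere o f p q S,
          positive_sphere_frame S (f q) U,
          positive_tangent_frame o f q V &
          cos theta = \det (U *m V^T)]].

Notation borel M := (g_sigma_algebraType (@open M)).

(* Lebesgue integral over R^m of a nonnegative Borel function, as an iterated
   integral (Tonelli).                                                        *)
Fixpoint integral_rV (R : realType) (m : nat) :
    ('rV[R]_m -> \bar R) -> \bar R :=
  match m with
  | 0 => fun g => g 0
  | m'.+1 => fun g => (\int[lebesgue_measure]_(x in [set: R])
      integral_rV (fun t : 'rV[R]_m' =>
        g (row_mx (const_mx x : 'rV[R]_1) t : 'rV[R]_(1 + m'))))%E
  end.

(* The volume measure dx of the immersed submanifold f(M), carried by M: in
   every chart its density is sqrt(det(g_ij)), g_ij = <d_i f, d_j f>.         *)
Definition is_volume_measure (R : realType) m n (M : closed_manifold R m)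
    (f : M -> 'rV[R]_n) (vol : set (borel M) -> \bar R) : Prop :=
  forall (c : chart R m M) (A : set (borel M)),
    atlas c -> measurable A -> A `<=` cdom c ->
    vol A = integral_rV (fun t => (\1_(cfun c @` A) t *
      let J := 'J (f \o cinv c) t in Num.sqrt (\det (J *m J^T)))%:E).

Definition E_KS (R : realType) m n (M : closed_manifold R m)
    (o : orientation M) (f : M -> 'rV[R]_n)
    (vol : {measure set (borel M) -> \bar R}) : \bar R :=
  (\int[vol]_(p in [set: M]) \int[vol]_(q in [set: M])
    ((1 - cos (combined_angle o f p q)) ^+ m /
     enorm (f p - f q) ^+ (2 * m))%:E)%E.

(* Main.v *)
(* Let x, y be points with tangent planes T_x, T_y.  Reflecting T_x in the
   hyperplane bisecting [x, y] gives the tangent plane at y of the tangent sphere,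
   so cos^2 of the combined angle is an expression Gamma(T_x, T_y, y - x) in which
   orientations play no role, and 1 - cos >= (1 - Gamma) / 2.  By Hadamard's
   inequality, Gamma < 1 unless the reflected plane is T_y.

   For large k, M_k contains two disjoint sheets that are C^1-close to two planes
   P1, P2 through the double point.  If P1 <> P2, the chords joining a point of the
   first sheet at distance r from the double point, in a direction of P1 outside
   P2, to the points of the second sheet much closer to the double point stay away
   from Gamma = 1.  If P1 = P2, let d be the distance from x to the second
   sheet: the chords from x to the points at tangential distance about d from the
   point nearest to x do so.  In both cases the pairs (x, y) with x in a shell of
   radius r contribute to the energy an amount bounded below independently of r,
   and the number of disjoint dyadic shells available tends to infinity with k. *)
Require Import Defs.
From mathcomp Require Import all_boot all_order all_algebra.
From mathcomp Require Import all_classical all_reals all_analysis.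
From mathcomp Require Import measurable_realfun ring lra.

Set Implicit Arguments.
Unset Strict Implicit.
Unset Printing Implicit Defensive.

Import Order.TTheory GRing.Theory Num.Theory.
Import numFieldNormedType.Exports.

Local Open Scope classical_set_scope.
Local Open Scope ring_scope.

(** Convergence of classes modulo reparametrisation provides no converging representatives, so all
    information is packed into one set of immersions, [near_double], which is open, invariant under
    diffeomorphisms and contains the limit. The order of the constants makes this work: the
    tolerance [eps] on tangent planes comes from the two planes alone, the radius [rho] of the
    sheets from the limit immersion, then the number of shells from the required energy, and only
    then the displacement [eta] of the sheets, which must be small against the smallest shell.
    Integrals are bounded below only through constants on disjoint measurable sets, since nothing is
    known about the measurability of the combined angle, which is defined by a choice. Accordingly
    volumes are estimated from below only, by an ellipsoid in one chart and then by subdivision,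
    without any change of variables formula. The sup norm and the Euclidean norm coexist: sup-norm
    balls are boxes, which suits coordinatewise estimates, while orthogonality needs the Euclidean
    norm. The comparison costs factors depending on [n] only. *)

Section LinearAlgebra.
Context {R : realType}.

(** * Gram matrices, Hadamard's inequality and contractions *)

Definition qform m (S : 'M[R]_m) (v : 'rV[R]_m) : R := (v *m S *m v^T) ord0 ord0.

Definition sqn n (v : 'rV[R]_n) : R := (v *m v^T) ord0 ord0.

Definition posdef m (S : 'M[R]_m) :=
  S^T = S /\ forall v, v != 0 -> 0 < qform S v.

Lemma sqnE n (v : 'rV[R]_n) : sqn v = \sum_i v ord0 i ^+ 2.
Proof. by rewrite /sqn mxE; apply: eq_bigr => i _; rewrite mxE expr2. Qed.

Lemma sqn_ge0 n (v : 'rV[R]_n) : 0 <= sqn v.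
Proof. by rewrite sqnE sumr_ge0// => i _; rewrite sqr_ge0. Qed.

Lemma sqn_eq0 n (v : 'rV[R]_n) : (sqn v == 0) = (v == 0).
Proof.
apply/eqP/eqP => [|->]; last by rewrite /sqn mul0mx mxE.
rewrite sqnE => /eqP; rewrite psumr_eq0 => [/allP v0|i _]; last exact: sqr_ge0.
apply/rowP => i; rewrite mxE; apply/eqP.
by have := v0 i (mem_index_enum _); rewrite sqrf_eq0.
Qed.

Lemma sqn_gt0 n (v : 'rV[R]_n) : (0 < sqn v) = (v != 0).
Proof. by rewrite lt_def sqn_ge0 andbT sqn_eq0. Qed.

Lemma sqn_mul m n (v : 'rV[R]_m) (J : 'M[R]_(m, n)) :
  sqn (v *m J) = qform (J *m J^T) v.
Proof. by rewrite /sqn /qform trmx_mul !mulmxA. Qed.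

Lemma qform_conj m n (S : 'M[R]_n) (B : 'M[R]_(m, n)) (v : 'rV_m) :
  qform (B *m S *m B^T) v = qform S (v *m B).
Proof. by rewrite /qform trmx_mul !mulmxA. Qed.

Lemma enormE n (v : 'rV[R]_n) : enorm v = Num.sqrt (sqn v).
Proof. by rewrite /enorm sqnE. Qed.

Lemma posdef_gram m n (J : 'M[R]_(m, n)) : row_free J -> posdef (J *m J^T).
Proof.
move=> Jfree; split=> [|v v0]; first by rewrite trmx_mul trmxK.
by rewrite -sqn_mul sqn_gt0 -(mul0mx _ J) (inj_eq (row_free_inj Jfree)).
Qed.

Lemma posdef_drsub m (S : 'M[R]_(1 + m)) : posdef S -> posdef (drsubmx S).
Proof.
move=> [Ssym Spos]; split=> [|v v0].
  by rewrite -[in RHS]Ssym trmx_drsub.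
have : row_mx 0 v != 0 :> 'rV[R]_(1 + m).
  by apply: contra v0 => /eqP; rewrite -row_mx0 => /eq_row_mx[_ ->].
move/Spos; rewrite /qform -[S in X in X -> _]submxK mul_row_block !mul0mx !add0r.
by rewrite tr_row_mx mul_row_col trmx0 mulmx0 add0r.
Qed.

Lemma posdef_unit m (S : 'M[R]_m) : posdef S -> S \in unitmx.
Proof.
move=> [_ Spos]; rewrite -row_free_unit; apply/row_freeP.
suff Sfree : row_free S by exact/row_freeP.
rewrite -kermx_eq0; apply/eqP/row_matrixP => i; rewrite row0.
apply/eqP/negPn/negP => /Spos; rewrite /qform -row_mul mulmx_ker row0 mul0mx mxE.
by rewrite ltxx.
Qed.

(** Elimination of the first variable: with [g] the off-diagonal block times the inverse of [S'],
    the Schur complement [s] is the value of the form at (1, -g), hence positive, and the corner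
    exceeds it by [g S' g^T], a value of the form of [S']. *)
Lemma posdef_schur m (S : 'M[R]_(1 + m)) : posdef S ->
  exists s (g : 'rV_m), [/\ 0 < s, s <= S ord0 ord0 &
    S = block_mx 1%:M g 0 1%:M *m block_mx s%:M 0 0 (drsubmx S) *m
        (block_mx 1%:M g 0 1%:M)^T].
Proof.
move=> Spd; have [Ssym Spos] := Spd.
set S' := drsubmx S; pose g := ursubmx S *m invmx S'.
pose s := (ulsubmx S - g *m S' *m g^T) ord0 ord0.
have S'u : S' \in unitmx by apply/posdef_unit/posdef_drsub.
have S'sym : S'^T = S' by have [] := posdef_drsub Spd.
have gS : g *m S' = ursubmx S by rewrite mulmxKV.
have dl : dlsubmx S = S' *m g^T.
  by rewrite -[in LHS]Ssym -trmx_ursub -gS trmx_mul S'sym.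
have sE : ulsubmx S = s%:M + g *m S' *m g^T.
  by rewrite -mx11_scalar subrK.
exists s, g; split.
- have -> : s = qform S (row_mx 1%:M (- g)).
    rewrite /qform -[S in row_mx _ _ *m S]submxK mul_row_block dl !mul1mx.
    rewrite -/S' tr_row_mx mul_row_col !linearN/= !mulNmx !mulmxA gS.
    by rewrite subrr mul0mx oppr0 addr0 trmx1 mulmx1 /s gS.
  apply: Spos; apply/negP => /eqP; rewrite -row_mx0.
  move=> /eq_row_mx[/matrixP/(_ ord0 ord0)].
  by rewrite !mxE => /eqP; rewrite oner_eq0.
- have -> : S ord0 ord0 = ulsubmx S ord0 ord0.
    by rewrite !mxE; congr (S _ _); apply: val_inj.
  rewrite sE [leRHS]mxE mxE/= mulr1n lerDl.
  have [/eqP g0|g0] := eqVneq g 0.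
    by rewrite (eqP g0) !mul0mx mxE.
  by have [_ /(_ _ g0)/ltW] := posdef_drsub Spd.
- rewrite mulmx_block !mul1mx !mulmx0 !mul0mx !addr0 !add0r tr_block_mx.
  rewrite mulmx_block !trmx1 !trmx0 !mulmx1 !mulmx0 !add0r gS -dl.
  by rewrite -[LHS]submxK sE -/S' gS.
Qed.

(** Completing the square. The determinant identity drives inductions on the size, and the last
    formula later describes the slices of an ellipsoid at a fixed first coordinate. *)
Lemma posdef_det_schur m (S : 'M[R]_(1 + m)) : posdef S ->
  exists s (g : 'rV_m), [/\ 0 < s, s <= S ord0 ord0,
    \det S = s * \det (drsubmx S) &
    forall x t, qform S (row_mx x%:M t) =
      s * x ^+ 2 + qform (drsubmx S) (t + x *: g)].
Proof.
move=> Spd; have [s [g [s0 sS SE]]] := posdef_schur Spd.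
exists s, g; split=> //.
- rewrite [in LHS]SE !det_mulmx det_tr !det_ublock !det1 !mul1r mulr1.
  by rewrite det_scalar1.
- move=> x t; rewrite [in LHS]SE qform_conj mul_row_block mulmx0 !mulmx1 addr0.
  rewrite mul_scalar_mx addrC /qform mul_row_block !mulmx0 add0r addr0.
  rewrite tr_row_mx mul_row_col tr_scalar_mx -!scalar_mxM mxE mxE/= mulr1n.
  by rewrite mulrAC -expr2 mulrC.
Qed.

Lemma posdef_det_gt0 m (S : 'M[R]_m) : posdef S -> 0 < \det S.
Proof.
elim: m S => [S _|m IH S Spd]; first by rewrite det_mx00.
have [s [g [s0 _ -> _]]] := @posdef_det_schur m S Spd.
by rewrite mulr_gt0// IH//; exact: posdef_drsub.
Qed.

(** Each elimination splits off a factor [s] that is at most the corner entry. *)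
Lemma hadamard m (S : 'M[R]_m) : posdef S -> \det S <= \prod_i S i i.
Proof.
elim: m S => [S _|m IH S Spd]; first by rewrite det_mx00 big_ord0.
have [s [g [s0 sS -> _]]] := @posdef_det_schur m S Spd.
have S'pd := posdef_drsub (Spd : @posdef (1 + m) S).
rewrite big_ord_recl ler_pM ?(ltW s0) ?(ltW (posdef_det_gt0 S'pd))//.
apply: le_trans (IH _ S'pd) _; rewrite le_eqVlt; apply/orP; left; apply/eqP/eq_bigr => i _.
by rewrite !mxE; congr (S _ _); apply: val_inj.
Qed.

(** Gram-Schmidt for the form [S], built from the last row upwards; the positive determinant is what
    preserves orientations. *)
Lemma posdef_orthonormalize m (S : 'M[R]_m) : posdef S ->
  exists2 A : 'M[R]_m, 0 < \det A & A *m S *m A^T = 1%:M.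
Proof.
elim: m S => [S _|m IH S Spd].
  by exists 1%:M; [rewrite det1|apply/matrixP; case].
have [s [g [s0 _ SE]]] := @posdef_schur m S Spd.
have [A' A'0 A'E] := IH _ (posdef_drsub (Spd : @posdef (1 + m) S)).
pose r := (Num.sqrt s)^-1.
have r0 : 0 < r by rewrite invr_gt0 sqrtr_gt0.
pose D : 'M[R]_(1 + m) := block_mx r%:M 0 0 A'.
pose U : 'M[R]_(1 + m) := block_mx 1%:M (- g) 0 1%:M.
exists (D *m U).
  by rewrite -[m.+1]/(1 + m)%N det_mulmx !det_ublock !det1 det_scalar1 !mulr1 mulr_gt0.
have UK : U *m block_mx 1%:M g 0 1%:M = 1%:M.
  rewrite mulmx_block !mulmx1 !mul1mx !mulmx0 !mul0mx !addr0 !add0r subrr.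
  by rewrite -scalar_mx_block.
rewrite SE trmx_mul !mulmxA -[D *m U *m _]mulmxA UK mulmx1.
rewrite -!mulmxA [_^T *m (U^T *m _)]mulmxA -trmx_mul UK trmx1 mul1mx.
rewrite /D -[m.+1]/(1 + m)%N tr_block_mx !mulmx_block !trmx0 !mulmx0 !mul0mx !addr0 !add0r.
rewrite tr_scalar_mx -!scalar_mxM mulmxA A'E [X in block_mx X%:M](_ : _ = 1).
  by rewrite !mulmx0 -scalar_mx_block.
by rewrite mulrCA -expr2 /r exprVn sqr_sqrtr ?(ltW s0)// mulfV// gt_eqF.
Qed.

Lemma orthonormal_basis m n (J : 'M[R]_(m, n)) : row_free J ->
  exists2 A : 'M[R]_m, 0 < \det A & orthonormal_rows (A *m J).
Proof.
move=> /posdef_gram/posdef_orthonormalize[A A0 AE]; exists A => //.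
by rewrite /orthonormal_rows trmx_mul mulmxA -[A *m J *m _]mulmxA.
Qed.

Lemma sqn_orthonormal m n (V : 'M[R]_(m, n)) (v : 'rV_m) :
  orthonormal_rows V -> sqn (v *m V) = sqn v.
Proof. by move=> VV; rewrite sqn_mul VV /qform mulmx1. Qed.

(** [x V^T V] is the orthogonal projection of [x] on the row space, so Pythagoras applies. *)
Lemma bessel m n (V : 'M[R]_(m, n)) (x : 'rV_n) : orthonormal_rows V ->
  sqn x = sqn (x *m V^T) + sqn (x - x *m V^T *m V).
Proof.
move=> VV; rewrite -(sqn_orthonormal (x *m V^T) VV).
set y := x *m V^T *m V.
have yx : y *m (x - y)^T = 0.
  rewrite linearB/= mulmxBr /y !trmx_mul trmxK !mulmxA.
  by rewrite -[x *m V^T *m V *m V^T]mulmxA VV mulmx1 subrr.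
have xy : (x - y) *m y^T = 0 by rewrite -[LHS]trmxK trmx_mul trmxK yx trmx0.
rewrite -{1}(subrK y x) /sqn linearD/= mulmxDl !mulmxDr xy addr0 yx add0r.
by rewrite mxE addrC.
Qed.

Lemma sqn_proj_le m n (V : 'M[R]_(m, n)) (x : 'rV_n) : orthonormal_rows V ->
  sqn (x *m V^T) <= sqn x ?= iff (x <= V)%MS.
Proof.
move=> VV; apply/leifP; rewrite [in X in _ == X](bessel x VV) [in X in _ < X](bessel x VV).
have [/submxP[y ->]|xV] := boolP (x <= V)%MS.
  by rewrite -[y *m V *m V^T]mulmxA VV mulmx1 subrr [X in _ + X](_ : _ = 0) ?addr0 // /sqn mul0mx mxE.
rewrite ltrDl sqn_gt0 subr_eq0; apply: contra xV => /eqP ->.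
exact: submxMl.
Qed.

(** By Hadamard, the determinant of [C C^T] is at most the product of its diagonal entries, which
    are the squared lengths of the projections on the row space of [V] of the unit rows of [U]. One
    row outside that space makes its factor smaller than 1. *)
Lemma det_contraction m n (U V : 'M[R]_(m, n)) :
  orthonormal_rows U -> orthonormal_rows V ->
  \det (U *m V^T) ^+ 2 <= 1 ?= iff (U <= V)%MS.
Proof.
move=> UU VV; set C := U *m V^T.
have Cii i : (C *m C^T) i i = sqn (row i U *m V^T).
  by rewrite -row_mul sqnE mxE; apply: eq_bigr => j _; rewrite !mxE expr2.
have U1 i : sqn (row i U) = 1.
  have : (U *m U^T) i i = 1 by rewrite (UU : U *m U^T = 1%:M) mxE eqxx.
  by rewrite mxE sqnE => <-; apply: eq_bigr => j _; rewrite !mxE expr2.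
have det2 : \det C ^+ 2 = \det (C *m C^T) by rewrite det_mulmx det_tr expr2.
have Cle i : 0 <= (C *m C^T) i i <= 1.
  by rewrite Cii sqn_ge0/= -(U1 i); exact: (sqn_proj_le _ VV).
have detle : \det C != 0 -> \det C ^+ 2 <= \prod_i (C *m C^T) i i.
  move=> C0; rewrite det2; apply/hadamard/posdef_gram.
  by rewrite row_free_unit unitmxE unitfE.
apply/leifP; case: ifPn => [|UV].
  case/submxP => D UD; have CD : C = D by rewrite /C UD -mulmxA VV mulmx1.
  have : D *m D^T = 1%:M by rewrite -UU UD trmx_mul mulmxA -[D *m V *m _]mulmxA VV mulmx1.
  by rewrite -CD det2 => ->; rewrite det1.
(* Hadamard is available for positive definite matrices only; a singular [C] gives 0, which is below
   1 anyway. *)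
have [->|C0] := eqVneq (\det C) 0; first by rewrite expr0n ltr01.
apply: (le_lt_trans (detle C0)).
have [i Ui] : exists i, ~~ (row i U <= V)%MS.
  by apply/existsP; rewrite -negb_forall; apply: contra UV => /forallP/row_subP.
rewrite (bigD1 i)//=; apply: (@le_lt_trans _ _ ((C *m C^T) i i)).
  rewrite ler_piMr//; first by case/andP: (Cle i).
  by apply: prodr_ile1 => j _; exact: Cle.
by rewrite Cii -(U1 i) (lt_leif (sqn_proj_le _ VV)).
Qed.

End LinearAlgebra.

(** * Reflections and the squared cosine [Gamma] *)

Section Gamma.
Context {R : realType}.

(** The Householder reflection in the hyperplane orthogonal to [w]; for [w = 0] the convention on
    division makes it the identity. *)
Definition refl n (w : 'rV[R]_n) : 'M[R]_n := 1%:M - (2 / sqn w) *: (w^T *m w).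

Definition dotp n (u v : 'rV[R]_n) : R := (u *m v^T) ord0 ord0.

Lemma dotpC n (u v : 'rV[R]_n) : dotp u v = dotp v u.
Proof. by rewrite /dotp -[u *m v^T]trmxK trmx_mul trmxK mxE. Qed.

Lemma dotpE n (u v : 'rV[R]_n) : u *m v^T = (dotp u v)%:M.
Proof. exact: mx11_scalar. Qed.

Lemma mul_refl n (u w : 'rV[R]_n) :
  u *m refl w = u - (2 / sqn w * dotp u w) *: w.
Proof.
rewrite /refl mulmxBr mulmx1 -scalemxAr mulmxA dotpE mul_scalar_mx.
by rewrite scalerA.
Qed.

Lemma refl_self n (w : 'rV[R]_n) : w != 0 -> w *m refl w = - w.
Proof.
move=> w0; rewrite mul_refl /dotp -/(sqn w) divfK ?sqn_eq0//.
by rewrite scaler_nat mulr2n opprD addrA subrr sub0r.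
Qed.

Lemma tr_refl n (w : 'rV[R]_n) : (refl w)^T = refl w.
Proof. by rewrite /refl linearB/= trmx1 linearZ/= trmx_mul trmxK. Qed.

Lemma refl_inv n (w : 'rV[R]_n) : w != 0 -> refl w *m refl w = 1%:M.
Proof.
move=> w0; rewrite {1}/refl mulmxBl mul1mx -scalemxAl -mulmxA refl_self//.
by rewrite mulmxN scalerN opprK subrK.
Qed.

Lemma dotpZl n (c : R) (u v : 'rV[R]_n) : dotp (c *: u) v = c * dotp u v.
Proof. by rewrite /dotp -scalemxAl mxE. Qed.

Lemma dotpZr n (c : R) (u v : 'rV[R]_n) : dotp u (c *: v) = c * dotp u v.
Proof. by rewrite dotpC dotpZl dotpC. Qed.

Lemma dotpDl n (u v w : 'rV[R]_n) : dotp (u + v) w = dotp u w + dotp v w.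
Proof. by rewrite /dotp mulmxDl mxE. Qed.

Lemma dotpDr n (u v w : 'rV[R]_n) : dotp w (u + v) = dotp w u + dotp w v.
Proof. by rewrite dotpC dotpDl !(dotpC w). Qed.

Lemma dotpNl n (u v : 'rV[R]_n) : dotp (- u) v = - dotp u v.
Proof. by rewrite -scaleN1r dotpZl mulN1r. Qed.

Lemma dotpNr n (u v : 'rV[R]_n) : dotp u (- v) = - dotp u v.
Proof. by rewrite dotpC dotpNl dotpC. Qed.

Definition dotpE' := (dotpDl, dotpDr, dotpNl, dotpNr, dotpZl, dotpZr).

Lemma sqn_dotp n (u : 'rV[R]_n) : sqn u = dotp u u. Proof. by []. Qed.

Lemma refl_scale n (c : R) (w : 'rV[R]_n) : c != 0 -> refl (c *: w) = refl w.
Proof.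
move=> c0; rewrite /refl sqn_dotp dotpZl dotpZr -scalemxAr [(c *: w)^T]linearZ -scalemxAl.
rewrite !scalerA -sqn_dotp; congr (_ - _ *: _).
have [->|s0] := eqVneq (sqn w) 0; first by rewrite !mulr0 !invr0 !mulr0 !mul0r.
by field; rewrite s0 c0.
Qed.

(** For vectors of equal length, [b - a] has squared length [-2 <a, b - a>], so the coefficient in
    the reflection formula is -1. *)
Lemma refl_swap n (a b : 'rV[R]_n) : sqn a = sqn b -> b - a != 0 ->
  a *m refl (b - a) = b.
Proof.
move=> ab w0; have E : sqn (b - a) = - 2 * dotp a (b - a).
  by move: ab; rewrite !sqn_dotp !dotpE' [dotp b a]dotpC => <-; ring.
have s0 := w0; rewrite -sqn_eq0 in s0.
have d0 : dotp a (b - a) != 0 by apply: contra s0 => /eqP d0; rewrite E d0 mulr0.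
rewrite mul_refl (_ : _ * dotp _ _ = -1); last by rewrite E; field.
by rewrite scaleN1r opprK addrC subrK.
Qed.

(* If [J1], [J2] span the tangent spaces at x, y and [w = y - x], this is the
   squared cosine of the combined angle: the reflection in the hyperplane
   bisecting [x, y] preserves the tangent sphere at x through y and exchanges
   x and y, so it maps T_xM to the tangent space of that sphere at y. *)
Definition Gamma m n (J1 J2 : 'M[R]_(m, n)) (w : 'rV[R]_n) : R :=
  \det (J1 *m refl w *m J2^T) ^+ 2 / (\det (J1 *m J1^T) * \det (J2 *m J2^T)).

Lemma Gamma_orthonormal m n (J1 J2 : 'M[R]_(m, n)) (A B : 'M[R]_m) w :
  orthonormal_rows (A *m J1) -> orthonormal_rows (B *m J2) ->
  Gamma J1 J2 w = \det (A *m J1 *m refl w *m (B *m J2)^T) ^+ 2.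
Proof.
have detE (C : 'M[R]_m) (J : 'M[R]_(m, n)) : orthonormal_rows (C *m J) ->
    \det C ^+ 2 * \det (J *m J^T) = 1.
  rewrite /orthonormal_rows trmx_mul mulmxA -[C *m J *m _]mulmxA.
  move=> /(congr1 determinant); rewrite det1 !det_mulmx det_tr => <-; ring.
move=> /detE A1 /detE B1; rewrite /Gamma.
have -> : A *m J1 *m refl w *m (B *m J2)^T =
    A *m (J1 *m refl w *m J2^T) *m B^T by rewrite trmx_mul !mulmxA.
set C := J1 *m refl w *m J2^T; rewrite !det_mulmx det_tr.
move: A1 B1; set a := \det (J1 *m _); set b := \det (J2 *m _) => A1 B1.
have a0 : a != 0 by apply/eqP => a0; move/eqP: A1; rewrite a0 mulr0 eq_sym oner_eq0.
have b0 : b != 0 by apply/eqP => b0; move/eqP: B1; rewrite b0 mulr0 eq_sym oner_eq0.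
rewrite !exprMn -[LHS]mulr1 -[X in _ * X]mulr1 -{1}A1 -B1; field.
by rewrite a0 b0.
Qed.

(** Changes of basis multiply numerator and denominator by the same squares, so only the row spaces
    matter. If a Gram determinant vanishes, both sides are 0 by the convention on division. *)
Lemma Gamma_unitmx m n (J1 J2 : 'M[R]_(m, n)) (A B : 'M[R]_m) w :
  A \in unitmx -> B \in unitmx -> Gamma (A *m J1) (B *m J2) w = Gamma J1 J2 w.
Proof.
rewrite !unitmxE !unitfE => A0 B0; rewrite /Gamma.
have -> : A *m J1 *m refl w *m (B *m J2)^T =
    A *m (J1 *m refl w *m J2^T) *m B^T by rewrite trmx_mul !mulmxA.
have gramE (D : 'M[R]_m) (J : 'M[R]_(m, n)) :
    D *m J *m (D *m J)^T = D *m (J *m J^T) *m D^T by rewrite trmx_mul !mulmxA.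
rewrite !gramE !det_mulmx !det_tr; set a := \det A; set b := \det B.
have [z|a0] := eqVneq (\det (J1 *m J1^T)) 0.
  by rewrite z !(mulr0, mul0r) invr0 !mulr0.
have [z|b0] := eqVneq (\det (J2 *m J2^T)) 0.
  by rewrite z !(mulr0, mul0r) invr0 !mulr0.
by field; rewrite a0 b0 A0 B0.
Qed.

(** The equality case of [det_contraction]: after orthonormalisation of both bases, the reflected
    first frame is again orthonormal. *)
Lemma Gamma_lt1 m n (J1 J2 : 'M[R]_(m, n)) w : row_free J1 -> row_free J2 ->
  w != 0 -> ~~ (J1 *m refl w <= J2)%MS -> Gamma J1 J2 w < 1.
Proof.
move=> /orthonormal_basis[A A0 AJ] /orthonormal_basis[B B0 BJ] w0 J12.
rewrite (Gamma_orthonormal w AJ BJ).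
have AJR : orthonormal_rows (A *m J1 *m refl w).
  rewrite /orthonormal_rows trmx_mul tr_refl mulmxA -[_ *m refl w *m refl w]mulmxA.
  by rewrite refl_inv// mulmx1.
rewrite (lt_leif (det_contraction AJR BJ)); apply: contra J12 => AJB.
have Au : A \in unitmx by rewrite unitmxE unitfE gt_eqF.
have -> : J1 *m refl w = invmx A *m (A *m J1 *m refl w).
  by rewrite !mulmxA mulVmx// mul1mx.
exact: submx_trans (submxMl _ _) (submx_trans AJB (submxMl _ _)).
Qed.

(** The reflection reverses its own direction [b], so the reflected first plane still contains [b]
    and cannot be the second plane. *)
Lemma Gamma_tangent_lt1 m n (J1 J2 : 'M[R]_(m, n)) b :
  row_free J1 -> row_free J2 -> (b <= J1)%MS -> ~~ (b <= J2)%MS ->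
  Gamma J1 J2 b < 1.
Proof.
move=> J1f J2f bJ1 bJ2.
have b0 : b != 0 by apply: contra bJ2 => /eqP ->; exact: sub0mx.
apply: Gamma_lt1 => //; apply: contra bJ2 => J12.
have : (b *m refl b <= J2)%MS by apply: submx_trans J12; exact: submxMr.
by rewrite refl_self// eqmx_opp.
Qed.

(** The reflection sends [t] to [t - c (v + t)] with [c > 0]. If the reflected plane were the second
    one, subtracting tangent vectors would put the nonzero normal vector [v] into it. *)
Lemma Gamma_oblique_lt1 m n (J1 J2 : 'M[R]_(m, n)) (v t : 'rV[R]_n) :
  row_free J1 -> row_free J2 -> v != 0 -> v *m J2^T = 0 -> t != 0 ->
  (t <= J1)%MS -> (t <= J2)%MS -> Gamma J1 J2 (v + t) < 1.
Proof.
move=> J1f J2f v0 vJ t0 tJ1 tJ2.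
have vt : dotp v t = 0.
  by case/submxP: tJ2 => x ->; rewrite /dotp trmx_mul mulmxA vJ mul0mx mxE.
have w2 : sqn (v + t) = sqn v + sqn t.
  by rewrite !sqn_dotp !dotpE' vt dotpC vt addr0 add0r.
have w0 : 0 < sqn (v + t) by rewrite w2 addr_gt0 ?sqn_gt0.
apply: Gamma_lt1 => //; first by rewrite -sqn_gt0.
apply/negP => J12; case/eqP: v0.
have : (t *m refl (v + t) <= J2)%MS by apply: submx_trans J12; exact: submxMr.
rewrite mul_refl !dotpE' [dotp t v]dotpC vt add0r -sqn_dotp.
set c := _ * _ => tc.
have c0 : c != 0 by rewrite gt_eqF// mulr_gt0 ?sqn_gt0// divr_gt0.
have cv : (c *: v <= J2)%MS.
  have -> : c *: v = t - c *: t - (t - c *: (v + t)).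
    by apply/rowP => i; rewrite !mxE; ring.
  by rewrite addmx_sub ?eqmx_opp// addmx_sub ?eqmx_opp// scalemx_sub.
have {cv} : (v <= J2)%MS by rewrite -(eqmx_scale _ c0).
case/submxP=> x vx; apply/eqP; rewrite -sqn_eq0 /sqn {2}vx.
by rewrite trmx_mul mulmxA vJ mul0mx mxE.
Qed.

End Gamma.

(** * Continuity of matrix expressions and of [Gamma] *)

Section MatrixLimits.
Context {R : realType} {T : Type} {F : set_system T} {FF : Filter F}.

Lemma cvg_mx_coord m n (f : T -> 'M[R]_(m, n)) (A : 'M[R]_(m, n)) :
  (forall i j, f x i j @[x --> F] --> A i j) -> f x @[x --> F] --> A.
Proof.
move=> fA; apply/cvgrPdist_le => /= e e0; near=> x.
rewrite /Num.Def.normr/= mx_normrE (bigmax_le _ (ltW e0))//= => ij _.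
rewrite !mxE; move: ij; near: x; apply: filter_forall => /= ij.
exact: ((cvgrPdist_le _ _).1 (fA ij.1 ij.2)).
Unshelve. all: by end_near. Qed.

Lemma cvg_coord m n (f : T -> 'M[R]_(m, n)) (A : 'M[R]_(m, n)) i j :
  f x @[x --> F] --> A -> f x i j @[x --> F] --> A i j.
Proof.
move=> fA; apply: (@cvg_comp _ _ _ f (fun M : 'M[R]_(m, n) => M i j) _ _ _ fA).
exact: coord_continuous.
Qed.

Lemma cvg_sumr (I : Type) (r : seq I) (P : pred I) (f : I -> T -> R) (a : I -> R) :
  (forall i, P i -> f i x @[x --> F] --> a i) ->
  (\sum_(i <- r | P i) f i x) @[x --> F] --> \sum_(i <- r | P i) a i.
Proof. by move=> fa; apply: cvg_big => //; exact: add_continuous. Qed.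

Lemma cvg_prodr (I : Type) (r : seq I) (P : pred I) (f : I -> T -> R) (a : I -> R) :
  (forall i, P i -> f i x @[x --> F] --> a i) ->
  (\prod_(i <- r | P i) f i x) @[x --> F] --> \prod_(i <- r | P i) a i.
Proof. by move=> fa; apply: cvg_big => //; exact: mul_continuous. Qed.

Lemma cvg_mulmx m n p (f : T -> 'M[R]_(m, n)) (g : T -> 'M[R]_(n, p))
    (A : 'M[R]_(m, n)) (B : 'M[R]_(n, p)) :
  f x @[x --> F] --> A -> g x @[x --> F] --> B ->
  (f x *m g x) @[x --> F] --> A *m B.
Proof.
move=> fA gB; apply: cvg_mx_coord => i j.
under eq_cvg do rewrite mxE; rewrite mxE.
by apply: cvg_sumr => k _; apply: cvgM; exact: cvg_coord.
Qed.

Lemma cvg_trmx m n (f : T -> 'M[R]_(m, n)) (A : 'M[R]_(m, n)) :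
  f x @[x --> F] --> A -> (f x)^T @[x --> F] --> A^T.
Proof.
move=> fA; apply: cvg_mx_coord => i j.
under eq_cvg do rewrite mxE; rewrite mxE; exact: cvg_coord.
Qed.

Lemma cvg_det m (f : T -> 'M[R]_m) (A : 'M[R]_m) :
  f x @[x --> F] --> A -> \det (f x) @[x --> F] --> \det A.
Proof.
move=> fA; apply: cvg_sumr => s _; apply: cvgM; first exact: cvg_cst.
by apply: cvg_prodr => k _; exact: cvg_coord.
Qed.

Lemma cvg_sqn n (f : T -> 'rV[R]_n) (v : 'rV[R]_n) :
  f x @[x --> F] --> v -> sqn (f x) @[x --> F] --> sqn v.
Proof. by move=> fv; apply: cvg_coord; apply: cvg_mulmx => //; exact: cvg_trmx. Qed.

Lemma cvg_refl n (f : T -> 'rV[R]_n) (v : 'rV[R]_n) : v != 0 ->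
  f x @[x --> F] --> v -> refl (f x) @[x --> F] --> refl v.
Proof.
move=> v0 fv; apply: cvgB; first exact: cvg_cst.
apply: cvgZ; last by apply: cvg_mulmx => //; exact: cvg_trmx.
by apply: cvgM; [exact: cvg_cst|apply: cvgV; [rewrite sqn_eq0|exact: cvg_sqn]].
Qed.

Lemma cvg_Gamma m n (f g : T -> 'M[R]_(m, n)) (h : T -> 'rV[R]_n)
    (A B : 'M[R]_(m, n)) (v : 'rV[R]_n) :
  row_free A -> row_free B -> v != 0 ->
  f x @[x --> F] --> A -> g x @[x --> F] --> B -> h x @[x --> F] --> v ->
  Gamma (f x) (g x) (h x) @[x --> F] --> Gamma A B v.
Proof.
move=> Af Bf v0 fA gB hv; apply: cvgM.
  under eq_cvg do rewrite expr2; rewrite expr2.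
  have ? : \det (f x *m refl (h x) *m (g x)^T) @[x --> F] -->
      \det (A *m refl v *m B^T).
    apply: cvg_det; apply: cvg_mulmx; last exact: cvg_trmx.
    by apply: cvg_mulmx => //; exact: cvg_refl.
  exact: cvgM.
apply: cvgV.
  by rewrite mulf_neq0// gt_eqF// posdef_det_gt0//; exact: posdef_gram.
by apply: cvgM; apply: cvg_det; apply: cvg_mulmx => //; exact: cvg_trmx.
Qed.

End MatrixLimits.

(** * Comparison of the sup norm with the Euclidean norm *)

Section Norms.
Context {R : realType}.

Lemma mx_norm_coord m n (A : 'M[R]_(m, n)) i j : `|A i j| <= `|A|.
Proof.
rewrite [leRHS]/Num.Def.normr/= mx_normrE.
exact: (@le_bigmax _ _ _ 0 (fun ij => `|A ij.1 ij.2|) (i, j)).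
Qed.

Lemma mx_norm_le m n (A : 'M[R]_(m, n)) e : 0 <= e ->
  (forall i j, `|A i j| <= e) -> `|A| <= e.
Proof. by move=> e0 Ae; rewrite /Num.Def.normr/= mx_normrE bigmax_le. Qed.

Lemma mx_norm_lt m n (A : 'M[R]_(m, n)) e : 0 < e ->
  (forall i j, `|A i j| < e) -> `|A| < e.
Proof. by move=> e0 Ae; rewrite /Num.Def.normr/= mx_normrE; apply/bigmax_ltP. Qed.

Lemma mx_norm_mul m n p (A : 'M[R]_(m, n)) (B : 'M[R]_(n, p)) :
  `|A *m B| <= n%:R * `|A| * `|B|.
Proof.
apply: mx_norm_le => [|i j]; first by rewrite !mulr_ge0.
rewrite mxE; apply: (le_trans (ler_norm_sum _ _ _)).
rewrite -mulrA mulr_natl -[X in _ *+ X]card_ord -sumr_const.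
by apply: ler_sum => k _; rewrite normrM ler_pM ?mx_norm_coord.
Qed.

Lemma sqn_le n (v : 'rV[R]_n) : sqn v <= n%:R * `|v| ^+ 2.
Proof.
rewrite sqnE mulr_natl -[X in _ *+ X]card_ord -sumr_const; apply: ler_sum => i _.
by rewrite -real_normK ?num_real// lerXn2r ?nnegrE ?mx_norm_coord.
Qed.

Lemma norm_sqr_le_sqn n (v : 'rV[R]_n) : `|v| ^+ 2 <= sqn v.
Proof.
rewrite -ler_sqrt ?sqn_ge0// sqrtr_sqr normr_id.
apply: mx_norm_le => [|i j]; first exact: sqrtr_ge0.
rewrite (ord1 i) -sqrtr_sqr ler_wsqrtr// sqnE (bigD1 j)//= lerDl sumr_ge0// => k _.
exact: sqr_ge0.
Qed.

Lemma enorm_le n (v : 'rV[R]_n) : enorm v <= n%:R * `|v|.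
Proof.
rewrite enormE -[leRHS]ger0_norm ?mulr_ge0// -sqrtr_sqr ler_wsqrtr//.
apply: (le_trans (sqn_le v)); rewrite exprMn ler_wpM2r ?sqr_ge0//.
by rewrite -natrX ler_nat; case: n v => // n _; rewrite leq_pmulr.
Qed.

Lemma norm_le_enorm n (v : 'rV[R]_n) : `|v| <= enorm v.
Proof.
by rewrite enormE -[leLHS]ger0_norm// -sqrtr_sqr ler_wsqrtr// norm_sqr_le_sqn.
Qed.

End Norms.

(** * Mean value inequality from partial derivatives *)

Section MeanValue.
Context {R : realType}.

Lemma ball_rV n (t s : 'rV[R]_n) r : 0 < r ->
  ball t r s <-> forall i, `|t ord0 i - s ord0 i| < r.
Proof.
move=> r0; rewrite -ball_normE; split => [/= ts i|ts].
  by apply: le_lt_trans ts; have := mx_norm_coord (t - s) ord0 i; rewrite !mxE.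
by apply: mx_norm_lt => // i j; rewrite !mxE ord1.
Qed.

Lemma is_derive_line m n (g : 'rV[R]_m -> 'rV[R]_n) (y v : 'rV[R]_m) j s :
  derivable g (s *: v + y) v ->
  is_derive s 1 (fun s => g (s *: v + y) ord0 j) ('D_v g (s *: v + y) ord0 j).
Proof.
move=> gd; have gj : (fun h => h^-1 *: (g ((h + s) *: v + y) ord0 j -
    g (s *: v + y) ord0 j)) @ 0^' --> 'D_v g (s *: v + y) ord0 j.
  have := gd; rewrite /derivable => /cvg_ex[l gl].
  have -> : 'D_v g (s *: v + y) = l by exact: cvg_lim.
  have := cvg_coord (i := ord0) (j := j) gl; apply: cvg_trans; apply: near_eq_cvg.
  by apply: nearW => h; rewrite !mxE/= scalerDl addrA.
apply: DeriveDef.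
  apply/cvg_ex; exists ('D_v g (s *: v + y) ord0 j); apply: cvg_trans gj.
  by apply: near_eq_cvg; apply: nearW => h /=; rewrite [h *: 1]mulr1.
apply/cvg_lim => //; apply: cvg_trans gj.
by apply: near_eq_cvg; apply: nearW => h /=; rewrite [h *: 1]mulr1.
Qed.

Lemma line_mvt m n (g : 'rV[R]_m -> 'rV[R]_n) (y v : 'rV[R]_m) j (c e a b : R) :
  (forall s, s \in `[Num.min a b, Num.max a b] -> derivable g (s *: v + y) v /\
     `|'D_v g (s *: v + y) ord0 j - c| <= e) ->
  `|g (b *: v + y) ord0 j - g (a *: v + y) ord0 j - (b - a) * c| <= e * `|b - a|.
Proof.
wlog ab : a b / a <= b.
  move=> H; case/orP: (le_total a b) => [/H //|ba]; rewrite minC maxC => Hg.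
  have := H b a ba Hg; rewrite -normrN distrC.
  by rewrite (_ : - (_ - _) = g (b *: v + y) ord0 j - g (a *: v + y) ord0 j - (b - a) * c)//; ring.
rewrite min_l// max_r// => Hg.
have [|||c' cab E] := @MVT_segment R (fun s => g (s *: v + y) ord0 j)
    (fun s => 'D_v g (s *: v + y) ord0 j) a b.
- by [].
- move=> s sab; apply: is_derive_line.
  by have [] := Hg s (subset_itv_oo_cc sab).
- apply: derivable_within_continuous => s sab.
  have [sd _] := Hg s sab; have := is_derive_line j sd.
  by move=> H; exact: ex_derive.
- rewrite E mulrC -mulrBr normrM mulrC ler_wpM2r//.
  by have [] := Hg c' cab.
Qed.

(** The increment is telescoped over the points [z k], which take their first [k] coordinates from
    [t] and the others from [t']. A sup-norm ball is a box, so this axis-parallel path stays inside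
    it and the scalar mean value theorem applies on each segment. *)
Lemma mvt_partial m n (g : 'rV[R]_m -> 'rV[R]_n) t0 r (A : 'M[R]_(m, n)) e :
  (forall t i, ball t0 r t -> derivable g t (delta_mx ord0 i) /\
     `|'D_(delta_mx ord0 i) g t - row i A| <= e) ->
  forall t t', ball t0 r t -> ball t0 r t' ->
  `|g t - g t' - (t - t') *m A| <= m%:R * e * `|t - t'|.
Proof.
move=> Hg t t' tr t'r.
have r0 : 0 < r by have := tr; rewrite -ball_normE; exact: le_lt_trans.
case: m => [|m'] in g t0 A Hg t t' tr t'r *.
  have -> : t = t' by apply/rowP; case.
  by rewrite !subrr mul0mx subrr normr0 !mul0r.
have e0 : 0 <= e.
  have [_] := Hg t0 ord0 (ballxx _ r0); exact: le_trans.
apply: mx_norm_le => [|i0 j]; first by rewrite !mulr_ge0.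
rewrite (ord1 i0) {i0}.
pose z k : 'rV[R]_m'.+1 := \row_i (if (i < k)%N then t ord0 i else t' ord0 i).
(* [y k] is [z k] with coordinate [k] set to 0: both [z k] and [z k.+1] lie on the line through it
   in direction [k]. *)
pose y (k : 'I_m'.+1) : 'rV[R]_m'.+1 :=
  \row_i (if i == k then 0 else z k ord0 i).
have zS (k : 'I_m'.+1) : z k.+1 = t ord0 k *: delta_mx ord0 k + y k.
  apply/rowP => i; rewrite !mxE !eqxx/= ltnS leq_eqVlt -val_eqE.
  by case: eqVneq => [/val_inj->|_] /=; rewrite ?mulr1 ?addr0// mulr0 add0r.
have z_ (k : 'I_m'.+1) : z k = t' ord0 k *: delta_mx ord0 k + y k.
  apply/rowP => i; rewrite !mxE !eqxx/= -val_eqE.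
  case: eqVneq => [/val_inj->|_] /=; last by rewrite mulr0 add0r.
  by rewrite ltnn mulr1 addr0.
have step (k : 'I_m'.+1) : `|g (z k.+1) ord0 j - g (z k) ord0 j -
    (t ord0 k - t' ord0 k) * A k j| <= e * `|t - t'|.
  rewrite zS z_; apply: (@le_trans _ _ (e * `|t ord0 k - t' ord0 k|)); last first.
    by rewrite ler_wpM2l//; have := mx_norm_coord (t - t') ord0 k; rewrite !mxE.
  apply: line_mvt => s sI; have [|sd sA] := Hg (s *: delta_mx ord0 k + y k) k.
    apply/ball_rV => // i; rewrite !mxE eqxx/=.
    have ti := (ball_rV _ _ r0).1 tr i; have t'i := (ball_rV _ _ r0).1 t'r i.
    case: eqVneq => [ik|_]; last by rewrite mulr0 add0r; case: ifP.
    move: sI ti t'i; rewrite mulr1 addr0 in_itv/= -ik !ltr_distl ge_min le_max.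
    by move=> /andP[/orP[] ? /orP[] ?] /andP[? ?] /andP[? ?]; apply/andP; split; lra.
  split=> //; have := mx_norm_coord ('D_(delta_mx ord0 k) g (s *: delta_mx ord0 k + y k) - row k A) ord0 j.
  by rewrite !mxE => /le_trans; apply.
have z0 : z 0 = t' by apply/rowP => i; rewrite mxE.
have zm : z m'.+1 = t by apply/rowP => i; rewrite mxE ltn_ord.
have -> : (g t - g t' - (t - t') *m A) ord0 j = \sum_(k < m'.+1)
    (g (z k.+1) ord0 j - g (z k) ord0 j - (t ord0 k - t' ord0 k) * A k j).
  rewrite sumrB -(big_mkord xpredT (fun k => g (z k.+1) ord0 j - g (z k) ord0 j)).
  rewrite telescope_sumr// zm z0 !mxE; congr (_ - _).
  by apply: eq_bigr => k _; rewrite !mxE.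
apply: (le_trans (ler_norm_sum _ _ _)).
rewrite -mulrA mulr_natl -[X in _ *+ X]card_ord -sumr_const.
by apply: ler_sum => k _.
Qed.

End MeanValue.

(** * Maps of class C^1 and strict differentiability *)

Section C1maps.
Context {R : realType}.

Lemma cvg_near (X : Type) (Y : topologicalType) (F : set_system X)
    {FF : Filter F} (f g : X -> Y) (l : Y) :
  (\forall x \near F, f x = g x) ->
  f x @[x --> F] --> l -> g x @[x --> F] --> l.
Proof. by move=> fg; apply: cvg_trans; exact: near_eq_cvg. Qed.

Lemma mulmxr_continuous m n p (A : 'M[R]_(n, p)) :
  continuous (fun v : 'M[R]_(m, n) => v *m A).
Proof.
move=> v; apply: (@cvg_mulmx _ _ (nbhs v) _ m n p id (fun=> A)).
  exact: cvg_id.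
exact: cvg_cst.
Qed.

Lemma diff_approx (V W : normedModType R) (g : V -> W) (t : V)
    (df : {linear V -> W}) : continuous df ->
  (forall e, 0 < e ->
    \forall s \near t, `|g s - g t - df (s - t)| <= e * `|s - t|) ->
  differentiable g t /\ 'd g t = df :> (V -> W).
Proof.
move=> dfc gA.
have dfg : g \o shift t = cst (g t) + df +o_ 0 id.
  apply/eqaddoP => e e0; have := gA e e0.
  rewrite (near_shift 0 t) subr0 => H; near=> h.
  have : `|g (h + t) - g t - df (h + t - t)| <= e * `|h + t - t| by near: h.
  by rewrite addrK -addrA -opprD.
have dE := diff_unique dfc dfg; split=> //.
by apply/diff_locallyP; rewrite dE.
Unshelve. all: by end_near. Qed.

Lemma near_eq_diff (V W : normedModType R) (f g : V -> W) (t : V) :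
  (\forall s \near t, f s = g s) -> differentiable f t ->
  differentiable g t /\ 'd g t = 'd f t :> (V -> W).
Proof.
move=> fg fd; apply: diff_approx => [|e e0]; first exact: diff_continuous.
have H : \forall s \near t, `|f s - f t - 'd f t (s - t)| <= e * `|s - t|.
  have H : \forall h \near (0 : V),
      `|(f \o shift t - (cst (f t) + 'd f t)) h| <= e * `|h|.
    by have /eqaddoP/(_ e e0) := diff_locally fd.
  move: H; rewrite (near_shift t 0) sub0r => H; near=> h.
  have : `|(f \o shift t - (cst (f t) + 'd f t)) (h - t)| <= e * `|h - t|.
    by near: h.
  by rewrite -[X in `|X| <= _ -> _]/(f (h - t + t) - (f t + 'd f t (h - t))) subrK opprD addrA.
near=> s; rewrite -(nbhs_singleton fg).
have <- : f s = g s by near: s.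
by near: s.
Unshelve. all: by end_near. Qed.

Lemma differentiable_approx m n (g : 'rV[R]_m -> 'rV[R]_n) (t : 'rV[R]_m)
    (A : 'M[R]_(m, n)) :
  (forall e, 0 < e ->
    \forall s \near t, `|g s - g t - (s - t) *m A| <= e * `|s - t|) ->
  differentiable g t /\ 'J g t = A.
Proof.
move=> gA; pose df : {linear 'rV[R]_m -> 'rV[R]_n} := mulmxr A.
have dfc : continuous df by move=> v; exact: mulmxr_continuous.
have [gd dE] := diff_approx dfc gA; split=> //.
by apply/row_matrixP => i; rewrite !rowE mul_rV_lin1 dE.
Qed.

(** A pointwise notion: it is what strict differentiability at [t] takes, and it passes to
    compositions point by point. *)
Definition C1 m n (g : 'rV[R]_m -> 'rV[R]_n) (t : 'rV[R]_m) :=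
  (\forall s \near t, differentiable g s) /\ {for t, continuous (jacobian g)}.

Lemma row_jacobian m n (g : 'rV[R]_m -> 'rV[R]_n) (t : 'rV[R]_m) i :
  differentiable g t -> row i ('J g t) = 'D_(delta_mx ord0 i) g t.
Proof. by move=> gt; rewrite deriveEjacobian// rowE. Qed.

Lemma C1_diff m n (g : 'rV[R]_m -> 'rV[R]_n) (t : 'rV[R]_m) : C1 g t -> differentiable g t.
Proof. by move=> [/nbhs_singleton]. Qed.

Lemma C1_cont m n (g : 'rV[R]_m -> 'rV[R]_n) (t : 'rV[R]_m) : C1 g t -> {for t, continuous g}.
Proof. by move=> /C1_diff/differentiable_continuous. Qed.

(** Continuity of the partial derivatives at [t] lets [mvt_partial] compare with the constant matrix
    of their values at [t]. The estimate between two arbitrary nearby points is needed later for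
    cubes that are not centred at [t]. *)
Lemma partials_strict m n (g : 'rV[R]_m -> 'rV[R]_n) (t : 'rV[R]_m) :
  (forall i, \forall s \near t, derivable g s (delta_mx ord0 i)) ->
  (forall i, {for t, continuous ('D_(delta_mx ord0 i) g)}) ->
  forall e, 0 < e -> exists2 r, 0 < r & forall s s', ball t r s -> ball t r s' ->
  `|g s - g s' - (s - s') *m \matrix_i 'D_(delta_mx ord0 i) g t| <= e * `|s - s'|.
Proof.
move=> gd gc e e0; set A := \matrix_i _.
have H i : \forall s \near t, derivable g s (delta_mx ord0 i) /\
    `|'D_(delta_mx ord0 i) g s - row i A| <= e / m.+1%:R.
  near=> s; split; first by near: s; exact: gd.
  rewrite rowK; near: s.
  have := gc i; move=> /cvgrPdist_le/(_ (e / m.+1%:R)); rewrite divr_gt0// => /(_ isT).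
  by move=> H; near=> s; rewrite distrC; near: s.
have /nbhs_ballP[r /= r0 rg] : \forall s \near t, forall i,
    derivable g s (delta_mx ord0 i) /\
    `|'D_(delta_mx ord0 i) g s - row i A| <= e / m.+1%:R.
  exact: filter_forall H.
exists r => // s s' sr s'r.
apply: le_trans (mvt_partial (fun u i ur => rg u ur i) sr s'r) _; rewrite ler_wpM2r//.
by rewrite mulrCA ler_piMr ?(ltW e0)// ler_pdivrMr// mul1r ler_nat.
Unshelve. all: by end_near. Qed.

Lemma C1_partials m n (U : set 'rV[R]_m) (g : 'rV[R]_m -> 'rV[R]_n) : open U ->
  (forall i s, U s -> derivable g s (delta_mx ord0 i)) ->
  (forall i s, U s -> {for s, continuous ('D_(delta_mx ord0 i) g)}) ->
  forall t, U t -> C1 g t.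
Proof.
move=> oU gd gc.
have dg t : U t -> differentiable g t /\
    'J g t = \matrix_i 'D_(delta_mx ord0 i) g t.
  move=> Ut; apply: differentiable_approx => e e0.
  have [|i|r r0 H] := @partials_strict _ _ g t _ _ e e0.
  - by move=> i; apply: (filterS _ (open_nbhs_nbhs (conj oU Ut))) => s; exact: gd.
  - exact: gc.
  - apply/nbhs_ballP; exists r => //= s tr; apply: H => //; exact: ballxx.
move=> t Ut; split.
  by apply: (filterS _ (open_nbhs_nbhs (conj oU Ut))) => s /dg[].
rewrite /prop_for/continuous_at (dg t Ut).2.
apply: (@cvg_near _ _ (nbhs t) _ (fun s => \matrix_i 'D_(delta_mx ord0 i) g s)).
  near=> s; have H : U s by near: s; exact: open_nbhs_nbhs.
  by have [_ HJ] := dg s H; exact: (esym HJ).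
apply: cvg_mx_coord => i j; under eq_cvg do rewrite mxE; rewrite mxE.
by apply: cvg_coord; exact: gc.
Unshelve. all: by end_near. Qed.

Lemma C1_strict m n (g : 'rV[R]_m -> 'rV[R]_n) (t : 'rV[R]_m) : C1 g t ->
  forall e, 0 < e -> exists2 r, 0 < r & forall s s', ball t r s -> ball t r s' ->
  `|g s - g s' - (s - s') *m 'J g t| <= e * `|s - s'|.
Proof.
move=> gt e e0; have [gd gc] := gt.
have -> : 'J g t = \matrix_i 'D_(delta_mx ord0 i) g t.
  by apply/row_matrixP => i; rewrite rowK row_jacobian//; exact: C1_diff.
apply: partials_strict => // i.
  by apply: filterS gd => s /diff_derivable.
rewrite /prop_for/continuous_at -row_jacobian; last exact: C1_diff.
apply: (@cvg_near _ _ (nbhs t) _ (fun s => row i ('J g s))).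
  by near=> s; apply: row_jacobian; near: s.
apply: cvg_mx_coord => k j; under eq_cvg do rewrite mxE; rewrite mxE.
exact: cvg_coord.
Unshelve. all: by end_near. Qed.

Lemma jacobian_comp m n p (f : 'rV[R]_m -> 'rV[R]_n) (g : 'rV[R]_n -> 'rV[R]_p) (t : 'rV[R]_m) :
  differentiable f t -> differentiable g (f t) ->
  'J (g \o f) t = 'J f t *m 'J g (f t).
Proof.
move=> ft gt; apply/row_matrixP => i; rewrite row_mul !rowE.
by rewrite !mul_rV_lin1 /= diff_comp.
Qed.

Lemma C1_comp m n p (f : 'rV[R]_m -> 'rV[R]_n) (g : 'rV[R]_n -> 'rV[R]_p) (t : 'rV[R]_m) :
  C1 f t -> C1 g (f t) -> C1 (g \o f) t.
Proof.
move=> fC gC; have fc := C1_cont fC; have [fd fJ] := fC; have [gd gJ] := gC.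
have gfd : \forall s \near t, differentiable g (f s) by exact: fc gd.
split; first by near=> s; apply: differentiable_comp; near: s.
rewrite /prop_for/continuous_at jacobian_comp; try exact: C1_diff.
apply: (@cvg_near _ _ (nbhs t) _ (fun s => 'J f s *m 'J g (f s))).
  by near=> s; apply/esym/jacobian_comp; near: s.
apply: cvg_mulmx => //; exact: (cvg_comp f (jacobian g) fc gJ).
Unshelve. all: by end_near. Qed.

Lemma near_eq_differentiable m n (f g : 'rV[R]_m -> 'rV[R]_n) (t : 'rV[R]_m) :
  {near t, f =1 g} -> differentiable f t -> differentiable g t /\ 'J g t = 'J f t.
Proof.
move=> fg fd.
have fg' : \forall s \near t, f s = g s by [].
have [gd dE] := near_eq_diff fg' fd; split; first exact: gd.
exact: (congr1 (@lin1_mx R m n) dE).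
Qed.

Lemma near_eq_C1 m n (f g : 'rV[R]_m -> 'rV[R]_n) (t : 'rV[R]_m) :
  {near t, f =1 g} -> C1 f t -> C1 g t /\ 'J g t = 'J f t.
Proof.
move=> fg fC; have [fd fJ] := fC.
have [gd JE] := near_eq_differentiable fg (C1_diff fC).
have fg2 : \forall s \near t, {near s, f =1 g} by exact: near_join fg.
have H : \forall s \near t, differentiable g s /\ 'J g s = 'J f s.
  by near=> s; apply: near_eq_differentiable; near: s.
split; last exact: JE.
split; first by apply: filterS H => s [].
rewrite /prop_for/continuous_at JE; apply: cvg_near fJ.
by near=> s; apply/esym; have [] : differentiable g s /\ 'J g s = 'J f s by near: s.
Unshelve. all: by end_near. Qed.

End C1maps.

(** * Maps of class C^2 and their composition *)

Section C2maps.
Context {R : realType}.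

Local Notation "''dx' i" := (delta_mx ord0 i) (at level 8, i at level 2).

Lemma C1_derive_cont m n (g : 'rV[R]_m -> 'rV[R]_n) (t v : 'rV[R]_m) :
  C1 g t -> {for t, continuous ('D_v g)}.
Proof.
move=> gC; have [gd gJ] := gC.
rewrite /prop_for/continuous_at deriveEjacobian; last exact: C1_diff.
apply: (@cvg_near _ _ (nbhs t) _ (fun s => v *m 'J g s)).
  by near=> s; apply/esym/deriveEjacobian; near: s.
by apply: cvg_mulmx; [exact: cvg_cst|].
Unshelve. all: by end_near. Qed.

Lemma C2_on_C1 m n U (g : 'rV[R]_m -> 'rV[R]_n) (t : 'rV[R]_m) : C2_on U g -> U t ->
  C1 g t /\ forall i, C1 ('D_('dx i) g) t.
Proof.
move=> [oU gd gc] Ut; split=> [|i].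
  apply: (C1_partials oU) Ut => i s Us; first exact: (gd [::]).
  exact: (gc [:: i]).
apply: (C1_partials oU) Ut => j s Us; first exact: (gd [:: i]).
exact: (gc [:: j; i]).
Qed.

(** Converse of [C2_on_C1]: C^2 amounts to C^1 for the map and its first partials, a form in which
    the chain rule for C^1 maps can be used. *)
Lemma C1_C2_on m n U (g : 'rV[R]_m -> 'rV[R]_n) : open U ->
  (forall t, U t -> C1 g t) -> (forall i t, U t -> C1 ('D_('dx i) g) t) ->
  C2_on U g.
Proof.
move=> oU g1 g2; split; first exact: oU.
- move=> [|j [|? ?]] i t ss Ut; last by [].
    by apply: diff_derivable; exact: C1_diff (g1 t Ut).
  by apply: diff_derivable; exact: C1_diff (g2 j t Ut).
- move=> [|i [|j [|? ?]]] t ss Ut; last by [].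
  + exact: C1_cont (g1 t Ut).
  + exact: C1_derive_cont (g1 t Ut).
  + exact: C1_derive_cont (g2 j t Ut).
Qed.

Lemma C2_on_eq m n U (f g : 'rV[R]_m -> 'rV[R]_n) :
  (forall t, U t -> f t = g t) -> C2_on U f -> C2_on U g.
Proof.
move=> fg fC; have [oU _ _] := fC.
have fg' t : U t -> \forall s \near t, f s = g s.
  by move=> Ut; apply: (filterS _ (open_nbhs_nbhs (conj oU Ut))) => s; exact: fg.
apply: (C1_C2_on oU) => [t Ut|i t Ut].
  have [H _] := C2_on_C1 fC Ut; have [H' _] := near_eq_C1 (fg' t Ut) H; exact: H'.
have [_ /(_ i) fi] := C2_on_C1 fC Ut.
have H : {near t, 'D_('dx i) f =1 'D_('dx i) g}.
  apply: (filterS _ (open_nbhs_nbhs (conj oU Ut))) => s Us.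
  by apply: near_eq_derive; exact: fg'.
have [H' _] := near_eq_C1 H fi; exact: H'.
Qed.

(** Serves to show that an immersion composed with a diffeomorphism is an immersion. A first partial
    of the composite is a sum of products [a l \* b l j], a component of a partial of [f] times a
    partial of [g] along [f]. Both factors have continuous partials, and the product rule
    concludes. *)
Lemma C2_on_comp m n p U W (f : 'rV[R]_m -> 'rV[R]_n) (g : 'rV[R]_n -> 'rV[R]_p) :
  (forall t, U t -> W (f t)) -> C2_on U f -> C2_on W g -> C2_on U (g \o f).
Proof.
move=> fUW fC gC; have [oU _ _] := fC.
have f1 t : U t -> C1 f t by move=> /(C2_on_C1 fC)[].
have f2 i t : U t -> C1 ('D_('dx i) f) t by move=> /(C2_on_C1 fC)[_ H]; exact: H.
have g1 t : U t -> C1 g (f t) by move=> /fUW/(C2_on_C1 gC)[].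
have g2 i t : U t -> C1 ('D_('dx i) g) (f t) by move=> /fUW/(C2_on_C1 gC)[_ H]; exact: H.
have gf1 t : U t -> C1 (g \o f) t.
  by move=> Ut; exact: C1_comp (f1 t Ut) (g1 t Ut).
apply: (C1_C2_on oU gf1) => i.
pose a l (s : 'rV[R]_m) := 'D_('dx i) f s ord0 l.
pose b l j (s : 'rV[R]_m) := 'D_('dx l) g (f s) ord0 j.
have DE t : U t -> 'D_('dx i) (g \o f) t =
    \matrix_(i < 1, j < p) (\sum_(l < n) (a l \* b l j)) t.
  move=> Ut; have gt := C1_diff (g1 t Ut); have ft := C1_diff (f1 t Ut).
  rewrite deriveEjacobian; last exact/C1_diff/gf1.
  rewrite (jacobian_comp ft gt) mulmxA -(deriveEjacobian _ ft).
  apply/rowP => j; rewrite mxE [RHS]mxE fct_sumE; apply: eq_bigr => l _.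
  by rewrite /= /b -(row_jacobian l gt) [in RHS]mxE.
have ad k l t : U t -> derivable (a l) t ('dx k).
  move=> Ut; have : derivable ('D_('dx i) f) t ('dx k) by apply: diff_derivable; exact: C1_diff (f2 i t Ut).
  by move=> /derivable_mxP/(_ ord0 l).
have bC l t : U t -> C1 ('D_('dx l) g \o f) t.
  move=> Ut; exact: C1_comp (f1 t Ut) (g2 l t Ut).
have bd k l j t : U t -> derivable (b l j) t ('dx k).
  move=> Ut; have : derivable ('D_('dx l) g \o f) t ('dx k) by apply: diff_derivable; exact: C1_diff (bC l t Ut).
  by move=> /derivable_mxP/(_ ord0 j).
have abd k j t : U t -> derivable (\sum_(l < n) (a l \* b l j)) t ('dx k).
  by move=> Ut; apply: derivable_sum => l; apply: derivableM; auto.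
pose h (t : 'rV[R]_m) := \matrix_(i < 1, j < p) (\sum_(l < n) (a l \* b l j)) t.
have hd k t : U t -> derivable h t ('dx k).
  move=> Ut; apply/derivable_mxP => i0 j.
  rewrite (_ : (fun _ => _) = \sum_(l < n) (a l \* b l j)); first exact: abd.
  by apply/funext => s; rewrite mxE.
have near_h t : U t -> {near t, h =1 'D_('dx i) (g \o f)}.
  move=> Ut; apply: (filterS _ (open_nbhs_nbhs (conj oU Ut))) => s Us.
  exact/esym/DE.
have hC t : U t -> C1 h t.
  apply: (C1_partials oU hd) => k {}t Ut.
  apply: (@cvg_near _ _ (nbhs t) _ (fun s => \matrix_(i < 1, j < p)
     \sum_(l < n) (a l s *: 'D_('dx k) (b l j) s + b l j s *: 'D_('dx k) (a l) s))).
    apply: (filterS _ (open_nbhs_nbhs (conj oU Ut))) => s Us.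
    rewrite derive_mx; last exact: hd.
    apply/matrixP => i0 j; rewrite !mxE.
    rewrite (_ : (fun _ => _) = \sum_(l < n) (a l \* b l j)); last first.
      by apply/funext => u; rewrite mxE.
    rewrite derive_sum => [|l]; last by apply: derivableM; auto.
    by apply: eq_bigr => l _; rewrite deriveM; auto.
  have -> : 'D_('dx k) h t = \matrix_(i < 1, j < p)
     \sum_(l < n) (a l t *: 'D_('dx k) (b l j) t + b l j t *: 'D_('dx k) (a l) t).
    rewrite derive_mx; last exact: hd.
    apply/matrixP => i0 j; rewrite !mxE.
    rewrite (_ : (fun _ => _) = \sum_(l < n) (a l \* b l j)); last first.
      by apply/funext => u; rewrite mxE.
    rewrite derive_sum => [|l]; last by apply: derivableM; auto.
    by apply: eq_bigr => l _; rewrite deriveM; auto.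
  apply: cvg_mx_coord => i0 j; under eq_cvg do rewrite mxE; rewrite mxE.
  apply: cvg_sumr => l _; apply: cvgD; apply: cvgZ.
  - by apply: cvg_coord; exact: C1_cont (f2 i t Ut).
  - have DbE s : U s -> 'D_('dx k) (b l j) s =
        'D_('dx k) ('D_('dx l) g \o f) s ord0 j.
      move=> Us; rewrite derive_mx ?mxE//.
      by apply: diff_derivable; exact: C1_diff (bC l s Us).
    rewrite DbE//.
    apply: (@cvg_near _ _ (nbhs t) _
      (fun s => 'D_('dx k) ('D_('dx l) g \o f) s ord0 j)).
      apply: (filterS _ (open_nbhs_nbhs (conj oU Ut))) => s Us.
      exact/esym/DbE.
    by apply: cvg_coord; exact: C1_derive_cont (bC l t Ut).
  - by apply: cvg_coord; exact: C1_cont (bC l t Ut).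
  - have DaE s : U s -> 'D_('dx k) (a l) s =
        'D_('dx k) ('D_('dx i) f) s ord0 l.
      move=> Us; rewrite [in RHS]derive_mx ?mxE//.
      by apply: diff_derivable; exact: C1_diff (f2 i s Us).
    rewrite DaE//.
    apply: (@cvg_near _ _ (nbhs t) _
      (fun s => 'D_('dx k) ('D_('dx i) f) s ord0 l)).
      apply: (filterS _ (open_nbhs_nbhs (conj oU Ut))) => s Us.
      exact/esym/DaE.
    by apply: cvg_coord; exact: C1_derive_cont (f2 i t Ut).
move=> t Ut; have [H' _] := near_eq_C1 (near_h t Ut) (hC t Ut); exact: H'.
Qed.

End C2maps.

(** * The tangent sphere and its frames *)

Section TangentSphere.
Context {R : realType}.

Lemma enorm_sqr n (v : 'rV[R]_n) : enorm v ^+ 2 = sqn v.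
Proof. by rewrite enormE sqr_sqrtr// sqn_ge0. Qed.

Definition posframe m n (J U : 'M[R]_(m, n)) :=
  orthonormal_rows U /\ exists A : 'M[R]_m, 0 < \det A /\ U = A *m J.

Lemma submx_refl p q n (B : 'M[R]_(p, n)) (C : 'M[R]_(q, n)) (w : 'rV[R]_n) :
  (w <= C)%MS -> (B <= C)%MS -> (B *m refl w <= C)%MS.
Proof.
move=> wC BC; rewrite /refl mulmxBr mulmx1 -scalemxAr mulmxA.
rewrite addmx_sub// eqmx_opp scalemx_sub//.
exact: submx_trans (submxMl _ _) wC.
Qed.

Lemma refl_sub n (x y : 'rV[R]_n) : refl (y - x) = refl (x - y).
Proof. by rewrite -[y - x]opprB -scaleN1r refl_scale// oppr_eq0 oner_eq0. Qed.

Lemma orthonormal_refl m n (U : 'M[R]_(m, n)) w :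
  w != 0 -> orthonormal_rows U -> orthonormal_rows (U *m refl w).
Proof.
move=> w0 UU; rewrite /orthonormal_rows trmx_mul tr_refl mulmxA.
by rewrite -[U *m refl w *m refl w]mulmxA refl_inv// mulmx1.
Qed.

Lemma orthonormal_flip m n (U : 'M[R]_(m, n)) : (0 < m)%N -> orthonormal_rows U ->
  exists2 D : 'M[R]_m, \det D = -1 & orthonormal_rows (D *m U).
Proof.
case: m U => // m U _ UU.
pose d : 'rV[R]_m.+1 := \row_i (if i == ord0 then -1 else 1).
exists (diag_mx d).
  rewrite det_diag big_ord_recl big1 => [|i _]; last by rewrite mxE.
  by rewrite mxE mulr1.
rewrite /orthonormal_rows trmx_mul mulmxA -[diag_mx d *m U *m _]mulmxA UU mulmx1.
rewrite tr_diag_mx mulmx_diag -[1%:M]diag_const_mx; congr diag_mx.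
by apply/rowP => i; rewrite !mxE; case: eqP; rewrite ?mulrNN mulr1.
Qed.

(** On a round sphere the frame at [x] is carried to [y] by the reflection that exchanges these
    points, and one vector is reversed if the orientation comes out wrong. On a plane the same frame
    serves at both points. *)
Lemma exists_sphere_frame m n (S : oriented_sphere R m n) (x y : 'rV[R]_n)
    (J : 'M[R]_(m, n)) : (0 < m)%N -> y - x != 0 -> row_free J ->
  sphere_points S x -> sphere_points S y ->
  (forall U, positive_sphere_frame S x U <-> posframe J U) ->
  exists U, positive_sphere_frame S y U.
Proof.
move=> m0 w0 Jf; have [A A0 AJ] := orthonormal_basis Jf.
case: S => [z r B r0 Bf|z B Bf] /= Sx Sy Sframe; last first.
  by exists (A *m J); have /Sframe[] : posframe J (A *m J) by split=> //; exists A.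
have [_ [Uxz [C [C0 CB]]]] : positive_sphere_frame (RoundSphere z r0 Bf) x (A *m J).
  by apply/Sframe; split=> //; exists A.
have [[xB xr] [yB yr]] := (Sx, Sy).
have wB : (y - x <= B)%MS.
  rewrite (_ : y - x = (y - z) - (x - z)); last by rewrite opprB addrA subrK.
  by rewrite addmx_sub// eqmx_opp.
have BR : (B *m refl (y - x) <= B)%MS by exact: submx_refl.
have xyz : sqn (x - z) = sqn (y - z).
  by rewrite -!enorm_sqr xr yr.
have xw : x - z - (y - z) != 0 by rewrite opprB addrA subrK -opprB oppr_eq0.
have yR : (y - z) *m refl (y - x) = x - z.
  rewrite refl_sub (_ : x - y = x - z - (y - z)); last by rewrite opprB addrA subrK.
  exact: refl_swap.
pose U := A *m J *m refl (y - x).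
have UU : orthonormal_rows U by exact: orthonormal_refl.
have yU : U *m (y - z)^T = 0.
  by rewrite /U -mulmxA -[refl _]tr_refl -trmx_mul yR.
have [K KB] : exists K, B *m refl (y - x) = K *m B by exact/submxP.
have KK : K *m K = 1%:M.
  apply: (row_free_inj Bf); rewrite -mulmxA -KB mulmxA -KB -mulmxA refl_inv//.
  by rewrite mulmx1 mul1mx.
have UB : col_mx (y - z) U = C *m K *m B.
  rewrite -mulmxA -KB mulmxA -CB mul_col_mx; congr (col_mx _ _).
  by rewrite -yR -mulmxA refl_inv// mulmx1.
have K0 : \det (C *m K) != 0.
  rewrite det_mulmx mulf_neq0 ?(lt0r_neq0 C0)//; apply/eqP => K0.
  move/(congr1 determinant)/eqP: KK.
  by rewrite det_mulmx K0 mul0r det1 eq_sym oner_eq0.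
have [CK|CK] := ltP 0 (\det (C *m K)).
  by exists U; split=> //; split=> //; exists (C *m K).
have [D D1 DU] := orthonormal_flip m0 UU.
exists (D *m U); split=> //; split; first by rewrite -mulmxA yU mulmx0.
exists (block_mx 1%:M 0 0 D *m (C *m K)); split.
  by rewrite [\det (_ *m _)]det_mulmx det_ublock det1 mul1r D1 mulN1r oppr_gt0 lt_neqAle K0.
by rewrite -mulmxA -UB mul_block_col !mul1mx !mul0mx addr0 add0r.
Qed.

Lemma equidistant n (u v : 'rV[R]_n) : dotp u v = sqn v -> v != 0 ->
  sqn (u - (sqn u / (2 * sqn v)) *: v) = sqn (- ((sqn u / (2 * sqn v)) *: v)).
Proof.
move=> uv v0; rewrite !sqn_dotp !dotpE' [dotp v u]dotpC uv -!sqn_dotp.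
by field; rewrite sqn_eq0.
Qed.

Lemma exists_tangent_sphere m n (x y : 'rV[R]_n) (J : 'M[R]_(m, n)) :
  y - x != 0 -> row_free J -> exists S : oriented_sphere R m n,
  [/\ sphere_points S x, sphere_points S y &
   forall U, positive_sphere_frame S x U <-> posframe J U].
Proof.
move=> w0 Jf; set w := y - x.
have [wJ|wJ] := boolP (w <= J)%MS.
  exists (Plane x Jf); split=> //=; first by rewrite subrr sub0mx.
have [A A0 AJ] := orthonormal_basis Jf.
have Au : A \in unitmx by rewrite unitmxE unitfE gt_eqF.
pose V := A *m J; pose wN := w - w *m V^T *m V.
have wNV : wN *m V^T = 0.
  by rewrite /wN mulmxBl -[w *m V^T *m V *m V^T]mulmxA AJ mulmx1 subrr.
have wNJ : wN *m J^T = 0.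
  have -> : J = invmx A *m V by rewrite /V mulmxA mulVmx// mul1mx.
  by rewrite trmx_mul mulmxA wNV mul0mx.
have wN0 : wN != 0.
  apply: contra wJ => /eqP/subr0_eq->; rewrite /V mulmxA; exact: submxMl.
have wwN : dotp w wN = sqn wN.
  have -> : w = wN + w *m V^T *m V by rewrite subrK.
  rewrite sqn_dotp dotpDl [X in _ + X](_ : _ = 0) ?addr0//.
  by rewrite dotpC /dotp trmx_mul mulmxA wNV mul0mx mxE.
(* With [wN] the normal part of the chord, this coefficient makes [x + c *: wN] as far from [y] as
   from [x], by [equidistant]. *)
pose c := sqn w / (2 * sqn wN).
have c0 : 0 < c by rewrite divr_gt0 ?mulr_gt0 ?sqn_gt0.
pose z := x + c *: wN; pose r := enorm (x - z).
have xz : x - z = - (c *: wN) by rewrite /z opprD addrA subrr sub0r.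
have xz0 : x - z != 0 by rewrite xz oppr_eq0 scaler_eq0 negb_or gt_eqF.
have r0 : 0 < r by rewrite /r enormE sqrtr_gt0 sqn_gt0.
have xzJ : (x - z) *m J^T = 0 by rewrite xz mulNmx -scalemxAl wNJ scaler0 oppr0.
(* The outward normal at [x] comes first, so the orientation of the sphere by [B] is the one of [J]
   at [x]. *)
pose B : 'M[R]_(1 + m, n) := col_mx (x - z) J.
have free2 (a : 'M[R]_1) (s : 'rV[R]_m) : a *m (x - z) + s *m J = 0 -> a = 0 /\ s = 0.
  move=> E; have a0 : a = 0.
    have : (a *m (x - z) + s *m J) *m (x - z)^T = 0 by rewrite E mul0mx.
    rewrite mulmxDl -[s *m J *m _]mulmxA -[J *m _]trmxK trmx_mul trmxK xzJ trmx0 mulmx0 addr0.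
    rewrite -mulmxA dotpE mul_mx_scalar => /eqP; rewrite scaler_eq0 -sqn_dotp sqn_eq0.
    by rewrite (negPf xz0) => /eqP.
  split=> //; move: E; rewrite a0 mul0mx add0r => /eqP.
  by rewrite -(mul0mx _ J) (inj_eq (row_free_inj Jf)) => /eqP.
have Bf : row_free B.
  rewrite -kermx_eq0; apply/eqP/row_matrixP => i; rewrite row0.
  have : row i (kermx B) *m B = 0 by rewrite -row_mul mulmx_ker row0.
  rewrite -[row i _]hsubmxK mul_row_col => /free2[-> ->]; exact: row_mx0.
exists (RoundSphere z r0 Bf); split.
- split=> //; apply/submxP; exists (row_mx 1%:M 0).
  by rewrite mul_row_col mul1mx mul0mx addr0.
- have yzE : y - z = w + (x - z) by rewrite /w addrA subrK.
  split.
    rewrite yzE addmx_sub//; last first.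
      by apply/submxP; exists (row_mx 1%:M 0); rewrite mul_row_col mul1mx mul0mx addr0.
    apply/submxP; exists (row_mx (- c^-1)%:M (w *m V^T *m A)).
    rewrite mul_row_col mul_scalar_mx xz scalerN scaleNr opprK scalerA mulVf ?gt_eqF//.
    by rewrite scale1r -[_ *m A *m J]mulmxA /wN subrK.
  by rewrite /r !enormE yzE xz (equidistant wwN).
- move=> U; split=> [[UU [Ux [C [C0 CB]]]]|[UU [C [C0 UC]]]].
    split=> //; rewrite -[C]submxK in CB.
    move: CB; rewrite mul_block_col => /eq_col_mx[Cu Cd].
    have [ul ur] : ulsubmx C - 1%:M = 0 /\ ursubmx C = 0.
      apply: free2; rewrite mulmxBl mul1mx addrAC -Cu subrr//.
    have dl : dlsubmx C = 0.
      have : U *m (x - z)^T = 0 by [].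
      rewrite Cd mulmxDl -[_ *m J *m _]mulmxA -[J *m _]trmxK trmx_mul trmxK xzJ trmx0 mulmx0 addr0.
      rewrite -mulmxA dotpE mul_mx_scalar => /eqP; rewrite scaler_eq0 -sqn_dotp sqn_eq0.
      by rewrite (negPf xz0) => /eqP.
    exists (drsubmx C); split; last by rewrite Cd dl mul0mx add0r.
    by move: C0; rewrite -{1}[C]submxK (subr0_eq ul) ur det_lblock det1 mul1r.
  split=> //; split.
    by rewrite UC -mulmxA -[J *m _]trmxK trmx_mul trmxK xzJ trmx0 mulmx0.
  exists (block_mx 1%:M 0 0 C); rewrite det_ublock det1 mul1r; split=> //.
  by rewrite mul_block_col !mul0mx add0r addr0 mul1mx UC.
Qed.

(** Reflected back, a frame of a round sphere at [y] lies in the linear span of the sphere and is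
    orthogonal to the radius at [x], hence is tangent there. For a plane, the reflection preserves
    the direction of the plane. *)
Lemma sphere_frame_refl m n (S : oriented_sphere R m n) (x y : 'rV[R]_n)
    (J U : 'M[R]_(m, n)) : y - x != 0 -> row_free J ->
  sphere_points S x -> sphere_points S y ->
  (forall U, positive_sphere_frame S x U <-> posframe J U) ->
  positive_sphere_frame S y U -> exists A, U = A *m J *m refl (y - x).
Proof.
move=> w0 Jf; have [A A0 AJ] := orthonormal_basis Jf.
have AJp : posframe J (A *m J) by split=> //; exists A.
have Au : A \in unitmx by rewrite unitmxE unitfE gt_eqF.
suff H : positive_sphere_frame S x (A *m J) -> sphere_points S x ->
    sphere_points S y -> positive_sphere_frame S y U ->
    (U *m refl (y - x) <= A *m J)%MS.
  move=> Sx Sy Sframe SyU; have /submxP[C CE] := H ((Sframe _).2 AJp) Sx Sy SyU.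
  by exists (C *m A); rewrite -[C *m A *m J]mulmxA -CE -mulmxA refl_inv// mulmx1.
case: S => [z r B r0 Bf|z B Bf] /=; last first.
  move=> [_ [C [C0 CB]]] xB yB [UU [D [D0 DB]]].
  have Cu : C \in unitmx by rewrite unitmxE unitfE gt_eqF.
  have BJ : (B <= A *m J)%MS.
    by apply/submxP; exists (invmx C); rewrite CB mulmxA mulVmx// mul1mx.
  apply: submx_refl; last by rewrite DB; exact: submx_trans (submxMl _ _) BJ.
  rewrite (_ : y - x = (y - z) - (x - z)); last by rewrite opprB addrA subrK.
  by rewrite addmx_sub// ?eqmx_opp; exact: submx_trans BJ.
move=> [_ [xU [C [C0 CB]]]] [xB xr] [yB yr] [UU [yU [D [D0 DB]]]].
have Cu : C \in unitmx by rewrite unitmxE unitfE gt_eqF.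
have BE : B = invmx C *m col_mx (x - z) (A *m J) by rewrite CB mulmxA mulVmx// mul1mx.
have wB : (y - x <= B)%MS.
  rewrite (_ : y - x = (y - z) - (x - z)); last by rewrite opprB addrA subrK.
  by rewrite addmx_sub// eqmx_opp.
have UB : (U <= B)%MS.
  by apply/submxP; exists (dsubmx D); rewrite -[D]vsubmxK mul_col_mx in DB;
    case/eq_col_mx: DB.
have xyz : sqn (x - z) = sqn (y - z) by rewrite -!enorm_sqr xr yr.
have xw : y - z - (x - z) != 0 by rewrite opprB addrA subrK.
have xR : (x - z) *m refl (y - x) = y - z.
  rewrite (_ : y - x = y - z - (x - z)); last by rewrite opprB addrA subrK.
  exact: refl_swap.
have /submxP[E EE] := submx_refl wB UB.
have URx : U *m refl (y - x) *m (x - z)^T = 0.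
  by rewrite -mulmxA -[refl _]tr_refl -trmx_mul xR.
move: EE; rewrite BE mulmxA -[E *m _]hsubmxK mul_row_col; set a := lsubmx _ => EE.
have xz0 : x - z != 0 by rewrite -sqn_gt0 -sqrtr_gt0 -enormE xr.
have a0 : a = 0.
  move: URx; rewrite EE mulmxDl -[_ *m (A *m J) *m _]mulmxA xU mulmx0 addr0.
  rewrite -mulmxA dotpE mul_mx_scalar => /eqP; rewrite scaler_eq0 -sqn_dotp sqn_eq0.
  by rewrite (negPf xz0) => /eqP.
by rewrite EE a0 mul0mx add0r submxMl.
Qed.

(** The value is the same for every admissible sphere and every choice of frames, so uniqueness of
    the tangent sphere never has to be proved. *)
Lemma sphere_frame_det m n (S : oriented_sphere R m n) (x y : 'rV[R]_n)
    (J K U V : 'M[R]_(m, n)) : y - x != 0 -> row_free J ->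
  sphere_points S x -> sphere_points S y ->
  (forall U, positive_sphere_frame S x U <-> posframe J U) ->
  positive_sphere_frame S y U -> posframe K V ->
  \det (U *m V^T) ^+ 2 = Gamma J K (y - x).
Proof.
move=> w0 Jf Sx Sy SJ SU [VV [B [B0 VE]]].
have [A UE] := sphere_frame_refl w0 Jf Sx Sy SJ SU.
have UU : orthonormal_rows U by case: SU.
have AU : orthonormal_rows (A *m J).
  by have := orthonormal_refl w0 UU; rewrite UE -!mulmxA refl_inv// mulmx1.
rewrite (Gamma_orthonormal (y - x) AU (B := B)); last by rewrite -VE.
by rewrite -UE -VE.
Qed.

End TangentSphere.

(** * Charts, tangent frames and the formula for the combined angle *)

Section Charts.
Context {R : realType}.

Lemma cimg_cfun m (M : topologicalType) (c : chart R m M) p :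
  cdom c p -> cimg c (cfun c p).
Proof. by exists p. Qed.

Lemma cinvK m (M : topologicalType) (c : chart R m M) t :
  cimg c t -> cdom c (cinv c t) /\ cfun c (cinv c t) = t.
Proof. by move=> [q cq <-]; rewrite cfunK. Qed.

Lemma cinv_near m (M : topologicalType) (c : chart R m M) p (A : set M) :
  cdom c p -> nbhs p A -> \forall t \near cfun c p, A (cinv c t).
Proof.
move=> cp pA; have := cinv_continuous (cimg_cfun cp).
by rewrite /prop_for/continuous_at cfunK// => H; exact: H pA.
Qed.

Lemma cdom_near m (M : topologicalType) (c : chart R m M) p :
  cdom c p -> nbhs p (cdom c).
Proof. by move=> cp; apply: open_nbhs_nbhs; split=> //; exact: cdom_open. Qed.

Lemma cimg_near m (M : topologicalType) (c : chart R m M) t :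
  cimg c t -> \forall s \near t, cimg c s.
Proof. by move=> ct; apply: open_nbhs_nbhs; split=> //; exact: cimg_open. Qed.

Lemma compatible_C1 m (M : topologicalType) (c d : chart R m M) p :
  C2_compatible c d -> cdom c p -> cdom d p ->
  C1 (cfun d \o cinv c) (cfun c p).
Proof.
move=> [cd _] cp dp; have [|H _] := C2_on_C1 cd (t := cfun c p); first by exists p.
exact: H.
Qed.

Lemma compatible_sym m (M : topologicalType) (c d : chart R m M) :
  C2_compatible c d -> C2_compatible d c.
Proof. by move=> [cd dc]; split; rewrite setIC. Qed.

Lemma chart_comp_C1 m n (M : topologicalType) (c d : chart R m M)
    (f : M -> 'rV[R]_n) p : cdom c p -> cdom d p ->
  C1 (cfun d \o cinv c) (cfun c p) -> C1 (f \o cinv d) (cfun d p) ->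
  C1 (f \o cinv c) (cfun c p) /\
  tangent_mx c f p = 'J (cfun d \o cinv c) (cfun c p) *m tangent_mx d f p.
Proof.
move=> cp dp cdC fC.
have cpE : (cfun d \o cinv c) (cfun c p) = cfun d p by rewrite /= cfunK.
have fC' : C1 (f \o cinv d) ((cfun d \o cinv c) (cfun c p)) by rewrite cpE.
have H : {near cfun c p, (f \o cinv d) \o (cfun d \o cinv c) =1 f \o cinv c}.
  by apply: filterS (cinv_near cp (cdom_near dp)) => t dt /=; rewrite cfunK.
have [C JE] := near_eq_C1 H (C1_comp cdC fC'); split; first exact: C.
rewrite /tangent_mx JE (jacobian_comp (C1_diff cdC) (C1_diff fC')).
by rewrite cpE.
Qed.

Lemma jacobian_id m (f : 'rV[R]_m -> 'rV[R]_m) t :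
  (\forall s \near t, f s = s) -> 'J f t = 1%:M.
Proof.
move=> ft; have [|_ H] := @differentiable_approx R m m f t 1%:M; last exact: H.
move=> e e0; have t0 := nbhs_singleton ft; near=> s.
have -> : f s = s by near: s.
by rewrite t0 mulmx1 subrr normr0 mulr_ge0// ltW.
Unshelve. all: by end_near. Qed.

Lemma transition_inv m (M : topologicalType) (c d : chart R m M) p :
  cdom c p -> cdom d p -> C1 (cfun d \o cinv c) (cfun c p) ->
  C1 (cfun c \o cinv d) (cfun d p) ->
  'J (cfun d \o cinv c) (cfun c p) *m 'J (cfun c \o cinv d) (cfun d p) = 1%:M.
Proof.
move=> cp dp cd dc; have [_] := chart_comp_C1 cp dp cd dc.
rewrite /tangent_mx => <-; apply: jacobian_id.
by apply: filterS (cimg_near (cimg_cfun cp)) => t /cinvK[].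
Qed.

(** Compatibility is given only with charts of the atlas, so two oriented charts are compared
    through an atlas chart. *)
Lemma ochart_C1 m (M : closed_manifold R m) (o : orientation M) (c d : chart R m M) p :
  ocharts o c -> ocharts o d -> cdom c p -> cdom d p ->
  C1 (cfun d \o cinv c) (cfun c p).
Proof.
move=> oc od cp dp; have [a aa ap] := atlas_cover p.
have ca := compatible_C1 (ocharts_compatible oc aa) cp ap.
have ad := compatible_C1 (compatible_sym (ocharts_compatible od aa)) ap dp.
by have [H _] := chart_comp_C1 cp ap ca ad; exact: H.
Qed.

Section Immersed.
Context {m n : nat} {M : closed_manifold R m} {f : M -> 'rV[R]_n}.
Hypothesis fI : immersion f.

Lemma immersion_C1 c p : atlas c -> cdom c p -> C1 (f \o cinv c) (cfun c p).
Proof.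
move=> ac cp; have [fC _] := fI ac.
have [H _] := C2_on_C1 fC (cimg_cfun cp); exact: H.
Qed.

Lemma immersion_free c p : atlas c -> cdom c p -> row_free (tangent_mx c f p).
Proof. by move=> ac cp; have [_] := fI ac; apply. Qed.

Lemma ochart_tangent (o : orientation M) (c d : chart R m M) p :
  ocharts o c -> atlas d -> cdom c p -> cdom d p ->
  C1 (f \o cinv c) (cfun c p) /\
  exists2 T : 'M[R]_m, T \in unitmx & tangent_mx c f p = T *m tangent_mx d f p.
Proof.
move=> oc ad cp dp; have cd := ocharts_compatible oc ad.
have C := compatible_C1 cd cp dp.
have C' := compatible_C1 (compatible_sym cd) dp cp.
have [H E] := chart_comp_C1 cp dp C (immersion_C1 ad dp); split; first exact: H.
exists ('J (cfun d \o cinv c) (cfun c p)); last exact: E.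
have [Hu _] := mulmx1_unit (transition_inv cp dp C C'); exact: Hu.
Qed.

(** Transition Jacobians between oriented charts have positive determinant, so a frame that is
    positive in one of them is positive in the others. *)
Lemma positive_tangent_frameP (o : orientation M) (c : chart R m M) p V :
  ocharts o c -> cdom c p ->
  positive_tangent_frame o f p V <-> posframe (tangent_mx c f p) V.
Proof.
move=> oc cp; split=> [[VV [d [od dp [A [A0 VE]]]]]|[VV HA]]; last by split=> //; exists c.
split=> //; have [a aa ap] := atlas_cover p.
have [fcC _] := ochart_tangent oc aa cp ap.
have [_ E] := chart_comp_C1 dp cp (ochart_C1 od oc dp cp) fcC.
exists (A *m 'J (cfun c \o cinv d) (cfun d p)).
split; last exact: (etrans VE (etrans (congr1 (mulmx A) E) (mulmxA _ _ _))).
by rewrite det_mulmx; apply: mulr_gt0 A0 _; exact: (ocharts_positive od oc dp cp).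
Qed.

(** Every angle in the set from which [combined_angle] picks satisfies the formula, so the choice
    does not matter once the set is nonempty. A member is the arc cosine of the determinant for a
    constructed sphere and frames. *)
Lemma combined_angleP (o : orientation M) (c d : chart R m M) p q :
  (0 < m)%N -> atlas c -> atlas d -> cdom c p -> cdom d q -> f p != f q ->
  cos (combined_angle o f p q) ^+ 2 =
  Gamma (tangent_mx c f p) (tangent_mx d f q) (f q - f p).
Proof.
move=> m0 ac ad cp dq fpq; have w0 : f q - f p != 0 by rewrite subr_eq0 eq_sym.
have [oc occ ocp] := ocharts_cover o p.
have [od odd odq] := ocharts_cover o q.
have [_ [T Tu TE]] := ochart_tangent occ ac ocp cp.
have [_ [T' T'u T'E]] := ochart_tangent odd ad odq dq.
have Jpf := immersion_free ac cp; have Jqf := immersion_free ad dq.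
have free (A : 'M[R]_m) (J : 'M[R]_(m, n)) : A \in unitmx -> row_free J -> row_free (A *m J).
  by move=> Au Jf; rewrite /row_free mxrankMfree// -/(row_free A) row_free_unit.
have freeE (A : 'M[R]_m) (J K : 'M[R]_(m, n)) :
    A \in unitmx -> row_free J -> K = A *m J -> row_free K.
  by move=> Au Jf ->; exact: free.
have Kp : row_free (tangent_mx oc f p) by exact: freeE TE.
have Kq : row_free (tangent_mx od f q) by exact: freeE T'E.
have GE (J J' K K' : 'M[R]_(m, n)) w : K = T *m J -> K' = T' *m J' ->
    Gamma J J' w = Gamma K K' w by move=> -> ->; rewrite Gamma_unitmx.
rewrite (GE _ _ _ _ _ TE T'E).
have angleP th : (exists (S : oriented_sphere R m n) (U V : 'M[R]_(m, n)),
      [/\ is_tangent_sphere o f p q S,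
          positive_sphere_frame S (f q) U,
          positive_tangent_frame o f q V &
          cos th = \det (U *m V^T)]) ->
    cos th ^+ 2 = Gamma (tangent_mx oc f p) (tangent_mx od f q) (f q - f p).
  move=> [S [U [V [[Sp Sq SU] SqU]]]].
  move=> /(positive_tangent_frameP _ odd odq) Vq ->.
  apply: (sphere_frame_det w0 Kp Sp Sq _ SqU Vq) => W.
  by apply: (iff_trans (SU W)); exact: positive_tangent_frameP.
rewrite /combined_angle; set P := (X in get X).
suff [th Pth] : exists th, P th.
  by have [_] := @getPex _ P (ex_intro _ th Pth); exact: angleP.
have [S [Sp Sq SU]] := exists_tangent_sphere w0 Kp.
have [U SqU] := exists_sphere_frame m0 w0 Kp Sp Sq SU.
have [B B0 BJ] := orthonormal_basis Kq.
have UU : orthonormal_rows U by case: SqU.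
have posB (J : 'M[R]_(m, n)) : orthonormal_rows (B *m J) -> posframe J (B *m J).
  by move=> H; split=> //; exists B.
have Vq : positive_tangent_frame o f q (B *m tangent_mx od f q).
  exact: (positive_tangent_frameP _ odd odq).2 (posB _ BJ).
have d1 : -1 <= \det (U *m (B *m tangent_mx od f q)^T) <= 1.
  rewrite -ler_norml -(@expr_le1 _ 2)// real_normK ?num_real//.
  exact: (det_contraction UU BJ).1.
have [/andP[th0 thpi] thE] := acos_def d1.
exists (acos (\det (U *m (B *m tangent_mx od f q)^T))); split.
  by rewrite th0 thpi.
have St : is_tangent_sphere o f p q S.
  split; [exact: Sp|exact: Sq|move=> W; apply: (iff_trans (SU W))].
  by apply: iff_sym; exact: positive_tangent_frameP.
exists S, U, (B *m tangent_mx od f q); split; [exact: St|exact: SqU|exact: Vq|].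
exact: thE.
Qed.

End Immersed.
End Charts.

(** * Local parametrisations and their transport by diffeomorphisms *)

Section Params.
Context {R : realType}.

Lemma row_free_mulmx m n (A : 'M[R]_m) (J : 'M[R]_(m, n)) :
  A \in unitmx -> row_free J -> row_free (A *m J).
Proof.
by move=> Au Jf; rewrite /row_free mxrankMfree// -/(row_free A) row_free_unit.
Qed.

Lemma C2_mapping_near m (M N : closed_manifold R m) (phi : M -> N) p (A : set N) :
  C2_mapping phi -> nbhs (phi p) A -> nbhs p (phi @^-1` A).
Proof. by move=> [phic _] pA; exact: phic pA. Qed.

Lemma C2_mapping_C1 m (M N : closed_manifold R m) (phi : M -> N)
    (c : chart R m M) (d : chart R m N) p :
  C2_mapping phi -> atlas c -> atlas d -> cdom c p -> cdom d (phi p) ->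
  C1 (cfun d \o phi \o cinv c) (cfun c p).
Proof.
move=> [_ phiC] ac ad cp dp; have [|H _] := C2_on_C1 (phiC _ _ ac ad) (t := cfun c p).
  by exists p.
exact: H.
Qed.

Lemma tangent_mx_comp m n (M N : closed_manifold R m) (phi : M -> N)
    (g : N -> 'rV[R]_n) (c : chart R m M) (d : chart R m N) p :
  immersion g -> C2_mapping phi -> atlas c -> atlas d -> cdom c p -> cdom d (phi p) ->
  tangent_mx c (g \o phi) p =
    'J (cfun d \o phi \o cinv c) (cfun c p) *m tangent_mx d g (phi p).
Proof.
move=> gI phiC ac ad cp dp.
have C := C2_mapping_C1 phiC ac ad cp dp.
have E : (cfun d \o phi \o cinv c) (cfun c p) = cfun d (phi p) by rewrite /= cfunK.
have gC := immersion_C1 gI ad dp.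
have gC' : C1 (g \o cinv d) ((cfun d \o phi \o cinv c) (cfun c p)) by rewrite E; exact: gC.
have H : {near cfun c p, (g \o cinv d) \o (cfun d \o phi \o cinv c) =1 (g \o phi) \o cinv c}.
  have := cinv_near cp (C2_mapping_near phiC (cdom_near dp)).
  by apply: filterS => t dt /=; rewrite cfunK.
have [_ JE] := near_eq_C1 H (C1_comp C gC').
by rewrite /tangent_mx JE (jacobian_comp (C1_diff C) (C1_diff gC')) E.
Qed.

Lemma diffeo_jacobian_unit m (M N : closed_manifold R m) (phi : M -> N)
    (c : chart R m M) (d : chart R m N) p :
  C2_diffeo phi -> atlas c -> atlas d -> cdom c p -> cdom d (phi p) ->
  'J (cfun d \o phi \o cinv c) (cfun c p) \in unitmx.
Proof.
move=> [phiC [psi [psiC phiK psiK]]] ac ad cp dp.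
have C := C2_mapping_C1 phiC ac ad cp dp.
have E : (cfun d \o phi \o cinv c) (cfun c p) = cfun d (phi p) by rewrite /= cfunK.
have cp' : cdom c (psi (phi p)) by rewrite phiK.
have D := C2_mapping_C1 psiC ad ac dp cp'.
have D' : C1 (cfun c \o psi \o cinv d) ((cfun d \o phi \o cinv c) (cfun c p)).
  by rewrite E; exact: D.
have JE := jacobian_comp (C1_diff C) (C1_diff D').
have H : \forall t \near cfun c p,
    ((cfun c \o psi \o cinv d) \o (cfun d \o phi \o cinv c)) t = t.
  have := cinv_near cp (C2_mapping_near phiC (cdom_near dp)).
  apply: filterS2 (cimg_near (cimg_cfun cp)) => t /cinvK[ct tE] dt /=.
  by rewrite cfunK// phiK.
have [Hu _] := mulmx1_unit (etrans (esym JE) (jacobian_id H)); exact: Hu.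
Qed.

Lemma immersion_diffeo m n (M N : closed_manifold R m) (phi : M -> N)
    (g : N -> 'rV[R]_n) : immersion g -> C2_diffeo phi -> immersion (g \o phi).
Proof.
move=> gI phiD c ac; have [phiC _] := phiD; split; last first.
  move=> p cp; have [d ad dp] := atlas_cover (phi p).
  have Ju := diffeo_jacobian_unit phiD ac ad cp dp.
  have Jf := immersion_free gI ad dp.
  have := row_free_mulmx Ju Jf.
  by rewrite (tangent_mx_comp gI phiC ac ad cp dp).
(* Being C^2 is local: a chart [d] around the image point factors the composite into two maps known
   to be C^2. *)
have loc t : cimg c t -> exists2 V, V t & C2_on V ((g \o phi) \o cinv c).
  move=> [p cp <-]; have [d ad dp] := atlas_cover (phi p).
  have [_ /(_ _ _ ac ad) C] := phiC; have [gC _] := gI d ad.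
  exists (cfun c @` (cdom c `&` phi @^-1` cdom d)); first by exists p.
  apply: C2_on_eq (C2_on_comp _ C gC).
  - by move=> t' [q [cq dq] <-] /=; rewrite !cfunK.
  - by move=> t' [q [cq dq] <-] /=; rewrite cfunK//; exists (phi q).
apply: C1_C2_on => [|t ct|i t ct].
- exact: cimg_open.
- by have [V Vt VC] := loc t ct; have [H _] := C2_on_C1 VC Vt; exact: H.
- by have [V Vt VC] := loc t ct; have [_ H] := C2_on_C1 VC Vt; exact: H.
Qed.

(* More flexible than the charts of the atlas, which need not be maximal: this
   notion is stable under C^2-diffeomorphisms. *)
Definition local_param m (M : closed_manifold R m) (U : set 'rV[R]_m)
    (theta : 'rV[R]_m -> M) (tau : M -> 'rV[R]_m) :=
  [/\ open U, forall t, U t -> tau (theta t) = t,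
      forall V, open V -> V `<=` U -> open (theta @` V),
      forall t, U t -> {for t, continuous theta} &
      forall (d : chart R m M) t, atlas d -> U t -> cdom d (theta t) ->
        C1 (cfun d \o theta) t /\ C1 (tau \o cinv d) (cfun d (theta t))].

Lemma local_param_chart m (M : closed_manifold R m) (c : chart R m M) U :
  atlas c -> open U -> U `<=` cimg c -> local_param U (cinv c) (cfun c).
Proof.
move=> ac oU Uc; split.
- exact: oU.
- by move=> t /Uc/cinvK[].
- move=> V oV VU.
  have -> : cinv c @` V = cdom c `&` cfun c @^-1` V.
    apply/seteqP; split => [_ [t Vt <-]|p [cp Vp]].
      have [ct tE] := cinvK (Uc _ (VU _ Vt)); split=> //=.
      by rewrite tE.
    by exists (cfun c p) => //; rewrite cfunK.
  rewrite openE => p [cp Vp]; apply: filterI; first exact: cdom_near.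
  exact: (cfun_continuous cp (open_nbhs_nbhs (conj oV Vp))).
- by move=> t /Uc; exact: cinv_continuous.
- move=> d t ad Ut dt; have [ct tE] := cinvK (Uc _ Ut).
  have cd := atlas_compatible ac ad; split.
    by have := compatible_C1 cd ct dt; rewrite tE.
  exact: compatible_C1 (compatible_sym cd) dt ct.
Qed.

Lemma local_param_diffeo m (M N : closed_manifold R m) U theta tau
    (phi : M -> N) (psi : N -> M) :
  C2_mapping phi -> C2_mapping psi -> cancel phi psi -> cancel psi phi ->
  local_param U theta tau -> local_param U (phi \o theta) (tau \o psi).
Proof.
move=> phiC psiC phiK psiK [oU tauK op tc C]; split.
- exact: oU.
- by move=> t Ut /=; rewrite phiK tauK.
- move=> V oV VU; have -> : (phi \o theta) @` V = psi @^-1` (theta @` V).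
    apply/seteqP; split => [_ [t Vt <-]|p [t Vt tp]].
      by exists t; rewrite //= phiK.
    by exists t; rewrite //= tp psiK.
  by apply: open_comp (op _ oV VU) => p _; exact: psiC.1.
- move=> t Ut; apply: continuous_comp; first exact: tc.
  exact: phiC.1.
- move=> d t ad Ut dt; have [c ac ct] := atlas_cover (theta t).
  have [C1' C2'] := C c t ac Ut ct.
  have E : cfun c (theta t) = (cfun c \o theta) t by [].
  have D := C2_mapping_C1 phiC ac ad ct dt.
  have ct' : cdom c (psi (phi (theta t))) by rewrite phiK.
  have D' := C2_mapping_C1 psiC ad ac dt ct'.
  have E' : (cfun c \o psi \o cinv d) (cfun d (phi (theta t))) = cfun c (theta t).
    by rewrite /= cfunK// phiK.
  split.
    have H := C1_comp C1' D.
    have [H' _] : C1 (cfun d \o (phi \o theta)) t /\ 'J (cfun d \o (phi \o theta)) t =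
      'J ((cfun d \o phi \o cinv c) \o (cfun c \o theta)) t.
      apply: near_eq_C1 H; have K := tc t Ut _ (cdom_near ct); near=> s.
      have cs : cdom c (theta s) by near: s; exact: K.
      move=> /=.
      by rewrite cfunK.
    exact: H'.
  have C3 : C1 (tau \o cinv c) ((cfun c \o psi \o cinv d) (cfun d (phi (theta t)))).
    by rewrite E'; exact: C2'.
  have H := C1_comp D' C3.
  have [H' _] : C1 ((tau \o psi) \o cinv d) (cfun d ((phi \o theta) t)) /\
      'J ((tau \o psi) \o cinv d) (cfun d ((phi \o theta) t)) =
      'J ((tau \o cinv c) \o (cfun c \o psi \o cinv d)) (cfun d (phi (theta t))).
    apply: near_eq_C1 H.
    have := cinv_near dt (C2_mapping_near psiC (cdom_near ct')).
    by apply: filterS => s cs /=; rewrite cfunK.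
  exact: H'.
Unshelve. all: by end_near. Qed.

Section ParamImmersion.
Context {m n : nat} {M : closed_manifold R m}.
Variables (U : set 'rV[R]_m) (theta : 'rV[R]_m -> M) (tau : M -> 'rV[R]_m).
Variables (g : M -> 'rV[R]_n).
Hypothesis gI : immersion g.
Hypothesis thetaP : local_param U theta tau.

Lemma param_C1 d t : atlas d -> U t -> cdom d (theta t) ->
  C1 (g \o theta) t /\
  'J (g \o theta) t = 'J (cfun d \o theta) t *m tangent_mx d g (theta t).
Proof.
have [oU tauK op tc C] := thetaP; move=> ad Ut dt.
have [D _] := C d t ad Ut dt.
have gC : C1 (g \o cinv d) ((cfun d \o theta) t) by have H := immersion_C1 gI ad dt; exact: H.
have H : {near t, (g \o cinv d) \o (cfun d \o theta) =1 g \o theta}.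
  have K := tc t Ut _ (cdom_near dt); near=> s.
  have ds : cdom d (theta s) by near: s; exact: K.
  by rewrite /= cfunK.
have [C' JE] := near_eq_C1 H (C1_comp D gC); split; first exact: C'.
by rewrite JE (jacobian_comp (C1_diff D) (C1_diff gC)).
Unshelve. all: by end_near. Qed.

Lemma param_inv d t : atlas d -> U t -> cdom d (theta t) ->
  'J (cfun d \o theta) t *m 'J (tau \o cinv d) (cfun d (theta t)) = 1%:M.
Proof.
have [oU tauK op tc C] := thetaP; move=> ad Ut dt.
have [D D'] := C d t ad Ut dt.
have JE := jacobian_comp (C1_diff D) (C1_diff (D' : C1 _ ((cfun d \o theta) t))).
rewrite -[LHS]JE; apply: jacobian_id.
have K := tc t Ut _ (cdom_near dt); near=> s.
have ds : cdom d (theta s) by near: s; exact: K.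
have Us : U s by near: s; exact: open_nbhs_nbhs.
by rewrite /= cfunK// tauK.
Unshelve. all: by end_near. Qed.

Lemma param_unit d t : atlas d -> U t -> cdom d (theta t) ->
  'J (cfun d \o theta) t \in unitmx /\
  'J (tau \o cinv d) (cfun d (theta t)) \in unitmx.
Proof. move=> ad Ut dt; exact: mulmx1_unit (param_inv ad Ut dt). Qed.

End ParamImmersion.

End Params.

(** * Lower bounds for integrals *)

Section LowerIntegral.
Context {R : realType}.

(* No measurability is assumed: for nonnegative functions the library's
   integral is a supremum over simple functions below, hence monotone. *)
Lemma ge0_le_lower_integral d (T : measurableType d) (mu : {measure set T -> \bar R})
    (f g : T -> \bar R) :
  (forall x, 0 <= f x)%E -> (forall x, f x <= g x)%E ->
  (\int[mu]_(x in [set: T]) f x <= \int[mu]_(x in [set: T]) g x)%E.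
Proof.
move=> f0 fg; have g0 x : (0 <= g x)%E by exact: le_trans (f0 x) (fg x).
rewrite !ge0_integralTE//; apply: le_ereal_sup => _ [h hf <-].
by exists h => // x; exact: le_trans (hf x) (fg x).
Qed.

Lemma integral_ge_cst d (T : measurableType d) (mu : {measure set T -> \bar R})
    (g : T -> \bar R) (A : set T) (L : R) : measurable A -> 0 <= L ->
  (forall x, 0 <= g x)%E -> (forall x, A x -> L%:E <= g x)%E ->
  (L%:E * mu A <= \int[mu]_(x in [set: T]) g x)%E.
Proof.
move=> mA L0 g0 gL; rewrite -integral_cst// integral_mkcond.
apply: ge0_le_lower_integral => x; rewrite patchE; case: ifPn => //.
  by rewrite inE => /gL.
Qed.

Lemma integral_rV_ge0 m (g : 'rV[R]_m -> \bar R) :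
  (forall s, 0 <= g s)%E -> (0 <= integral_rV g)%E.
Proof.
elim: m g => [g g0|m IH g g0] /=; first exact: g0.
by apply: integral_ge0 => x _; apply: IH => t; exact: g0.
Qed.

(** Plays the part of a linear change of variables, for an arbitrary nonnegative [g]. Induction by
    slicing: on the slab [s (x - x0)^2 < r^2 / 2] the slice of the ellipsoid still contains an
    ellipsoid of radius [r / sqrt 2] for the form [S']. *)
Lemma integral_rV_ellipsoid m : exists2 c : R, 0 < c &
  forall (S : 'M[R]_m) (s0 : 'rV[R]_m) (r K : R) (g : 'rV[R]_m -> \bar R),
  posdef S -> 0 < r -> 0 <= K -> (forall s, 0 <= g s)%E ->
  (forall s, qform S (s - s0) < r ^+ 2 -> (K%:E <= g s)%E) ->
  ((c * K * r ^+ m / Num.sqrt (\det S))%:E <= integral_rV g)%E.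
Proof.
elim: m => [|m [c c0 IH]].
  exists 1 => // S s0 r K g _ r0 _ _ gK /=.
  rewrite expr0 det_mx00 sqrtr1 invr1 !mulr1 mul1r; apply: gK.
  by rewrite /qform mxE big_ord0 exprn_gt0.
pose q := Num.sqrt (2 : R); have q0 : 0 < q by rewrite sqrtr_gt0.
have q2 : q ^+ 2 = 2 by rewrite sqr_sqrtr.
exists (c * 2 / q ^+ m.+1); first by rewrite divr_gt0 ?mulr_gt0 ?exprn_gt0.
move=> S s0 r K g Spd r0 K0 g0 gK.
have [s [gam [sp _ dS qS]]] := @posdef_det_schur R m S Spd.
have S'pd := posdef_drsub (Spd : @posdef R (1 + m) S).
set S' := drsubmx _ in dS qS S'pd; have S'0 := posdef_det_gt0 S'pd.
pose x0 := lsubmx (s0 : 'rV[R]_(1 + m)) ord0 ord0; pose t0 := rsubmx (s0 : 'rV[R]_(1 + m)).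
have s0E : s0 = row_mx (x0%:M) t0 :> 'rV[R]_(1 + m).
  by rewrite -[LHS](hsubmxK (s0 : 'rV[R]_(1 + m))); congr row_mx; exact: mx11_scalar.
pose rho := r / (q * Num.sqrt s).
have ss0 : 0 < Num.sqrt s by rewrite sqrtr_gt0.
have rho0 : 0 < rho by rewrite divr_gt0// mulr_gt0.
pose L := c * K * (r / q) ^+ m / Num.sqrt (\det S').
have L0 : 0 <= L.
  by rewrite divr_ge0 ?sqrtr_ge0// !mulr_ge0 ?exprn_ge0 ?divr_ge0 ?(ltW c0) ?(ltW r0) ?(ltW q0).
have inner x : `]x0 - rho, x0 + rho[%classic x ->
    (L%:E <= integral_rV (fun t : 'rV[R]_m => g (row_mx (const_mx x : 'rV_1) t)))%E.
  rewrite /= in_itv/= => xI.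
  (* Completing the square moves the centre of the slice by [- (x - x0) *: gam]. *)
  apply: (IH S' (t0 - (x - x0) *: gam) (r / q)) => // [|t tI]; first by rewrite divr_gt0.
  apply: gK; rewrite [s0 in _ - s0]s0E.
  have -> : row_mx (const_mx x) t - row_mx x0%:M t0 = row_mx ((x - x0)%:M) (t - t0).
    rewrite opp_row_mx add_row_mx; congr row_mx.
    by apply/matrixP => i j; rewrite !ord1 !mxE eqxx !mulr1n.
  rewrite qS; move: tI; rewrite opprB addrA addrAC => tI.
  have : s * (x - x0) ^+ 2 < r ^+ 2 / 2.
    have : (x - x0) ^+ 2 < rho ^+ 2.
      rewrite -[_ ^+ 2]real_normK ?num_real// ltrXn2r ?nnegrE ?(ltW rho0)//.
      by rewrite ltr_distl.
    rewrite /rho expr_div_n exprMn q2 sqr_sqrtr ?(ltW sp)// => H.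
    by rewrite mulrC -ltr_pdivlMr// -mulrA -invfM.
  move: tI; rewrite expr_div_n q2 addrAC => H1 H2.
  by rewrite [ltRHS]splitr ltrD.
have G0 x : (0 <= integral_rV (fun t : 'rV[R]_m => g (row_mx (const_mx x : 'rV_1) t)))%E.
  by apply: integral_rV_ge0 => t; exact: g0.
have mI : measurable (`]x0 - rho, x0 + rho[%classic : set R) by exact: measurable_itv.
have H := integral_ge_cst (@lebesgue_measure R) mI L0 G0 inner.
have muI : lebesgue_measure (`]x0 - rho, x0 + rho[%classic : set R) = (2 * rho)%:E.
  rewrite lebesgue_measure_itv/= lte_fin ltrD2l gtrN// -EFinD; congr _%:E; ring.
apply: le_trans (_ : (L * (2 * rho))%:E <= _)%E; last first.
  by rewrite EFinM -muI; exact: H.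
rewrite lee_fin le_eqVlt; apply/orP; left; apply/eqP.
rewrite dS sqrtrM ?(ltW sp)// /L /rho.
have ds0 : 0 < Num.sqrt (\det S') by rewrite sqrtr_gt0.
rewrite expr_div_n !exprS; field.
by rewrite (lt0r_neq0 ss0) (lt0r_neq0 q0) (lt0r_neq0 ds0) expf_neq0 ?(lt0r_neq0 q0).
Qed.

End LowerIntegral.

(** * Volume of small parametrised cubes *)

Section LocalVolume.
Context {R : realType}.

(** Half-open, so that a cube is the disjoint union of its subcubes. *)
Definition cube m (a : 'rV[R]_m) (l : R) : set 'rV[R]_m :=
  [set t | forall i, a ord0 i <= t ord0 i < a ord0 i + l].

Lemma open_coord_lt m (b : 'rV[R]_m) :
  open [set t : 'rV[R]_m | forall i, t ord0 i < b ord0 i].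
Proof.
rewrite openE => t tb.
have H i : \forall s \near t, (s : 'rV[R]_m) ord0 i < b ord0 i.
  have /(_ [set x | x < b ord0 i]) := @coord_continuous R 1 m ord0 i t.
  by apply; apply: open_nbhs_nbhs; split; [exact: open_lt|exact: tb].
exact: filter_forall H.
Qed.

Lemma measurable_open (M : ptopologicalType) (A : set M) :
  open A -> measurable (A : set (borel M)).
Proof. by move=> oA; apply: sub_sigma_algebra. Qed.

(** A half-open cube is a difference of two open sets; [theta] is injective on [U] and maps its open
    subsets to open sets, so the image is again such a difference. *)
Lemma measurable_cube m (M : closed_manifold R m) U theta tau a l :
  @local_param R m M U theta tau -> cube a l `<=` U ->
  measurable (theta @` cube a l : set (borel M)).
Proof.
move=> [oU tauK op _ _] aU.
pose U1 := U `&` [set t | forall i, t ord0 i < (a + const_mx l) ord0 i].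
pose U2 := U1 `&` [set t | exists i, t ord0 i < a ord0 i].
have oU1 : open U1 by apply: openI oU _; exact: open_coord_lt.
have oU2 : open U2.
  apply: openI => //; rewrite openE => t [i ti].
  have /(_ [set x | x < a ord0 i]) := @coord_continuous R 1 m ord0 i t.
  move=> /(_ (open_nbhs_nbhs (conj (@open_lt _ _) ti))) H.
  by apply: (@filterS _ (nbhs t) _ _ _ _ H) => s si; exists i.
have -> : theta @` cube a l = theta @` U1 `\` theta @` U2.
  apply/seteqP; split=> [_ [t ta <-]|_ [[t [Ut t1] <-] tU2]].
    have Ut := aU _ ta; split.
      by exists t => //; split=> // i; rewrite !mxE; case/andP: (ta i).
    move=> [s [[Us _] [i si]] ts].
    have E : s = t by rewrite -(tauK _ Us) ts tauK.
    by move: si; rewrite E ltNge; case/andP: (ta i) => ->.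
  exists t => // i; have := t1 i; rewrite !mxE => ->; rewrite andbT.
  rewrite leNgt; apply/negP => ti; apply: tU2; exists t => //.
  by split; [split|exists i].
apply: (@measurableD _ (borel M)); apply: measurable_open; apply: op => //.
  by move=> t [].
by move=> t [[]].
Qed.

Definition gram m n (J : 'M[R]_(m, n)) : R := Num.sqrt (\det (J *m J^T)).

Lemma gram_mulmx m n (A : 'M[R]_m) (J : 'M[R]_(m, n)) :
  gram (A *m J) = `|\det A| * gram J.
Proof.
rewrite /gram trmx_mul mulmxA -[A *m J *m _]mulmxA !det_mulmx det_tr mulrAC -expr2.
by rewrite sqrtrM ?sqr_ge0// sqrtr_sqr.
Qed.

(** The chain rule for [(f \o theta) \o tau], obtained by inverting the Jacobian of [theta] read in
    the chart [d]. *)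
Lemma tangent_param m n (M : closed_manifold R m) U theta tau (f : M -> 'rV[R]_n)
    (d : chart R m M) s (t := (tau \o cinv d) s) :
  immersion f -> local_param U theta tau -> atlas d -> cimg d s ->
  U t -> theta t = cinv d s ->
  'J (f \o cinv d) s = 'J (tau \o cinv d) s *m 'J (f \o theta) t.
Proof.
move=> fI tP ad ds Ut tE; have [cs sE] := cinvK ds.
have dt : cdom d (theta t) by rewrite tE.
have [_ JE] := param_C1 fI tP ad Ut dt.
have K0 := param_inv tP ad Ut dt.
have sE' : cfun d (theta t) = s by rewrite tE.
have K : 'J (cfun d \o theta) t *m 'J (tau \o cinv d) s = 1%:M.
  by rewrite -[X in _ *m 'J _ X = _]sE'; exact: K0.
have JE' : 'J (f \o theta) t = 'J (cfun d \o theta) t *m 'J (f \o cinv d) s.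
  by rewrite -[X in _ = _ *m 'J _ X]sE'; exact: JE.
move: K JE'; move: ('J (cfun d \o theta) t) ('J (tau \o cinv d) s).
move=> X Y /mulmx1C YX ->; rewrite mulmxA YX mul1mx; exact: erefl.
Qed.

(* In a chart around [theta t0], the image of a small cube contains an ellipsoid
   given by the derivative of the change of coordinates. *)
Lemma volume_local m : exists2 c : R, 0 < c &
  forall n (M : closed_manifold R m) (f : M -> 'rV[R]_n)
    (vol : {measure set (borel M) -> \bar R}) U theta tau k t0,
  immersion f -> is_volume_measure f vol -> local_param U theta tau ->
  0 < k -> U t0 -> (\forall t \near t0, k <= gram ('J (f \o theta) t)) ->
  \forall a \near t0 & l \near (0:R)^'+,
    ((c * k * l ^+ m)%:E <= vol (theta @` cube a l))%E.
Proof.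
have [c c0 ellipsoid] := @integral_rV_ellipsoid R m.
(* The factor 1/2 is the loss on the Jacobian determinant near [s0]; [4 ^+ m] comes from the radius
   [l / 4] of the ellipsoid. *)
exists (c / 2 / 4 ^+ m); first by rewrite !divr_gt0 ?exprn_gt0.
move=> n M f vol U theta tau k t0 fI fvol tP k0 Ut0 kJ.
have [oU tauK op tc C] := tP.
have [d ad dt0] := atlas_cover (theta t0).
set s0 := cfun d (theta t0).
have [thC chiC] := C d t0 ad Ut0 dt0.
pose chi := tau \o cinv d.
have chi0 : chi s0 = t0 by rewrite /chi /= cfunK// tauK.
have [_ Au] := param_unit tP ad Ut0 dt0.
set A := 'J (tau \o cinv d) _ in Au.
(* [C'] bounds the inverse of the derivative [A] of the coordinate change: control of
   [(s - sz0) *m A] becomes control of [s - sz0]. *)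
pose C' := m%:R * `|invmx A| + 1.
have C'0 : 0 < C' by rewrite ltr_wpDl// mulr_ge0.
have C'A (s : 'rV[R]_m) : `|s| <= C' * `|s *m A|.
  rewrite -[s in leLHS](mulmxK Au); apply: le_trans (mx_norm_mul _ _) _.
  by rewrite mulrAC ler_wpM2r// lerDl.
have dA : 0 < `|\det A| by rewrite normr_gt0 -unitfE -unitmxE.
have [|r1 r10 strict] := C1_strict chiC (e := (2 * C')^-1).
  by rewrite invr_gt0 mulr_gt0.
pose P (t : 'rV[R]_m) := k <= gram ('J (f \o theta) t).
pose good s := [/\ cimg d s, U (chi s), theta (chi s) = cinv d s,
  `|\det A| / 2 <= `|\det ('J chi s)| & P (chi s)].
have chic : {for s0, continuous chi} by have H := C1_cont chiC; exact: H.
have : \forall s \near s0, ball s0 r1 s /\ good s.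
  have H1 : \forall s \near s0, `|\det A| / 2 < `|\det ('J chi s)|.
    have Jc : ('J chi s) @[s --> s0] --> A by have := chiC.2; exact.
    have H : `|\det ('J chi s)| @[s --> s0] --> `|\det A|.
      have H := cvg_det (FF := nbhs_filter s0) Jc.
      exact: (@cvg_norm _ _ _ _ (nbhs_filter s0) _ _ H).
    apply: (@cvgr_gt _ _ _ (nbhs_filter s0) _ _ H).
    by rewrite ltr_pdivrMr// ltr_pMr// ltr1n.
  have H2 : \forall s \near s0, (theta @` U) (cinv d s).
    apply: cinv_near => //; apply: open_nbhs_nbhs; split; first exact: op.
    by exists t0.
  have H3 : \forall s \near s0, P (chi s).
    have K : nbhs (chi s0) P by rewrite chi0; exact: kJ.
    have chic' : chi @ s0 --> chi s0 by exact: chic.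
    by have KK := chic' P K; rewrite nbhs_filterE in KK; exact: KK.
  have H4 : \forall s \near s0, cimg d s by exact: cimg_near (cimg_cfun dt0).
  have H5 : \forall s \near s0, ball s0 r1 s by exact: nbhsx_ballx.
  near=> s.
  have [t Ut ts] : (theta @` U) (cinv d s) by near: s.
  have tE : chi s = t by rewrite /chi /= -ts tauK.
  split; first by near: s.
  split; [by near: s|by rewrite tE|by rewrite tE|by apply: ltW; near: s|by near: s].
move=> /nbhs_ballP[r /= r0 rg].
have : \forall t \near t0, [/\ U t, cdom d (theta t) & ball s0 (r / 2) (cfun d (theta t))].
  have H1 : \forall t \near t0, cdom d (theta t) by exact: tc t0 Ut0 _ (cdom_near dt0).
  have thc : {for t0, continuous (cfun d \o theta)} by have H := C1_cont thC; exact: H.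
  have H2 : \forall t \near t0, ball s0 (r / 2) (cfun d (theta t)).
    have K : nbhs ((cfun d \o theta) t0) (ball s0 (r / 2)).
      by apply: nbhsx_ballx; rewrite divr_gt0.
    exact: thc _ K.
  have H3 : \forall t \near t0, U t by exact: open_nbhs_nbhs.
  by near=> t; split; near: t.
move=> /nbhs_ballP[r2 /= r20 tg].
(* The first bound keeps the cube where the chart is usable, the second keeps the ellipsoid in the
   ball of radius [r]. *)
pose e := Num.min (r2 / 2) (r / C').
have e0 : 0 < e by rewrite lt_min !divr_gt0.
exists (ball t0 (r2 / 2), [set l | 0 < l < e]); first split => /=.
- by apply: nbhsx_ballx; rewrite divr_gt0.
- by near=> l; apply/andP; split; near: l; [exact: nbhs_right_gt|exact: nbhs_right_lt].
move=> [a l] [/= at0 /andP[l0]]; rewrite lt_min => /andP[lr2 lr].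
have tgc t : cube a l t -> [/\ U t, cdom d (theta t) & ball s0 (r / 2) (cfun d (theta t))].
  move=> ta; apply: tg; apply/ball_rV => // i.
  have := (ball_rV t0 a (divr_gt0 r20 (ltr0Sn R 1))).1 at0 i.
  have /andP[] := ta i; move: lr2; set u := t0 ord0 i; set v := a ord0 i; set w := t ord0 i.
  by move=> lr2 va va2 H; rewrite ltr_distl in H; rewrite ltr_distl; lra.
pose z : 'rV[R]_m := a + const_mx (l / 2).
have za : cube a l z by move=> i; rewrite !mxE; lra.
have [Uz dz sz] := tgc z za; pose sz0 := cfun d (theta z).
have chiz : chi sz0 = z by rewrite /chi /= cfunK// tauK.
have r_gt : 0 < r / 2 by rewrite divr_gt0.
have szr : ball s0 r sz0 by apply: le_ball sz; rewrite ler_pdivrMr// ler_peMr ?(ltW r0)// ler1n.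
have mA : measurable (theta @` cube a l : set (borel M)).
  by apply: measurable_cube tP _ => t /tgc[].
have Ad : theta @` cube a l `<=` cdom d by move=> _ [t /tgc[_ dt _] <-].
rewrite (fvol d _ ad mA Ad).
have Spd : posdef (A *m A^T) by apply: posdef_gram; rewrite row_free_unit.
pose K := `|\det A| / 2 * k.
have l40 : 0 < l / 4 by rewrite divr_gt0.
have K0 : 0 <= K by rewrite mulr_ge0 ?divr_ge0 ?ltW.
apply: le_trans (ellipsoid _ sz0 (l / 4) K _ Spd l40 K0 _ _).
- rewrite lee_fin det_mulmx det_tr -expr2 sqrtr_sqr /K expr_div_n.
  rewrite le_eqVlt; apply/orP; left; apply/eqP; field.
  by rewrite (lt0r_neq0 dA) expf_neq0// pnatr_eq0.
- by move=> s; rewrite lee_fin mulr_ge0// ?sqrtr_ge0// indicE.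
- move=> s; rewrite -sqn_mul => sA; rewrite lee_fin.
  have sA' : `|(s - sz0) *m A| < l / 4.
    rewrite -(ltr_pXn2r (n := 2))// ?nnegrE ?(ltW l40)//.
    exact: le_lt_trans (norm_sqr_le_sqn _) sA.
  have ssz : `|s - sz0| < C' * (l / 4).
    by apply: le_lt_trans (C'A _) _; rewrite ltr_pM2l.
  have lr' : C' * (l / 4) < r / 2.
    have H1 : l * C' < r by rewrite -ltr_pdivlMr.
    have -> : C' * (l / 4) = l * C' / 4 by field.
    by move: H1 r0; move: (l * C') => u; clear; lra.
  have sr : ball s0 r s.
    rewrite [r]splitr; apply: ball_triangle sz _.
    by rewrite -ball_normE /= distrC; exact: lt_trans ssz lr'.
  have [sr1 [sd Us ths ds ks]] := rg _ sr; have [szr1 _] := rg _ szr.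
  (* The linear part is below [l / 4] and the remainder below [l / 8], so [chi s] is within [l / 2]
     of the centre [z] of the cube. *)
  have chis : cube a l (chi s).
    have := strict _ _ sr1 szr1; rewrite -/A -/chi chiz => H.
    have H2 : `|chi s - z| < l / 2.
      rewrite -(subrK ((s - sz0) *m A) (chi s - z)).
      apply: le_lt_trans (ler_normD _ _) _.
      apply: (@lt_trans _ _ (`|chi s - z - (s - sz0) *m A| + l / 4)).
        by rewrite ltrD2l.
      have : (2 * C')^-1 * `|s - sz0| < l / 8.
        rewrite mulrC ltr_pdivrMr ?mulr_gt0//.
        by rewrite (_ : l / 8 * (2 * C') = C' * (l / 4))//; field.
      move=> H3; rewrite -ltrBrDr; apply: lt_trans (le_lt_trans H H3) _.
      by clear -l0; lra.
    move=> i; have := le_lt_trans (mx_norm_coord (chi s - z) ord0 i) H2.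
    rewrite !mxE ltr_distl; move: (chi s ord0 i) (a ord0 i) => u v.
    by clear; lra.
  rewrite indicE mem_set; last first.
    by exists (theta (chi s)); [exists (chi s)|rewrite ths; case: (cinvK sd)].
  rewrite mul1r; have JE := tangent_param fI tP ad sd Us ths.
  have E := etrans (congr1 (@gram m n) JE) (gram_mulmx _ _).
  have KE : K <= gram ('J (f \o cinv d) s).
    by rewrite E; apply: ler_pM ds ks; rewrite ?divr_ge0 ?(ltW k0) ?(ltW dA).
  exact: KE.
Unshelve. all: by end_near. Qed.

End LocalVolume.

(** * Volume of cubes of any size *)

Section CubeVolume.
Context {R : realType}.

Lemma sum_measure_le d (T : measurableType d) (mu : {measure set T -> \bar R})
    (I : eqType) (s : seq I) (F : I -> set T) (A : set T) :
  uniq s -> measurable A -> (forall i, measurable (F i)) ->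
  (forall i j, i != j -> F i `&` F j = set0) ->
  (forall i, i \in s -> F i `<=` A) ->
  (\sum_(i <- s) mu (F i) <= mu A)%E.
Proof.
move=> + + mF dF; elim: s A => [|i s IH] A /=; first by rewrite big_nil.
move=> /andP[is' us] mA FA; rewrite big_cons.
rewrite (@measureDI _ _ _ mu A (F i))// addeC; apply: leeD.
  apply: IH => // [|j js]; first exact: measurableD.
  move=> x Fjx; split; first by apply: (FA j) => //; rewrite inE js orbT.
  move=> Fix; have : (F j `&` F i) x by [].
  by rewrite dF//; apply: contraNneq is' => <-.
by rewrite setIidr//; apply: FA; rewrite inE eqxx.
Qed.

(** The local bound is proportional to [l ^+ m], hence additive under subdivision: the cube is cut
    into subcubes so small that, by compactness of [K], the local bound holds at all their
    corners. *)
Lemma volume_cube m : exists2 c : R, 0 < c &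
  forall n (M : closed_manifold R m) (f : M -> 'rV[R]_n)
    (vol : {measure set (borel M) -> \bar R}) U theta tau k K a l,
  immersion f -> is_volume_measure f vol -> local_param U theta tau ->
  0 < k -> compact K -> K `<=` U ->
  (forall t, K t -> \forall s \near t, k <= gram ('J (f \o theta) s)) ->
  0 < l -> cube a l `<=` K ->
  ((c * k * l ^+ m)%:E <= vol (theta @` cube a l))%E.
Proof.
have [c c0 loc] := @volume_local R m; exists c => //.
move=> n M f vol U theta tau k K a l fI fvol tP k0 cK KU kJ l0 aK.
have /compact_near_coveringP cover := cK.
have : \forall e \near (0:R)^'+, forall b, K b ->
    ((c * k * e ^+ m)%:E <= vol (theta @` cube b e))%E.
  apply: (cover _ _ (fun e b => ((c * k * e ^+ m)%:E <= vol (theta @` cube b e))%E)).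
  by move=> t Kt; exact: loc fI fvol tP k0 (KU _ Kt) (kJ _ Kt).
move=> [/= e e0 He].
have [N lN] : exists N : nat, l / N.+1%:R < e.
  exists (Num.truncn (l / e)); rewrite ltr_pdivrMr// -ltr_pdivrMl// mulrC.
  exact: truncnS_gt.
pose h := l / N.+1%:R; have h0 : 0 < h by rewrite divr_gt0.
have hl : N.+1%:R * h = l by rewrite mulrC divfK.
pose b (s : {ffun 'I_m -> 'I_N.+1}) : 'rV[R]_m := a + \row_i ((s i)%:R * h).
have mulrS1 (j : nat) : j.+1%:R * h = j%:R * h + h by rewrite -natr1 mulrDl mul1r.
have ba s : cube (b s) h `<=` cube a l.
  move=> t ts i; have := ts i; rewrite !mxE => /andP[t1 t2]; apply/andP; split.
    by apply: le_trans t1; rewrite lerDl mulr_ge0// ltW.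
  apply: lt_le_trans t2 _; rewrite -addrA lerD2l -hl -mulrS1 ler_wpM2r ?(ltW h0)//.
  by rewrite ler_nat.
have Kb s : K (b s).
  by apply/aK/(ba s) => i; rewrite lexx ltrDl.
have bU s : cube (b s) h `<=` U by move=> t /(ba s)/aK/KU.
have [oU tauK _ _ _] := tP.
apply: le_trans (@sum_measure_le _ _ vol _ (enum {ffun 'I_m -> 'I_N.+1})
  (fun s => theta @` cube (b s) h) _ _ _ _ _ _).
- rewrite big_enum/=.
  apply: le_trans (_ : \sum_(s : {ffun 'I_m -> 'I_N.+1}) (c * k * h ^+ m)%:E <= _)%E.
    rewrite sumEFin lee_fin sumr_const card_ffun !card_ord -mulr_natl natrX.
    by rewrite -hl exprMn mulrCA.
  apply: lee_sum => s _; apply: He => //=.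
  by rewrite sub0r normrN gtr0_norm.
- exact: enum_uniq.
- by apply: measurable_cube tP _ => t /aK/KU.
- by move=> s; apply: measurable_cube tP (bU s).
- move=> s s' ss'; apply/seteqP; split=> // p [[t ts <-] [t' ts' E]].
  have tt : t' = t by rewrite -(tauK _ (bU s' _ ts')) E tauK//; exact: bU ts.
  have [i sis] : exists i, s i != s' i.
    by apply/existsP; rewrite -negb_forall; apply: contra ss' => /forallP H;
      apply/eqP/ffunP => i; exact/eqP.
  have := ts i; have := ts' i; rewrite tt !mxE => /andP[u1 u2] /andP[u3 u4].
  wlog : s s' t t' ts ts' E tt ss' sis u1 u2 u3 u4 / (s i < s' i)%N.
    move=> H; move: (sis); rewrite neq_ltn => /orP[|] ii.
      exact: (H s s' t t').
    by apply: (H s' s t t); rewrite // 1?eq_sym//; rewrite -?tt//.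
  move=> ii; have H : (s i)%:R * h + h <= (s' i)%:R * h.
    by rewrite -mulrS1 ler_wpM2r ?(ltW h0)// ler_nat.
  have : t ord0 i < t ord0 i.
    by apply: lt_le_trans u4 (le_trans _ u1); rewrite -addrA lerD2l.
  by rewrite ltxx.
- by move=> s _; apply: image_subset; exact: ba.
Qed.

End CubeVolume.

(** * From shells to a lower bound on the energy *)

Section EnergyBound.
Context {R : realType}.

Lemma integral_ge_sum d (T : measurableType d) (mu : {measure set T -> \bar R})
    (F : T -> \bar R) (N : nat) (A : 'I_N -> set T) (L : 'I_N -> R) :
  (forall x, 0 <= F x)%E -> (forall j, measurable (A j)) ->
  (forall i j, i != j -> A i `&` A j = set0) -> (forall j, 0 <= L j) ->
  (forall j x, A j x -> ((L j)%:E <= F x)%E) ->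
  (\sum_(j < N) (L j)%:E * mu (A j) <= \int[mu]_(x in [set: T]) F x)%E.
Proof.
move=> F0 mA dA L0 LF.
have -> : (\sum_(j < N) (L j)%:E * mu (A j) =
    \int[mu]_(x in [set: T]) \sum_(j < N) (L j)%:E * (\1_(A j) x)%:E)%E.
  rewrite ge0_integral_sum//; last 2 first.
  - by move=> j; apply/measurable_funeM/measurable_EFinP/measurable_indic.
  - by move=> j x _; rewrite mule_ge0// lee_fin ?L0// indicE.
  apply: eq_bigr => j _; rewrite ge0_integralZl_EFin//.
  - by rewrite integral_indic// setIT.
  - exact/measurable_EFinP/measurable_indic.
apply: ge0_le_lower_integral => x.
  by apply: sume_ge0 => j _; rewrite mule_ge0// lee_fin ?L0// indicE.
have [[j Ajx]|nA] := pselect (exists j, A j x); last first.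
  rewrite big1// => j _; rewrite indicE memNset ?mule0//.
  by move=> Ajx; apply: nA; exists j.
rewrite (bigD1 j)//= big1 ?adde0 => [|i ij].
  by rewrite indicE mem_set// mule1; exact: LF.
rewrite indicE memNset ?mule0// => Aix.
by have : (A i `&` A j) x by []; rewrite dA.
Qed.

(** If [c] exceeds -1, [1 - c ^+ 2] is [1 - c] times a factor between 0 and 2; otherwise
    [d <= 0]. *)
Lemma cos_gap (c d : R) : c ^+ 2 <= 1 - d -> c <= 1 -> d / 2 <= 1 - c.
Proof. nra. Qed.

Section DisjointPieces.
Context {m n : nat} {M : closed_manifold R m} {f : M -> 'rV[R]_n}.
Context {o : orientation M} {vol : {measure set (borel M) -> \bar R}}.
Context {U1 U2 : set 'rV[R]_m} {theta1 theta2 : 'rV[R]_m -> M}.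
Context {tau1 tau2 : M -> 'rV[R]_m}.
Hypotheses (m0 : (0 < m)%N) (fI : immersion f) (f_inj : injective f).
Hypothesis fvol : is_volume_measure f vol.
Hypotheses (P1 : local_param U1 theta1 tau1) (P2 : local_param U2 theta2 tau2).
Hypothesis dis : forall t s, U1 t -> U2 s -> theta1 t <> theta2 s.

Let G1 := f \o theta1.
Let G2 := f \o theta2.

Lemma sheets_neq t s : U1 t -> U2 s -> G1 t != G2 s.
Proof. by move=> Ut Us; apply/eqP => /f_inj; exact: dis. Qed.

Lemma param_angle t s : U1 t -> U2 s ->
  cos (combined_angle o f (theta1 t) (theta2 s)) ^+ 2 =
  Gamma ('J G1 t) ('J G2 s) (G2 s - G1 t).
Proof.
move=> Ut Us; have [c ac ct] := atlas_cover (theta1 t).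
have [d ad ds] := atlas_cover (theta2 s).
have [_ J1] := param_C1 fI P1 ac Ut ct; have [T1 _] := param_unit P1 ac Ut ct.
have [_ J2] := param_C1 fI P2 ad Us ds; have [T2 _] := param_unit P2 ad Us ds.
have H := combined_angleP (f := f) fI o m0 ac ad ct ds (sheets_neq Ut Us).
have K (A B : 'M[R]_m) (J J' K K' : 'M[R]_(m, n)) w : A \in unitmx -> B \in unitmx ->
   J' = A *m J -> K' = B *m K -> Gamma J' K' w = Gamma J K w.
  by move=> Au Bu -> ->; exact: Gamma_unitmx.
exact: etrans H (esym (K _ _ _ _ _ _ _ T1 T2 J1 J2)).
Qed.

Definition KS_integrand p q : R :=
  (1 - cos (combined_angle o f p q)) ^+ m / enorm (f p - f q) ^+ (2 * m).

Lemma KS_integrand_ge0 p q : 0 <= KS_integrand p q.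
Proof.
by rewrite divr_ge0 ?exprn_ge0 ?subr_ge0 ?cos_le1// /enorm sqrtr_ge0.
Qed.

(** The factor [n.+1] pays for passing from the sup norm to the Euclidean norm. *)
Lemma KS_integrand_ge t s (dl r : R) : U1 t -> U2 s -> 0 <= dl ->
  Gamma ('J G1 t) ('J G2 s) (G2 s - G1 t) <= 1 - dl -> `|G2 s - G1 t| <= r ->
  (dl / 2) ^+ m / (n.+1%:R * r) ^+ (2 * m) <= KS_integrand (theta1 t) (theta2 s).
Proof.
move=> Ut Us dl0; rewrite -param_angle// => Gd Gr.
have w0 : 0 < enorm (G1 t - G2 s).
  by rewrite enormE sqrtr_gt0 sqn_gt0 subr_eq0; exact: sheets_neq.
have wr : enorm (G1 t - G2 s) <= n.+1%:R * r.
  apply: le_trans (enorm_le _) _; rewrite distrC ler_pM//.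
  by rewrite ler_nat.
apply: ler_pM.
- by rewrite exprn_ge0// divr_ge0.
- by rewrite invr_ge0 exprn_ge0//; exact: le_trans (ltW w0) wr.
- have d1 : dl / 2 <= 1 - cos (combined_angle o f (theta1 t) (theta2 s)).
    by apply: cos_gap => //; exact: cos_le1.
  by rewrite lerXn2r// ?nnegrE ?subr_ge0 ?cos_le1// divr_ge0.
- rewrite lef_pV2 ?posrE ?exprn_gt0 ?(lt_le_trans w0 wr)//.
  by rewrite lerXn2r// ?nnegrE ?(ltW w0)// (le_trans (ltW w0) wr).
Qed.

End DisjointPieces.

(* A shell of size [r] has volume of order [r ^ m], and the inner integral over
   the cube of side [e <= C r] is at least of order [e ^ m / e ^ (2 m) >=
   r ^ (- m)]: each shell contributes a constant, whatever its scale. *)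
Lemma energy_ge m : (0 < m)%N -> exists2 c : R, 0 < c &
  forall n (M : closed_manifold R m) (f : M -> 'rV[R]_n)
    (o : orientation M) (vol : {measure set (borel M) -> \bar R})
    U1 U2 theta1 theta2 tau1 tau2 k K1 K2 (dl C kap : R) (N : nat)
    (a : 'I_N -> 'rV[R]_m) (r : 'I_N -> R),
  immersion f -> injective f -> is_volume_measure f vol ->
  local_param U1 theta1 tau1 -> local_param U2 theta2 tau2 ->
  (forall t s, U1 t -> U2 s -> theta1 t <> theta2 s) ->
  0 < k -> compact K1 -> K1 `<=` U1 -> compact K2 -> K2 `<=` U2 ->
  (forall t, K1 t -> \forall s \near t, k <= gram ('J (f \o theta1) s)) ->
  (forall t, K2 t -> \forall s \near t, k <= gram ('J (f \o theta2) s)) ->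
  0 < dl -> 0 < C -> 0 < kap -> (forall j, 0 < r j) ->
  (forall i j, i != j -> cube (a i) (kap * r i) `&` cube (a j) (kap * r j) = set0) ->
  (forall j, cube (a j) (kap * r j) `<=` K1) ->
  (forall j t, cube (a j) (kap * r j) t -> exists (s : 'rV[R]_m) (e : R),
    [/\ 0 < e, e <= C * r j, cube s e `<=` K2 & forall s', cube s e s' ->
      `|(f \o theta2) s' - (f \o theta1) t| <= C * e /\
      Gamma ('J (f \o theta1) t) ('J (f \o theta2) s')
        ((f \o theta2) s' - (f \o theta1) t) <= 1 - dl]) ->
  ((N%:R * (c * k ^+ 2 * (dl / 2) ^+ m / (n.+1%:R * C) ^+ (2 * m) * (kap / C) ^+ m))%:E
   <= E_KS o f vol)%E.
Proof.
move=> m0; have [c c0 volc] := @volume_cube R m; exists (c ^+ 2); first by rewrite exprn_gt0.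
move=> n M f o vol U1 U2 theta1 theta2 tau1 tau2 k K1 K2 dl C kap N a r.
move=> fI f_inj fvol P1 P2 dis k0 cK1 KU1 cK2 KU2 kJ1 kJ2 dl0 C0 kap0 r0 disj aK shells.
pose B := (dl / 2) ^+ m / (n.+1%:R * C) ^+ (2 * m).
have B0 : 0 < B by rewrite divr_gt0 ?exprn_gt0 ?divr_gt0 ?mulr_gt0.
(* Value of the inner integral that a shell of size [r j] guarantees, the side [e] of the partner
   cube being replaced by its upper bound [C * r j]. *)
pose L j := B * (c * k) / (C * r j) ^+ m.
have L0 j : 0 <= L j.
  apply/ltW/divr_gt0; first by apply: mulr_gt0 B0 _; exact: mulr_gt0.
  by apply/exprn_gt0/mulr_gt0.
pose A j := theta1 @` cube (a j) (kap * r j).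
have [_ tauK1 _ _ _] := P1.
have aU j : cube (a j) (kap * r j) `<=` U1 by move=> t /aK/KU1.
have mA j : measurable (A j : set (borel M)) by exact: measurable_cube P1 (aU j).
have dA i j : i != j -> A i `&` A j = set0.
  move=> ij; apply/seteqP; split=> // p [[t ti <-] [s sj E]].
  have st : s = t by rewrite -(tauK1 _ (aU j _ sj)) E tauK1//; exact: aU ti.
  have : (cube (a i) (kap * r i) `&` cube (a j) (kap * r j)) t by split=> //; rewrite -st.
  by rewrite disj.
have volA j : ((c * k * (kap * r j) ^+ m)%:E <= vol (A j))%E.
  by apply: volc (fI) fvol P1 k0 cK1 KU1 kJ1 _ (aK j); rewrite mulr_gt0.
have inner j p : A j p ->
    ((L j)%:E <= \int[vol]_(q in [set: M]) (KS_integrand (f := f) (o := o) p q)%:E)%E.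
  move=> [t tj <-]; have [s [e [e0 eC sK Hs]]] := shells j t tj.
  have ne0 : 0 < n.+1%:R * (C * e) by rewrite mulr_gt0// mulr_gt0.
  pose V := (dl / 2) ^+ m / (n.+1%:R * (C * e)) ^+ (2 * m).
  have V0 : 0 <= V by rewrite ltW// divr_gt0 ?exprn_gt0 ?divr_gt0.
  have sU : cube s e `<=` U2 by move=> u /sK/KU2.
  have mS : measurable (theta2 @` cube s e : set (borel M)) by exact: measurable_cube P2 sU.
  have I0 q : (0 <= (KS_integrand (f := f) (o := o) (theta1 t) q)%:E)%E.
    by rewrite lee_fin; exact: KS_integrand_ge0.
  have IV q : (theta2 @` cube s e) q ->
      (V%:E <= (KS_integrand (f := f) (o := o) (theta1 t) q)%:E)%E.
    move=> [s' ss' <-]; rewrite lee_fin; have [H1 H2] := Hs s' ss'.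
    have Ut := aU j t tj; have Us := sU s' ss'.
    exact: (KS_integrand_ge m0 fI f_inj P1 P2 dis Ut Us (ltW dl0) H2 H1).
  apply: le_trans (integral_ge_cst vol mS V0 I0 IV).
  have volS := volc _ _ _ _ _ _ _ _ _ _ _ fI fvol P2 k0 cK2 KU2 kJ2 e0 sK.
  apply: le_trans (_ : V%:E * (c * k * e ^+ m)%:E <= _)%E; last first.
    by apply: lee_wpmul2l => //; rewrite lee_fin.
  rewrite -EFinM lee_fin.
  (* The integrand contributes [e ^+ m] twice in the denominator and the volume once in the
     numerator: a smaller partner cube only increases the bound. *)
  have -> : V * (c * k * e ^+ m) = B * (c * k) / e ^+ m.
    rewrite /V /B !exprMn mul2n -addnn !exprD.
    have e0' : e ^+ m != 0 by rewrite expf_neq0// gt_eqF.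
    have C0' : C ^+ m != 0 by rewrite expf_neq0// gt_eqF.
    have n0' : n.+1%:R ^+ m != 0 :> R by rewrite expf_neq0// pnatr_eq0.
    by field; rewrite e0' C0' n0'.
  have Cr0 : 0 < C * r j by exact: mulr_gt0.
  rewrite /L; apply: ler_wpM2l; first by apply/ltW/(mulr_gt0 B0)/mulr_gt0.
  rewrite lef_pV2 ?posrE ?exprn_gt0//.
  by rewrite lerXn2r// nnegrE ltW// mulr_gt0.
rewrite /E_KS; apply: le_trans (integral_ge_sum vol _ mA dA L0 inner); last first.
  by move=> p; apply: integral_ge0 => q _; rewrite lee_fin KS_integrand_ge0.
apply: le_trans (_ : \sum_(j < N) (L j)%:E * (c * k * (kap * r j) ^+ m)%:E <= _)%E; last first.
  by apply: lee_sum => j _; apply: lee_wpmul2l; rewrite ?lee_fin.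
rewrite (eq_bigr (fun=> (c ^+ 2 * k ^+ 2 * B * (kap / C) ^+ m)%:E)) => [|j _].
  rewrite sumEFin lee_fin sumr_const card_ord mulr_natl /B.
  by rewrite !mulrA.
rewrite -EFinM; congr _%:E; rewrite /L !exprMn exprVn.
have C0' : C ^+ m != 0 by rewrite expf_neq0// gt_eqF.
have r0' : r j ^+ m != 0 by rewrite expf_neq0// gt_eqF.
by field; rewrite C0' r0'.
Qed.

End EnergyBound.

(** * Gaps of [Gamma] that persist near a configuration of planes *)

Section GammaNear.
Context {R : realType}.

Lemma cvg_fst_comp (T : Type) (U V : topologicalType) (F : set_system T)
    {FF : Filter F} (f : T -> U * V) (a : U * V) :
  f x @[x --> F] --> a -> (f x).1 @[x --> F] --> a.1.
Proof. move=> fa; apply: (cvg_comp f fst fa); exact: cvg_fst. Qed.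

Lemma cvg_snd_comp (T : Type) (U V : topologicalType) (F : set_system T)
    {FF : Filter F} (f : T -> U * V) (a : U * V) :
  f x @[x --> F] --> a -> (f x).2 @[x --> F] --> a.2.
Proof. move=> fa; apply: (cvg_comp f snd fa); exact: cvg_snd. Qed.

Lemma gram_near m n (J : 'M[R]_(m, n)) : row_free J -> exists k e : R,
  [/\ 0 < k, 0 < e & forall J', `|J' - J| <= e -> k <= gram J'].
Proof.
move=> Jf; have d0 := posdef_det_gt0 (posdef_gram Jf).
set D := \det _ in d0.
have H : \forall J' \near J, D / 2 < \det (J' *m J'^T).
  have K : \det (J' *m J'^T) @[J' --> nbhs J] --> D.
    apply: (cvg_det (FF := nbhs_filter J)).
    apply: (cvg_mulmx (FF := nbhs_filter J)); first exact: cvg_id.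
    by apply: (cvg_trmx (FF := nbhs_filter J)); exact: cvg_id.
  apply: (@cvgr_gt _ _ _ (nbhs_filter J) _ _ K).
  by rewrite ltr_pdivrMr// ltr_pMr// ltr1n.
have /nbhs_ballP[e /= e0 He] := H.
exists (Num.sqrt (D / 2)), (e / 2); split; [|by rewrite divr_gt0|].
  by rewrite sqrtr_gt0 divr_gt0.
move=> J' J'e; rewrite /gram; apply/ler_wsqrtr/ltW/He.
rewrite -ball_normE/= distrC; apply: le_lt_trans J'e _.
by rewrite ltr_pdivrMr// ltr_pMr// ltr1n.
Qed.

Lemma Gamma_scale m n (J1 J2 : 'M[R]_(m, n)) (c : R) w : c != 0 ->
  Gamma J1 J2 (c *: w) = Gamma J1 J2 w.
Proof. by move=> c0; rewrite /Gamma refl_scale. Qed.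

(** [Gamma] is continuous at [(J1, J2, w)], where it is less than 1; half of the gap is kept. *)
Lemma Gamma_near_tangent m n (J1 J2 : 'M[R]_(m, n)) (w : 'rV[R]_n) :
  row_free J1 -> row_free J2 -> (w <= J1)%MS -> ~~ (w <= J2)%MS ->
  exists dl e : R, [/\ 0 < dl, 0 < e & forall Jx Jy w',
    `|Jx - J1| <= e -> `|Jy - J2| <= e -> `|w' - w| <= e ->
    Gamma Jx Jy w' <= 1 - dl].
Proof.
move=> J1f J2f wJ1 wJ2; have lt1 := Gamma_tangent_lt1 J1f J2f wJ1 wJ2.
have w0 : w != 0 by apply: contra wJ2 => /eqP ->; exact: sub0mx.
pose z0 := (J1, J2, w); pose dl := (1 - Gamma J1 J2 w) / 2.
have dl0 : 0 < dl by rewrite divr_gt0 ?subr_gt0.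
have H : \forall z \near z0, Gamma z.1.1 z.1.2 z.2 < 1 - dl.
  have K : Gamma z.1.1 z.1.2 z.2 @[z --> nbhs z0] --> Gamma J1 J2 w.
    have FF := nbhs_filter z0.
    have id0 : z @[z --> nbhs z0] --> z0 by exact: cvg_id.
    have z1 := cvg_fst_comp (FF := FF) id0; have z11 := cvg_fst_comp (FF := FF) z1.
    have z12 := cvg_snd_comp (FF := FF) z1; have z2 := cvg_snd_comp (FF := FF) id0.
    exact: (cvg_Gamma (FF := nbhs_filter z0) J1f J2f w0 z11 z12 z2).
  apply: (@cvgr_lt _ _ _ (nbhs_filter z0) _ _ K).
  by rewrite /dl; move: (Gamma J1 J2 w) lt1 => u; clear; lra.
have /nbhs_ballP[e /= e0 He] := H.
have e2 : e / 2 < e by rewrite ltr_pdivrMr// ltr_pMr// ltr1n.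
exists dl, (e / 2); split; [by []|by rewrite divr_gt0|].
move=> Jx Jy w' Jxe Jye we; apply/ltW/(He (Jx, Jy, w')).
by split; [split|]; rewrite -ball_normE/= distrC; apply: le_lt_trans e2.
Qed.

Lemma unit_sphere_compact n : compact [set v : 'rV[R]_n | `|v| = 1].
Proof.
apply: bounded_closed_compact.
  by exists 1; split; [exact: num_real|move=> M M1 v /= ->; exact: ltW].
have -> : [set v : 'rV[R]_n | `|v| = 1] = (@Num.norm _ _) @^-1` [set 1] by [].
apply: closed_comp; last exact: closed_eq.
by move=> v _; exact: norm_continuous.
Qed.

(** The unit vector [v] is not fixed, so the bound must be uniform over the compact unit sphere.
    [Js] will be the tangent plane at the foot of the perpendicular, to which [v] is exactly normal,
    while [Jy] is the one at the end of the chord. *)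
Lemma Gamma_near_oblique m n (J1 J2 : 'M[R]_(m, n)) (t : 'rV[R]_n) :
  row_free J1 -> row_free J2 -> (t <= J1)%MS -> (t <= J2)%MS -> t != 0 ->
  exists dl e : R, [/\ 0 < dl, 0 < e & forall Jx Jy Js v w,
    `|Jx - J1| <= e -> `|Jy - J2| <= e -> `|Js - J2| <= e ->
    `|v| = 1 -> v *m Js^T = 0 -> `|w - (v + t)| <= e ->
    Gamma Jx Jy w <= 1 - dl].
Proof.
move=> J1f J2f tJ1 tJ2 t0.
(* The quantities that tend to a limit: the gap to 0, [Jx] to [J1], [Jy] and [Js] to [J2], the error
   on the chord to 0. Having the gap among them makes it uniform in [v]. *)
pose I := ((R * 'M[R]_(m, n)) * ('M[R]_(m, n) * 'M[R]_(m, n)) * 'rV[R]_n)%type.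
pose i0 : I := ((0, J1), (J2, J2), 0).
pose P (i : I) (v : 'rV[R]_n) := v *m (i.1.2.2)^T = 0 ->
  Gamma i.1.1.2 i.1.2.1 (v + t + i.2) < 1 - i.1.1.1.
have cover := (compact_near_coveringP _).1 (@unit_sphere_compact n) I (nbhs i0) P (nbhs_filter i0).
have : \forall i \near i0, [set v : 'rV[R]_n | `|v| = 1] `<=` P i.
  apply: cover => v v1.
  have v0 : v != 0 by apply/eqP => v0; move/eqP: v1; rewrite v0 normr0 eq_sym oner_eq0.
  pose z0 : 'rV[R]_n * I := (v, i0).
  suff H : \forall z \near z0, P z.2 z.1 by exact: H.
  have FF := nbhs_filter z0.
  have id0 : z @[z --> nbhs z0] --> z0 by exact: cvg_id.
  have zv := cvg_fst_comp (FF := FF) id0; have zi := cvg_snd_comp (FF := FF) id0.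
  have zi1 := cvg_fst_comp (FF := FF) zi; have zd := cvg_snd_comp (FF := FF) zi.
  have zi11 := cvg_fst_comp (FF := FF) zi1; have zi12 := cvg_snd_comp (FF := FF) zi1.
  have zr := cvg_fst_comp (FF := FF) zi11; have zJx := cvg_snd_comp (FF := FF) zi11.
  have zJy := cvg_fst_comp (FF := FF) zi12; have zJs := cvg_snd_comp (FF := FF) zi12.
  (* Near a [v] that is not normal to [J2], the premise of [P] fails. *)
  have [vJ|vJ] := eqVneq (v *m J2^T) 0; last first.
    have K : `|z.1 *m z.2.1.2.2^T| @[z --> nbhs z0] --> `|v *m J2^T|.
      have K := cvg_mulmx (FF := FF) zv (cvg_trmx (FF := FF) zJs).
      exact: (@cvg_norm _ _ _ _ FF _ _ K).
    have K0 : 0 < `|v *m J2^T| by rewrite normr_gt0.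
    have := @cvgr_gt _ _ _ FF _ _ K _ K0.
    by apply: filterS => z zE; rewrite /P => z0'; move: zE; rewrite z0' normr0 ltxx.
  have lt1 := Gamma_oblique_lt1 J1f J2f v0 vJ t0 tJ1 tJ2.
  have vt0 : v + t + 0 != 0.
    rewrite addr0; apply/negP => /eqP vt; case/eqP: v0.
    have vE : v = - t by apply/eqP; rewrite -addr_eq0 vt.
    have vv : v *m v^T = 0.
      rewrite {2}vE; case/submxP: tJ2 => x ->.
      by rewrite linearN/= trmx_mul mulmxN mulmxA vJ mul0mx oppr0.
    by apply/eqP; rewrite -sqn_eq0 /sqn vv mxE.
  have KG : Gamma z.2.1.1.2 z.2.1.2.1 (z.1 + t + z.2.2) @[z --> nbhs z0] -->
      Gamma J1 J2 (v + t + 0).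
    have zw : z.1 + t + z.2.2 @[z --> nbhs z0] --> v + t + 0.
      apply: (@cvgD _ _ _ _ FF); last exact: zd.
      by apply: (@cvgD _ _ _ _ FF); [exact: zv|exact: cvg_cst].
    exact: (cvg_Gamma (FF := FF) J1f J2f vt0 zJx zJy zw).
  have K2 : 1 - z.2.1.1.1 - Gamma z.2.1.1.2 z.2.1.2.1 (z.1 + t + z.2.2) @[z --> nbhs z0] -->
      1 - 0 - Gamma J1 J2 (v + t + 0).
    apply: (@cvgB _ _ _ _ FF); last exact: KG.
    by apply: (@cvgB _ _ _ _ FF); [exact: cvg_cst|exact: zr].
  have K0 : 0 < 1 - 0 - Gamma J1 J2 (v + t + 0) by rewrite subr0 addr0 subr_gt0.
  have := @cvgr_gt _ _ _ FF _ _ K2 _ K0.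
  by apply: filterS => z zE _; rewrite -subr_gt0.
move=> /nbhs_ballP[e /= e0 He].
have e2 : e / 2 < e by rewrite ltr_pdivrMr// ltr_pMr// ltr1n.
have e20 : 0 < e / 2 by rewrite divr_gt0.
exists (e / 2), (e / 2); split=> // Jx Jy Js v w Jxe Jye Jse v1 vJs we.
have B : ball i0 e ((e / 2, Jx), (Jy, Js), w - (v + t)).
  have bM (J J' : 'M[R]_(m, n)) : `|J' - J| <= e / 2 -> ball J e J'.
    by move=> H; rewrite -ball_normE/= distrC; exact: le_lt_trans e2.
  have b0 : ball (0 : R) e (e / 2) by rewrite -ball_normE/= sub0r normrN gtr0_norm.
  have bw : ball (0 : 'rV[R]_n) e (w - (v + t)).
    by rewrite -ball_normE/= sub0r normrN; exact: le_lt_trans e2.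
  by split; [split; split; [exact: b0|exact: bM|exact: bM|exact: bM]|exact: bw].
have := He _ B v v1 vJs => /=; rewrite addrC subrK; exact: ltW.
Qed.

End GammaNear.

(** * Sheets: maps that are C^1-close to an affine map *)

Section Sheets.
Context {R : realType}.

(* [G] is C^1-close to [t |-> x + (t - t0) J] near [t0]. *)
Definition sheet m n (G : 'rV[R]_m -> 'rV[R]_n) (t0 : 'rV[R]_m) (x : 'rV[R]_n)
    (J : 'M[R]_(m, n)) (rho eps eta : R) :=
  `|G t0 - x| <= eta /\
  forall t, `|t - t0| <= rho -> C1 G t /\ `|'J G t - J| <= eps.

Lemma sheet_strict m n (G : 'rV[R]_m -> 'rV[R]_n) t0 x J rho eps eta :
  sheet G t0 x J rho eps eta -> forall t t', `|t - t0| < rho -> `|t' - t0| < rho ->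
  `|G t - G t' - (t - t') *m J| <= m%:R * eps * `|t - t'|.
Proof.
move=> [_ GJ] t t' t1 t2; apply: (mvt_partial (t0 := t0) (r := rho)); last 2 first.
- by rewrite -ball_normE/= distrC.
- by rewrite -ball_normE/= distrC.
move=> s i; rewrite -ball_normE/= distrC => /ltW /GJ[sC sJ]; split.
  by apply: diff_derivable; exact: C1_diff sC.
rewrite -(row_jacobian i (C1_diff sC)); apply: le_trans sJ.
move: ('J G s) => K; rewrite -linearB/=; apply: mx_norm_le => // k j.
by rewrite mxE; exact: mx_norm_coord.
Qed.

Lemma is_derive_sqn m n (G : 'rV[R]_m -> 'rV[R]_n) (x : 'rV[R]_n) (y v : 'rV[R]_m) (s : R) :
  derivable G (s *: v + y) v ->
  is_derive s 1 (fun s : R => sqn (G (s *: v + y) - x))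
    (2 * dotp (G (s *: v + y) - x) ('D_v G (s *: v + y))).
Proof.
move=> Gd; pose g j := (fun s : R => G (s *: v + y) ord0 j).
have -> : (fun s : R => sqn (G (s *: v + y) - x)) =
    \sum_(j < n) (g j - cst (x ord0 j)) ^+ 2.
  apply/funext => u; rewrite sqnE fct_sumE; apply: eq_bigr => j _.
  by rewrite !mxE.
have H1 j : is_derive s 1 (g j) ('D_v G (s *: v + y) ord0 j) by exact: is_derive_line.
have H2 j : is_derive s 1 (g j - cst (x ord0 j)) ('D_v G (s *: v + y) ord0 j - 0).
  by apply: is_deriveB.
have H3 j := is_deriveX 2 (H2 j).
have H4 := is_derive_sum H3.
apply: (is_derive_eq H4).
rewrite /dotp mxE mulr_sumr; apply: eq_bigr => j _.
have -> : (G (s *: v + y) - x) ord0 j = (g j - cst (x ord0 j)) s by rewrite !mxE.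
by rewrite subr0 expr1 mulrA; congr (_ * _); rewrite mxE.
Qed.

(** At a local minimum the derivative of the squared distance vanishes along each coordinate
    line. *)
Lemma sqn_critical m n (G : 'rV[R]_m -> 'rV[R]_n) (x : 'rV[R]_n) (s : 'rV[R]_m) :
  C1 G s -> (\forall u \near s, sqn (G s - x) <= sqn (G u - x)) ->
  (G s - x) *m ('J G s)^T = 0.
Proof.
move=> GC smin; have [Gd _] := GC.
have : \forall u \near s, differentiable G u /\ sqn (G s - x) <= sqn (G u - x).
  by near=> u; split; near: u.
move=> /nbhs_ballP[r /= r0 Hr].
apply/rowP => i; rewrite [RHS]mxE.
pose v : 'rV[R]_m := delta_mx ord0 i.
have line h : h \in `](- r), r[ -> ball s r (h *: v + s).
  rewrite in_itv/= => hr; apply/ball_rV => // j; rewrite !mxE eqxx/=.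
  case: eqVneq => _; last by rewrite mulr0 add0r subrr normr0.
  by rewrite mulr1 opprD addrCA subrr addr0 normrN ltr_norml.
have z0 : (0 : R) \in `](- r), r[ by rewrite in_itv/= r0 oppr_lt0 r0.
have D h : h \in `](- r), r[ -> derivable G (h *: v + s) v.
  by move=> /line/Hr[Gh _]; exact: diff_derivable.
have ab : - r <= r by rewrite ltW// (lt_trans _ r0)// oppr_lt0.
have dab h : h \in `](- r), r[ ->
    derivable (fun h : R => sqn (G (h *: v + s) - x)) h 1.
  by move=> /D/is_derive_sqn H; exact: ex_derive.
have mab h : h \in `](- r), r[ ->
    sqn (G (0 *: v + s) - x) <= sqn (G (h *: v + s) - x).
  by move=> hr; rewrite scale0r add0r; have [_] := Hr _ (line h hr).
have [_ E] := derive1_at_min ab dab z0 mab.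
have := @derive_val _ _ _ _ _ _ _ (is_derive_sqn x (D 0 z0)).
rewrite E scale0r add0r => /eqP; rewrite eq_sym mulf_eq0 pnatr_eq0/= => /eqP.
rewrite -(row_jacobian i (C1_diff GC)); move: ('J G s) (G s - x) => K w.
move=> E0; apply: etrans E0; rewrite /dotp !mxE; apply: eq_bigr => j _.
by rewrite !mxE.
Unshelve. all: by end_near. Qed.

Lemma cube_norm m (a t : 'rV[R]_m) l : 0 <= l -> cube a l t -> `|t - a| <= l.
Proof.
move=> l0 ta; apply: mx_norm_le => // i j; rewrite ord1 !mxE.
by have /andP[H1 /ltW H2] := ta j; rewrite ger0_norm ?subr_ge0// lerBlDl.
Qed.

Lemma norm_delta m (i : 'I_m) : `|delta_mx ord0 i : 'rV[R]_m| <= 1.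
Proof.
by apply: mx_norm_le => // k j; rewrite mxE; case: (_ && _); rewrite ?normr1 ?normr0.
Qed.

End Sheets.

(** * Shells for transverse sheets *)

Section TwoSheets.
Context {R : realType}.

(* [e] is of order [r] when the two sheets are transverse, but is the distance
   between them when they are tangent. *)
Definition shell_bound m n (J1 J2 : 'M[R]_(m, n)) (i : 'I_m) (dl C kap eps mu : R) :=
  forall (G1 G2 : 'rV[R]_m -> 'rV[R]_n) t1 t2 x rho eta r, 0 < rho ->
  sheet G1 t1 x J1 rho eps eta -> sheet G2 t2 x J2 rho eps eta ->
  (forall t s, `|t - t1| <= rho -> `|s - t2| <= rho -> G1 t <> G2 s) ->
  0 < r -> r <= mu * rho -> eta <= mu * r ->
  forall t, cube (t1 + r *: delta_mx ord0 i) (kap * r) t ->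
  exists (s : 'rV[R]_m) (e : R), [/\ 0 < e, e <= C * r,
    forall s', cube s e s' -> `|s' - t2| <= rho &
    forall s', cube s e s' -> `|G2 s' - G1 t| <= C * e /\
      Gamma ('J G1 t) ('J G2 s') (G2 s' - G1 t) <= 1 - dl].

Lemma norm_sum5 (V : normedZmodType R) (a b c d e : V) :
  `|a + b - c - d - e| <= `|a| + `|b| + `|c| + `|d| + `|e|.
Proof.
do 3 (apply: le_trans (ler_normB _ _) _; rewrite lerD2r).
exact: ler_normD.
Qed.

Lemma sheet_lip m n (G : 'rV[R]_m -> 'rV[R]_n) t0 x J rho eps eta (L : R) :
  sheet G t0 x J rho eps eta -> m%:R * eps <= 1 -> m%:R * `|J| + 1 <= L ->
  forall t t', `|t - t0| < rho -> `|t' - t0| < rho ->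
  `|G t - G t'| <= L * `|t - t'|.
Proof.
move=> GS e1 JL t t' t1 t2; have H := sheet_strict GS t1 t2.
rewrite -(subrK ((t - t') *m J) (G t - G t')); apply: le_trans (ler_normD _ _) _.
have H2 := mx_norm_mul (t - t') J.
have H3 := normr_ge0 (t - t').
move: H H2 H3; move: `|_ - _ - _| `|_ *m _| `|t - t'| => a b c.
move: e1 JL; move: (m%:R * eps) (`|J|) (m%:R : R) => p q u.
by clear; nra.
Qed.

(* The chords are nearly parallel to [row i J1], a vector tangent to the first
   sheet but not to the second. *)
Lemma two_sheets_transverse m n (J1 J2 : 'M[R]_(m, n)) (i : 'I_m) :
  row_free J1 -> row_free J2 -> ~~ (row i J1 <= J2)%MS ->
  exists dl C kap eps mu : R, [/\ 0 < dl, 0 < C, 0 < eps, 0 < mu &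
    [/\ 0 < kap, kap <= 1 / 4, mu <= 1 / 4 & shell_bound J1 J2 i dl C kap eps mu]].
Proof.
move=> J1f J2f iJ2; have m0 : (0 < m)%N by case: m i {J1 J2 J1f J2f iJ2} => // -[].
have [dl [e0 [dl0 e00 HG]]] := Gamma_near_tangent J1f J2f (row_sub i J1) iJ2.
set w0 := row i J1 in iJ2 HG.
pose e1 := Num.min e0 1.
have e10 : 0 < e1 by rewrite lt_min e00 ltr01.
have e11 : e1 <= 1 by rewrite ge_min lexx orbT.
have e1e0 : e1 <= e0 by rewrite ge_min lexx.
pose L := m%:R * (`|J1| + `|J2|) + 1.
have L1 : 1 <= L by rewrite lerDr mulr_ge0// addr_ge0.
have L0 : 0 < L by exact: lt_le_trans L1.
have LJ1 : m%:R * `|J1| + 1 <= L by rewrite lerD2r ler_wpM2l// lerDl.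
have LJ2 : m%:R * `|J2| + 1 <= L by rewrite lerD2r ler_wpM2l// lerDr.
have mR : 0 < m%:R :> R by rewrite ltr0n.
(* With [mu = e1 / 8], these choices bound the five terms of [WE] by 1, 1, 1, 2 and 1 eighths of
   [e1 * r], hence the error on the chord by [e1 * r]. *)
pose kap := e1 / (8 * L); pose eps := e1 / (8 * m%:R).
have kap0 : 0 < kap by rewrite divr_gt0 ?mulr_gt0.
have kapL : L * kap = e1 / 8 by rewrite /kap; field; rewrite gt_eqF.
have meps : m%:R * eps = e1 / 8 by rewrite /eps; field; rewrite gt_eqF.
have epse : eps <= e0.
  apply: le_trans e1e0; have : (1 : R) <= m%:R by rewrite ler1n.
  rewrite /eps ler_pdivrMr ?mulr_gt0// => H; apply: ler_peMr (ltW e10) _.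
  by move: H; clear; lra.
have kap8 : kap <= 1 / 8.
  by move: kapL L1 kap0 e11; clear; nra.
(* Large enough that [C * kap * r] dominates the length of a chord and that [kap <= C]. *)
pose C := (`|w0| + 1) / kap + 1.
have Ckap : C * kap = `|w0| + 1 + kap by rewrite /C mulrDl mul1r divfK// gt_eqF.
have C1 : 1 <= C by rewrite /C lerDr divr_ge0 ?(ltW kap0)// addr_ge0.
exists dl, C, kap, eps, (e1 / 8); split=> //.
- exact: lt_le_trans C1.
- by rewrite /eps divr_gt0 ?mulr_gt0.
- by rewrite divr_gt0.
split=> //.
- by move: kap8; clear; lra.
- by move: e11; clear; lra.
move=> G1 G2 t1 t2 x rho eta r rho0 S1 S2 dis r0 rmu etar t tc.
have kr0 : 0 < kap * r by rewrite mulr_gt0.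
have uk := cube_norm (ltW kr0) tc.
set u := t - _ in uk.
have tt1 : `|t - t1| <= 2 * r.
  have -> : t - t1 = u + r *: delta_mx ord0 i by rewrite /u opprD addrA subrK.
  apply: le_trans (ler_normD _ _) _; rewrite normrZ gtr0_norm//.
  have := norm_delta (R := R) i; move: uk kap8 r0; move: `|_| `|_| => a b.
  by clear; nra.
have rrho : 8 * r <= rho by move: rmu e11 e10 rho0; clear; nra.
have tr : `|t - t1| < rho by apply: le_lt_trans tt1 _; move: rrho r0; clear; lra.
have t1r : `|t1 - t1| < rho by rewrite subrr normr0.
have t2r : `|t2 - t2| < rho by rewrite subrr normr0.
(* A cube at [t2], of side proportional to [r], serves for all [t] in the shell. *)
exists t2, (kap * r); split=> //.
- by move: C1 kap8 r0; clear; nra.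
- move=> s' /(cube_norm (ltW kr0)) H; apply: le_trans H _.
  by move: kap8 rrho r0; clear; nra.
move=> s' /(cube_norm (ltW kr0)) sk.
have s'r : `|s' - t2| < rho.
  by apply: le_lt_trans sk _; move: kap8 rrho r0; clear; nra.
have e18 : m%:R * eps <= 1 by rewrite meps; move: e11; clear; lra.
set W := G2 s' - G1 t.
have WE : W + r *: w0 = (G2 s' - G2 t2) + (G2 t2 - x) - (G1 t1 - x) -
    (G1 t - G1 t1 - (t - t1) *m J1) - u *m J1.
  have -> : (t - t1) *m J1 = u *m J1 + r *: w0.
    have -> : t - t1 = u + r *: delta_mx ord0 i by rewrite /u opprD addrA subrK.
    by rewrite mulmxDl -scalemxAl -rowE.
  rewrite /W; move: (G2 s') (G2 t2) (G1 t1) (G1 t) (u *m J1) (r *: w0) => a b c d e f.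
  by apply/rowP => j; rewrite !mxE; ring.
have Wb : `|W + r *: w0| <= e1 * r.
  have H1 := sheet_lip S2 e18 LJ2 s'r t2r.
  have H4 := sheet_strict S1 tr t1r; rewrite meps in H4.
  have H5 := mx_norm_mul u J1.
  rewrite WE; apply: le_trans (norm_sum5 _ _ _ _ _) _.
  have [H2 _] := S2; have [H3 _] := S1.
  move: H1 H2 H3 H4 H5 sk uk tt1 LJ1 kapL etar.
  move: `|G2 s' - G2 t2| `|G2 t2 - x| `|G1 t1 - x| `|_ - _ - _| `|u *m J1|.
  move: `|s' - t2| `|t - t1| => p q a b c d e H1 H2 H3 H4 H5 H6 H7 H8 LJ1 H9 H10.
  have K1 : L * p <= e1 / 8 * r by rewrite -H9 -mulrA ler_wpM2l// ltW.
  have K2 : e1 / 8 * q <= e1 / 8 * (2 * r) by rewrite ler_wpM2l// divr_ge0// ltW.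
  have K3 : m%:R * `|u| * `|J1| <= e1 / 8 * r.
    rewrite mulrAC -H9 -[leRHS]mulrA; apply: ler_pM => //.
    by apply: le_trans LJ1; rewrite lerDl.
  by move: H1 H2 H3 H4 H5 K1 K2 K3 H10 (mulr_gt0 e10 r0); clear; lra.
have w0W : `|- r^-1 *: W - w0| <= e0.
  have -> : - r^-1 *: W - w0 = - (r^-1 *: (W + r *: w0)).
    by rewrite [in RHS]scalerDr scalerA mulVf ?gt_eqF// scale1r opprD scaleNr.
  rewrite normrN normrZ gtr0_norm ?invr_gt0//; apply: le_trans e1e0.
  by rewrite mulrC ler_pdivrMr.
split.
  have -> : W = (W + r *: w0) - r *: w0 by rewrite addrK.
  apply: le_trans (ler_normB _ _) _; rewrite normrZ gtr0_norm// mulrA Ckap.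
  by move: Wb e11 r0 kap0; clear; nra.
rewrite -(Gamma_scale _ _ (c := - r^-1)); last by rewrite oppr_eq0 invr_eq0 gt_eqF.
apply: HG w0W.
- have [_ H] := S1; have [_ H'] := H t (ltW tr); apply: le_trans H' _.
  exact: epse.
- have [_ H] := S2; have [_ H'] := H s' (ltW s'r); apply: le_trans H' _.
  exact: epse.
Qed.

End TwoSheets.

(** * Shells for tangent sheets *)

Section TangentSheets.
Context {R : realType}.

Lemma closed_ball_rV_compact n (t : 'rV[R]_n) (r : R) :
  compact [set s : 'rV[R]_n | `|s - t| <= r].
Proof.
apply: bounded_closed_compact.
  exists (`|t| + r); split; [exact: num_real|move=> M M1 v /= vr].
  rewrite -(subrK t v); apply: le_trans (ler_normD _ _) _.
  by rewrite addrC; apply: le_trans (ltW M1); rewrite lerD2l.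
have -> : [set s : 'rV[R]_n | `|s - t| <= r] = (fun s => `|s - t|) @^-1` [set x | x <= r] by [].
apply: closed_comp; last exact: closed_le.
move=> v _; apply: (@cvg_norm _ _ _ _ (nbhs_filter v)).
by apply: (@cvgB _ _ _ _ (nbhs_filter v)); [exact: cvg_id|exact: cvg_cst].
Qed.

Lemma nearest_point m n (G : 'rV[R]_m -> 'rV[R]_n) (y : 'rV[R]_n) (t : 'rV[R]_m) (r : R) :
  0 <= r -> (forall s, `|s - t| <= r -> C1 G s) ->
  exists2 s, `|s - t| <= r &
    forall u, `|u - t| <= r -> sqn (G s - y) <= sqn (G u - y).
Proof.
move=> r0 GC; have cA := @closed_ball_rV_compact m t r.
have [||s sA smin] := @EVT_min_rV R m (fun s => sqn (G s - y)) _ _ cA.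
- by exists t; rewrite /= subrr normr0.
- apply: continuous_in_subspaceT => s; rewrite inE => /= /GC/C1_cont sc.
  apply: (cvg_sqn (FF := nbhs_filter s)).
  by apply: (@cvgB _ _ _ _ (nbhs_filter s)); [exact: sc|exact: cvg_cst].
exists s; first by move: sA; rewrite inE.
by move=> u ur; apply: smin; rewrite inE.
Qed.

(** Serves to locate the nearest point: its parameter has size [p], known up to an error [a * p]
    proportional to itself, which the smallness of [a * c] absorbs. *)
Lemma absorb_error (c p q a z : R) : 0 < c -> 0 <= p -> 0 <= z ->
  p <= c * q -> q <= a * p + 2 * z -> a * c <= 1 / 8 -> p <= 4 * c * z.
Proof.
move=> c0 p0 z0 pq qa ac; have H : p <= c * (a * p + 2 * z).
  by apply: le_trans pq _; rewrite ler_wpM2l// ltW.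
have H2 : a * c * p <= 1 / 8 * p by rewrite ler_wpM2r.
have H3 : 0 <= c * z by rewrite mulr_ge0// ltW.
rewrite mulrDr (_ : c * (a * p) = a * c * p) in H; last by ring.
rewrite (_ : c * (2 * z) = 2 * (c * z)) in H; last by ring.
rewrite -mulrA; move: H H2 H3 p0; move: (a * c * p) (c * z) => u v.
by clear; lra.
Qed.

(* The chord from [G1 t] to the nearest point [G2 s], of length [d], is normal to
   the second sheet; moving from [G2 s] by [d] in a tangent direction makes the
   chord oblique, with Gamma bounded away from 1 by compactness of the set of
   unit normals. *)
Lemma two_sheets_tangent m n (J1 J2 : 'M[R]_(m, n)) (i : 'I_m) :
  row_free J1 -> row_free J2 -> (J2 <= J1)%MS ->
  exists dl C kap eps mu : R, [/\ 0 < dl, 0 < C, 0 < eps, 0 < mu &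
    [/\ 0 < kap, kap <= 1 / 4, mu <= 1 / 4 & shell_bound J1 J2 i dl C kap eps mu]].
Proof.
move=> J1f J2f J21; have m0 : (0 < m)%N by case: m i {J1 J2 J1f J2f J21} => // -[].
pose tau := row i J2.
have tau0 : tau != 0.
  rewrite /tau rowE -(mul0mx _ J2) (inj_eq (row_free_inj J2f)); apply/eqP.
  move=> /(congr1 (fun M : 'rV[R]_m => M ord0 i))/eqP.
  by rewrite !mxE !eqxx/= oner_eq0.
have [dl [e0 [dl0 e00 HG]]] :=
  Gamma_near_oblique J1f J2f (submx_trans (row_sub i J2) J21) (row_sub i J2) tau0.
pose e1 := Num.min e0 1.
have e10 : 0 < e1 by rewrite lt_min e00 ltr01.
have e11 : e1 <= 1 by rewrite ge_min lexx orbT.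
have e1e0 : e1 <= e0 by rewrite ge_min lexx.
pose L := m%:R * (`|J1| + `|J2|) + 1.
have L1 : 1 <= L by rewrite lerDr mulr_ge0// addr_ge0.
have L0 : 0 < L by exact: lt_le_trans L1.
have LJ1 : m%:R * `|J1| + 1 <= L by rewrite lerD2r ler_wpM2l// lerDl.
have LJ2 : m%:R * `|J2| + 1 <= L by rewrite lerD2r ler_wpM2l// lerDr.
have mR : 1 <= m%:R :> R by rewrite ler1n.
(* A right inverse of [J2] turns bounds on tangent vectors into bounds on parameters. *)
have [B JB] := row_freeP J2f.
pose c := n%:R * `|B| + 1.
have c1 : 1 <= c by rewrite lerDr mulr_ge0.
have c0 : 0 < c by exact: lt_le_trans c1.
have cJ (v : 'rV[R]_m) : `|v| <= c * `|v *m J2|.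
  rewrite -[v in leLHS]mulmx1 -JB mulmxA; apply: le_trans (mx_norm_mul _ _) _.
  by rewrite mulrAC ler_wpM2r// lerDl.
pose kap := e1 / (8 * L); pose eps := e1 / (8 * m%:R * c).
have kap0 : 0 < kap by rewrite divr_gt0 ?mulr_gt0.
have kapL : L * kap = e1 / 8 by rewrite /kap; field; rewrite gt_eqF.
have mR0 : 0 < m%:R :> R by exact: lt_le_trans mR.
have meps : m%:R * eps * c = e1 / 8 by rewrite /eps; field; rewrite !gt_eqF.
have eps0 : 0 < eps by rewrite divr_gt0 ?mulr_gt0.
have meps0 : 0 < m%:R * eps by rewrite mulr_gt0.
have meps8 : m%:R * eps <= e1 / 8.
  by move: meps c1 meps0; move: (m%:R * eps) (c) => p q; clear; nra.
have epse : eps <= e0.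
  apply: le_trans e1e0; move: meps8 mR eps0 e10.
  by move: (m%:R : R) (eps) (e1) => p q u; clear; nra.
have kap8 : kap <= 1 / 8.
  by move: kapL L1 kap0 e11; clear; nra.
(* [2 * L + 1] bounds the sup distance from [G1 t] to [G2 t2] in units of [r]. The nearest point
   minimises the Euclidean distance, whence the factor [n.+1]. *)
pose D := n.+1%:R * (2 * L + 1).
have n1 : 1 <= n.+1%:R :> R by rewrite ler1n.
have D1 : 2 * L + 1 <= D by rewrite /D ler_peMl// addr_ge0// mulr_ge0// ltW.
have D0 : 1 <= D by apply: le_trans D1; move: L1; clear; lra.
have D00 : 0 < D by exact: lt_le_trans D0.
(* Gives [16 * c * D * r <= rho], which keeps the nearest point in the interior of the ball where it
   is sought. *)
pose mu := 1 / (16 * c * D).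
have cD0 : 0 < 16 * c * D by apply: mulr_gt0 D00; exact: mulr_gt0.
have muD : mu * (16 * c * D) = 1.
  by rewrite /mu divfK// gt_eqF.
have cD1 : 1 <= c * D by apply: mulr_ege1.
have mu0 : 0 < mu by rewrite divr_gt0.
have mu8 : mu <= 1 / 16 by move: muD cD1 mu0; move: (mu) (c) (D) => p q u; clear; nra.
pose C := (`|tau| + 2) / kap + D.
have Ckap : C * kap = `|tau| + 2 + D * kap by rewrite /C mulrDl divfK// gt_eqF.
have CD : D <= C by rewrite /C lerDr divr_ge0 ?(ltW kap0)// addr_ge0.
exists dl, C, kap, eps, mu; split=> //.
  exact: lt_le_trans CD.
split=> //.
- by move: kap8; clear; lra.
- by move: mu8; clear; lra.
move=> G1 G2 t1 t2 x rho eta r rho0 S1 S2 dis r0 rmu etar t tc.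
have kr0 : 0 < kap * r by rewrite mulr_gt0.
have uk := cube_norm (ltW kr0) tc.
set u := t - _ in uk.
have tt1 : `|t - t1| <= 2 * r.
  have -> : t - t1 = u + r *: delta_mx ord0 i by rewrite /u opprD addrA subrK.
  apply: le_trans (ler_normD _ _) _; rewrite normrZ gtr0_norm//.
  have := norm_delta (R := R) i; move: uk kap8 r0; move: `|_| `|_| => a b.
  by clear; nra.
have rrho : 16 * (c * D * r) <= rho.
  have -> : 16 * (c * D * r) = r * (16 * c * D) by ring.
  have K : rho = mu * rho * (16 * c * D) by rewrite mulrAC muD mul1r.
  by rewrite [leRHS]K ler_wpM2r// ltW.
have rrho' : 16 * r <= rho.
  by apply: le_trans rrho; rewrite ler_pM2l// ler_peMl// ltW.
have tr : `|t - t1| < rho by apply: le_lt_trans tt1 _; move: rrho' r0; clear; lra.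
have t1r : `|t1 - t1| < rho by rewrite subrr normr0.
have t2r : `|t2 - t2| < rho by rewrite subrr normr0.
have e18 : m%:R * eps <= 1 by move: meps8 e11; clear; lra.
set y := G1 t.
have yb : `|G2 t2 - y| <= (2 * L + 1) * r.
  have H := sheet_lip S1 e18 LJ1 tr t1r.
  have [H1 _] := S1; have [H2 _] := S2.
  have -> : G2 t2 - y = (G2 t2 - x) - (G1 t1 - x) - (G1 t - G1 t1).
    rewrite /y; move: (G2 t2) (G1 t) (G1 t1) => a b d.
    by apply/rowP => j; rewrite !mxE; ring.
  apply: le_trans (ler_normB _ _) _; apply: le_trans (lerD (ler_normB _ _) (lexx _)) _.
  have H3 : L * `|t - t1| <= L * (2 * r) by rewrite ler_wpM2l// ltW.
  move: H H1 H2 H3 etar mu8 r0; move: `|_| `|_| `|_| (L * _) => a b d e.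
  by clear; nra.
have rho2 : 0 <= rho / 2 by rewrite divr_ge0// ltW.
have rho2l : rho / 2 < rho by rewrite ltr_pdivrMr// ltr_pMr// ltr1n.
(* The minimum is sought over the ball of radius [rho / 2]; [st2'] then places it within [rho / 4]
   of [t2], so it is an unconstrained local minimum and the chord is normal there. *)
have [s sr smin] : exists2 s, `|s - t2| <= rho / 2 &
    forall u, `|u - t2| <= rho / 2 -> sqn (G2 s - y) <= sqn (G2 u - y).
  apply: nearest_point => // s sr; have [_ H] := S2.
  by have [H' _] := H s (le_trans sr (ltW rho2l)); exact: H'.
have srho : `|s - t2| < rho by exact: le_lt_trans sr rho2l.
pose d := `|G2 s - y|.
(* Disjointness of the sheets enters here: the scale [d] of the partner cube is positive. *)
have d0 : 0 < d.
  rewrite normr_gt0 subr_eq0; apply/eqP => E.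
  exact: (dis t s (ltW tr) (ltW srho) (esym E)).
have dD : d <= D * r.
  have H : enorm (G2 s - y) <= enorm (G2 t2 - y).
    by rewrite !enormE ler_wsqrtr// smin// subrr normr0.
  apply: le_trans (norm_le_enorm _) (le_trans H _).
  apply: le_trans (enorm_le _) _; rewrite /D -mulrA.
  by apply: ler_pM => //; rewrite ler_nat.
have st2 : `|s - t2| <= 4 * c * (D * r).
  have H := sheet_strict S2 srho t2r; have K := cJ (s - t2).
  have K2 : `|(s - t2) *m J2| <= `|G2 s - G2 t2 - (s - t2) *m J2| + `|G2 s - G2 t2|.
    by rewrite -{1}[(s - t2) *m J2](subKr (G2 s - G2 t2)) distrC; exact: ler_normB.
  have K3 : `|G2 s - G2 t2| <= 2 * (D * r).
    have -> : G2 s - G2 t2 = (G2 s - y) - (G2 t2 - y) by rewrite opprB addrA subrK.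
    apply: le_trans (ler_normB _ _) _; move: dD yb; rewrite -/d.
    have : (2 * L + 1) * r <= D * r by rewrite ler_wpM2r// ltW.
    by move: ((2 * L + 1) * r) (D * r) (d) `|G2 t2 - y| => p q a b; clear; lra.
  apply: (absorb_error c0 (normr_ge0 _) _ K (le_trans K2 (lerD H K3))).
  - by rewrite mulr_ge0// ltW.
  - by rewrite meps; move: e11; clear; lra.
have st2' : `|s - t2| <= rho / 4.
  apply: le_trans st2 _; rewrite (_ : 4 * c * (D * r) = 4 * (c * D * r)); last by ring.
  by move: rrho; move: (c * D * r) => w; clear; lra.
have sC : C1 G2 s.
  by have [_ H] := S2; have [H' _] := H s (ltW srho); exact: H'.
have ortho : (G2 s - y) *m ('J G2 s)^T = 0.
  apply: sqn_critical => //; apply/nbhs_ballP.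
  exists (rho / 4) => [|v]; first by rewrite /= divr_gt0.
  rewrite -ball_normE/= => sv; apply: smin.
  have -> : v - t2 = (s - t2) - (s - v) by rewrite opprB [RHS]addrC addrA subrK.
  apply: le_trans (ler_normB _ _) _; move: st2' sv; move: `|_| `|_| => a b.
  by clear; lra.
pose nu := d^-1 *: (G2 s - y).
have nu1 : `|nu| = 1 by rewrite normrZ gtr0_norm ?invr_gt0// mulVf// gt_eqF.
have nuJ : nu *m ('J G2 s)^T = 0 by rewrite -scalemxAl ortho scaler0.
have kd0 : 0 < kap * d by rewrite mulr_gt0.
(* From the foot [s], a step of length [d] in the parameter direction [i]: the scale is that of the
   distance between the sheets, not [r]. *)
exists (s + d *: delta_mx ord0 i), (kap * d).
have cube_s' s' : cube (s + d *: delta_mx ord0 i) (kap * d) s' ->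
    [/\ `|s' - s| <= 2 * d & `|s' - t2| < rho].
  move=> /(cube_norm (ltW kd0)); set v := s' - _ => vk.
  have H : `|s' - s| <= 2 * d.
    have -> : s' - s = v + d *: delta_mx ord0 i by rewrite /v opprD addrA subrK.
    apply: le_trans (ler_normD _ _) _; rewrite normrZ gtr0_norm//.
    have := norm_delta (R := R) i; move: vk kap8 d0; move: `|_| `|_| => a b.
    by clear; nra.
  split=> //; rewrite -(subrK s s') -addrA; apply: le_lt_trans (ler_normD _ _) _.
  have K : D * r <= c * D * r by rewrite ler_wpM2r ?(ltW r0)// ler_peMl// (ltW D00).
  move: H st2' dD rrho K rho0; move: `|_| `|_| (c * D * r) (D * r) => a b p q.
  by clear; lra.
split=> //.
- apply: le_trans (_ : D * r <= _); last by rewrite ler_wpM2r// ltW.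
  by apply: le_trans dD; rewrite ler_piMl ?(ltW d0)//; move: kap8; clear; lra.
- by move=> s' /cube_s'[_ /ltW].
move=> s' s'c; have [s's s't2] := cube_s' s' s'c.
have := cube_norm (ltW kd0) s'c; set v := s' - _ => vk.
set W := G2 s' - y.
(* [d *: (nu + tau)] is the model chord. The error comes from the size of the cube and from the
   nonlinearity of [G2] between [s] and [s']. *)
have WE : W - d *: (nu + tau) = v *m J2 + (G2 s' - G2 s - (s' - s) *m J2).
  have -> : (s' - s) *m J2 = v *m J2 + d *: tau.
    have -> : s' - s = v + d *: delta_mx ord0 i by rewrite /v opprD addrA subrK.
    by rewrite mulmxDl -scalemxAl -rowE.
  rewrite scalerDr /nu scalerA mulfV ?gt_eqF// scale1r /W.
  move: (G2 s') (G2 s) (v *m J2) (d *: tau) => a b p q.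
  by apply/rowP => j; rewrite !mxE; ring.
have Wb : `|W - d *: (nu + tau)| <= e1 * d.
  rewrite WE; apply: le_trans (ler_normD _ _) _.
  have H1 := mx_norm_mul v J2.
  have H2 := sheet_strict S2 s't2 srho.
  have K1 : m%:R * `|v| * `|J2| <= e1 / 8 * d.
    rewrite mulrAC -kapL -[leRHS]mulrA; apply: ler_pM => //.
    by apply: le_trans LJ2; rewrite lerDl.
  have K2 : m%:R * eps * `|s' - s| <= e1 / 8 * (2 * d) by apply: ler_pM => //; exact: ltW.
  by move: H1 H2 K1 K2 (mulr_gt0 e10 d0); move: `|_| `|_| (_ * _) (_ * _) => a b p q; clear; lra.
split.
  have -> : W = (W - d *: (nu + tau)) + d *: (nu + tau) by rewrite subrK.
  apply: le_trans (ler_normD _ _) _; rewrite normrZ (gtr0_norm d0) mulrA Ckap.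
  have := ler_normD nu tau; rewrite nu1.
  have K : 0 <= D * kap by rewrite mulr_ge0// ?(ltW kap0)// (ltW D00).
  move: Wb e11 d0 K; move: `|_| `|_| `|_| (D * kap) => a b p q.
  by clear; nra.
rewrite -(Gamma_scale _ _ (c := d^-1)); last by rewrite invr_eq0 gt_eqF.
have HJ q : `|q - t2| < rho -> `|'J G2 q - J2| <= e0.
  by move=> /ltW qr; have [_ H] := S2; have [_ H'] := H q qr; apply: le_trans H' _; exact: epse.
have HJ1 : `|'J G1 t - J1| <= e0.
  by have [_ H] := S1; have [_ H'] := H t (ltW tr); apply: le_trans H' _; exact: epse.
apply: (HG _ _ _ nu _ HJ1 (HJ _ s't2) (HJ _ srho) nu1 nuJ).
have -> : d^-1 *: W - (nu + tau) = d^-1 *: (W - d *: (nu + tau)).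
  by rewrite [in RHS]scalerBr scalerA mulVf ?gt_eqF// scale1r.
rewrite normrZ gtr0_norm ?invr_gt0//; apply: le_trans e1e0.
by rewrite mulrC ler_pdivrMr.
Qed.

(** The planes have the same dimension: unless the first contains a direction outside the second
    they coincide, and the tangent case applies. *)
Lemma two_sheets m n (J1 J2 : 'M[R]_(m, n)) : (0 < m)%N ->
  row_free J1 -> row_free J2 ->
  exists i dl C kap eps mu, [/\ 0 < dl, 0 < C, 0 < eps, 0 < mu &
    [/\ 0 < kap, kap <= 1 / 4, mu <= 1 / 4 & shell_bound J1 J2 i dl C kap eps mu]].
Proof.
move=> m0 J1f J2f; have [J12|J12] := boolP (J1 <= J2)%MS; last first.
  have [i iJ] : exists i, ~~ (row i J1 <= J2)%MS.
    by apply/existsP; rewrite -negb_forall; apply: contra J12 => /forallP/row_subP.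
  by exists i; exact: two_sheets_transverse.
exists (Ordinal m0); apply: two_sheets_tangent => //.
have : (J1 == J2)%MS by rewrite -(geq_leqif (mxrank_leqif_eq J12)) (eqnP J1f) (eqnP J2f).
by case/andP.
Qed.

End TangentSheets.

(** * Neighbourhoods in the compact-open C^2-topology *)

Section C2Neighbourhoods.
Context {R : realType} {m n : nat} {M : closed_manifold R m}.

(** The condition that [C2_open] imposes at a point, as a filter, so that closeness conditions can
    be intersected and compactness arguments run on it. *)
Definition C2_nbhs (g : M -> 'rV[R]_n) : set_system (M -> 'rV[R]_n) :=
  [set V | exists (l : nat) (c : 'I_l -> chart R m M)
      (K : 'I_l -> set M) (e : 'I_l -> R),
    (forall i, [/\ atlas (c i), compact (K i), K i `<=` cdom (c i)
                 & 0 < e i]) /\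
    forall g', immersion g' ->
      (forall i, C2_close (c i) (K i) (e i) g g') -> V g'].

Global Instance C2_nbhs_filter g : Filter (C2_nbhs g).
Proof.
split.
- exists 0%N, (fun i : 'I_0 => False_rect _ (notF (ltn_ord i))).
  exists (fun=> set0), (fun=> 1); split=> //.
  by case.
- move=> V W [l [c [K [e [cP VP]]]]] [l' [c' [K' [e' [cP' WP]]]]].
  exists (l + l')%N.
  exists (fun i : 'I_(l + l')%N => match fintype.split i with inl j => c j | inr j => c' j end).
  exists (fun i : 'I_(l + l')%N => match fintype.split i with inl j => K j | inr j => K' j end).
  exists (fun i : 'I_(l + l')%N => match fintype.split i with inl j => e j | inr j => e' j end).
  split=> [i|g' g'I close]; first by case: (fintype.split i).
  split.
    apply: VP => // i; have := close (lshift l' i).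
    by rewrite (unsplitK (inl i : 'I_l + 'I_l')%type).
  apply: WP => // i; have := close (rshift l i).
  by rewrite (unsplitK (inr i : 'I_l + 'I_l')%type).
- move=> V W VW [l [c [K [e [cP VP]]]]]; exists l, c, K, e; split=> // g' g'I H.
  by apply: VW; exact: VP.
Qed.

Lemma C2_nbhs_immersion g : C2_nbhs g (@immersion R m n M).
Proof.
exists 0%N, (fun i : 'I_0 => False_rect _ (notF (ltn_ord i))).
by exists (fun=> set0), (fun=> 1); split=> //; case.
Qed.

Lemma C2_nbhs_close g (d : chart R m M) (K : set M) (e : R) :
  atlas d -> compact K -> K `<=` cdom d -> 0 < e ->
  C2_nbhs g (C2_close d K e g).
Proof.
move=> ad cK Kd e0; exists 1%N, (fun=> d), (fun=> K), (fun=> e); split=> //.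
by move=> g' _ /(_ ord0).
Qed.

Lemma C2_close_tangent (d : chart R m M) (K : set M) (e : R) (f g : M -> 'rV[R]_n) p :
  immersion f -> immersion g -> atlas d -> cdom d p -> K p -> 0 < e ->
  C2_close d K e f g ->
  `|tangent_mx d g p - tangent_mx d f p| <= e /\ `|g p - f p| <= e.
Proof.
move=> fI gI ad dp Kp e0 fg; split; last first.
  have := fg p [::] Kp isT; rewrite /= cfunK// => /ltW; rewrite distrC.
  by apply: le_trans; exact: norm_le_enorm.
have fd := C1_diff (immersion_C1 fI ad dp).
have gd := C1_diff (immersion_C1 gI ad dp).
have H i : `|row i (tangent_mx d g p) - row i (tangent_mx d f p)| <= e.
  have := fg p [:: i] Kp isT; rewrite /=.
  rewrite -(row_jacobian i fd) -(row_jacobian i gd) => /ltW; rewrite distrC.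
  by apply: le_trans; exact: norm_le_enorm.
move: H; rewrite /tangent_mx; move: ('J _ _) ('J _ _) => X Y H.
apply: mx_norm_le => [|i j]; first exact: ltW.
apply: le_trans (H i); have := mx_norm_coord (row i Y - row i X) ord0 j.
by rewrite !mxE.
Qed.

(** Closeness is given in atlas charts over compact sets but wanted in an arbitrary parametrisation.
    Near each point of [K] the change of coordinates has bounded Jacobian, and compactness of [K]
    yields one neighbourhood of [g]. *)
Lemma param_near (U : set 'rV[R]_m) theta tau (g : M -> 'rV[R]_n) (K : set 'rV[R]_m) (e : R) :
  immersion g -> local_param U theta tau -> compact K -> K `<=` U -> 0 < e ->
  \forall g' \near C2_nbhs g, forall t, K t ->
    `|'J (g' \o theta) t - 'J (g \o theta) t| <= e /\
    `|(g' \o theta) t - (g \o theta) t| <= e.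
Proof.
move=> gI tP cK KU e0; have [oU tauK op tc C] := tP.
apply: ((compact_near_coveringP _).1 cK _ (C2_nbhs g)
  (fun g' t => `|'J (g' \o theta) t - 'J (g \o theta) t| <= e /\
    `|(g' \o theta) t - (g \o theta) t| <= e) _) => t Kt.
have Ut := KU t Kt; have [d ad dt] := atlas_cover (theta t).
have [psiC _] := C d t ad Ut dt; have [_ psiJ] := psiC.
pose B := `|'J (cfun d \o theta) t| + 1.
have B0 : 0 < B by rewrite ltr_wpDl.
have H1 : \forall s \near t, cdom d (theta s) by exact: tc t Ut _ (cdom_near dt).
have H2 : \forall s \near t, `|'J (cfun d \o theta) s| < B.
  have K2 := @cvg_norm _ _ _ _ (nbhs_filter t) _ _ psiJ.
  by apply: (@cvgr_lt _ _ _ (nbhs_filter t) _ _ K2); rewrite ltrDl.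
have H3 : \forall s \near t, U s by exact: open_nbhs_nbhs.
have : \forall s \near t, [/\ U s, cdom d (theta s) & `|'J (cfun d \o theta) s| < B].
  by near=> s; split; near: s.
move=> /nbhs_ballP[r /= r0 Hr].
pose K0 := [set s : 'rV[R]_m | `|s - t| <= r / 2].
have K0r s : K0 s -> ball t r s.
  rewrite /K0 /= -ball_normE/= distrC => H; apply: le_lt_trans H _.
  by rewrite ltr_pdivrMr// ltr_pMr// ltr1n.
have cK0 : compact (theta @` K0).
  apply: continuous_compact; last exact: closed_ball_rV_compact.
  apply: continuous_in_subspaceT => s; rewrite inE => /K0r/Hr[Us _ _].
  exact: tc.
have K0d : theta @` K0 `<=` cdom d by move=> _ [s /K0r/Hr[_ ds _] <-].
(* [B] bounds the Jacobian of the change of coordinates and [m] comes from the sup norm of a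
   product; the added 1 ensures [e' <= e], for the values. *)
pose e' := e / (m%:R * B + 1).
have mB : 0 < m%:R * B + 1 by rewrite ltr_wpDl// mulr_ge0// ltW.
have e'0 : 0 < e' by rewrite divr_gt0.
have e'e : e' <= e by rewrite ler_pdivrMr// ler_peMr ?(ltW e0)// lerDr mulr_ge0// ltW.
have t0 : nbhs t K0.
  apply/nbhs_ballP; exists (r / 2); first by rewrite /= divr_gt0.
  by move=> s; rewrite -ball_normE/= distrC => /ltW.
exists (K0, [set g' | immersion g' /\ C2_close d (theta @` K0) e' g g']).
  split; first exact: t0.
  apply: filterI; first exact: C2_nbhs_immersion.
  exact: C2_nbhs_close.
move=> [s g'] [/= Ks [g'I close]]; have [Us ds Bs] := Hr _ (K0r _ Ks).
have [|T1 T2] := C2_close_tangent gI g'I ad ds _ e'0 close; first by exists s.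
split; last exact: le_trans T2 e'e.
have [_ JE] := param_C1 gI tP ad Us ds; have [_ JE'] := param_C1 g'I tP ad Us ds.
have E : 'J (g' \o theta) s - 'J (g \o theta) s = 'J (cfun d \o theta) s *m
    (tangent_mx d g' (theta s) - tangent_mx d g (theta s)).
  exact: etrans (congr2 (fun X Y => X - Y) JE' JE) (esym (mulmxBr _ _ _)).
apply: (@le_trans _ _ (m%:R * B * e')).
  apply: le_trans (_ : m%:R * `|'J (cfun d \o theta) s| *
     `|tangent_mx d g' (theta s) - tangent_mx d g (theta s)| <= _).
    have := mx_norm_mul ('J (cfun d \o theta) s)
      (tangent_mx d g' (theta s) - tangent_mx d g (theta s)).
    by apply: le_trans; rewrite -E; exact: lexx.
  apply: ler_pM T1 => //.
  by rewrite ler_wpM2l// ltW.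
rewrite /e' mulrA ler_pdivrMr// mulrC ler_wpM2l ?(ltW e0)//.
by rewrite lerDl.
Unshelve. all: by end_near. Qed.

End C2Neighbourhoods.

(** * An open invariant set of immersions with two close sheets *)

Section NearDoublePoint.
Context {R : realType} {m n : nat}.

Lemma sheet_weaken (G : 'rV[R]_m -> 'rV[R]_n) t0 x J rho rho' eps eps' eta eta' :
  sheet G t0 x J rho eps eta -> rho' <= rho -> eps <= eps' -> eta <= eta' ->
  sheet G t0 x J rho' eps' eta'.
Proof.
move=> [Gx GJ] rr ee hh; split; first exact: le_trans Gx hh.
move=> t tr; have [C H] := GJ t (le_trans tr rr); split; first exact: C.
exact: le_trans H ee.
Qed.

Definition oball (t : 'rV[R]_m) (r : R) : set 'rV[R]_m := [set s | `|s - t| < r].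

Lemma open_oball t r : open (oball t r).
Proof.
have -> : oball t r = ball t r.
  by apply/seteqP; split=> s; rewrite -ball_normE /oball /= distrC.
by have := @ball_open _ _ t r; exact.
Qed.

Variables (t1 t2 : 'rV[R]_m) (x : 'rV[R]_n) (J1 J2 : 'M[R]_(m, n)).
Variables (rho eps eta : R).
Hypotheses (rho0 : 0 < rho) (eps0 : 0 < eps) (eta0 : 0 < eta).

(* The slack [q < 1] makes this set open. *)
Definition near_double (M : closed_manifold R m) : set (M -> 'rV[R]_n) :=
  [set g | immersion g /\ exists theta1 tau1 theta2 tau2 (q : R),
    [/\ local_param (oball t1 (2 * rho)) theta1 tau1,
        local_param (oball t2 (2 * rho)) theta2 tau2,
        forall t s, oball t1 (2 * rho) t -> oball t2 (2 * rho) s -> theta1 t <> theta2 s,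
        0 <= q < 1 &
        sheet (g \o theta1) t1 x J1 rho (q * eps) (q * eta) /\
        sheet (g \o theta2) t2 x J2 rho (q * eps) (q * eta)]].

(** Parametrisations live on balls of radius [2 * rho] so that the closed ball of radius [rho],
    where the sheets are controlled, is a compact part of their domain. *)
Lemma oball_sub t : [set s : 'rV[R]_m | `|s - t| <= rho] `<=` oball t (2 * rho).
Proof. by move=> s /= H; apply: le_lt_trans H _; rewrite ltr_pMl// ltr1n. Qed.

Lemma sheet_near (M : closed_manifold R m) (g : M -> 'rV[R]_n) theta tau t0 J (q q' : R) :
  immersion g -> local_param (oball t0 (2 * rho)) theta tau ->
  q < q' -> sheet (g \o theta) t0 x J rho (q * eps) (q * eta) ->
  \forall g' \near C2_nbhs g, sheet (g' \o theta) t0 x J rho (q' * eps) (q' * eta).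
Proof.
move=> gI tP qq [gx gJ].
pose mu := Num.min ((q' - q) * eps) ((q' - q) * eta).
have mu0 : 0 < mu by rewrite lt_min !mulr_gt0// subr_gt0.
have mu1 : mu <= (q' - q) * eps by rewrite ge_min lexx.
have mu2 : mu <= (q' - q) * eta by rewrite ge_min lexx orbT.
have cK := @closed_ball_rV_compact R m t0 rho.
have H := param_near gI tP cK (@oball_sub t0) mu0.
apply: filterS2 (C2_nbhs_immersion g) H => g' g'I g'H; split.
  have t00 : `|t0 - t0| <= rho by rewrite subrr normr0 ltW.
  have [_ D] := g'H t0 t00; rewrite -(subrK ((g \o theta) t0) ((g' \o theta) t0)) -addrA.
  apply: le_trans (ler_normD _ _) _.
  by apply: le_trans (lerD D gx) _; rewrite -lerBrDr -mulrBl.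
move=> t tr; have [D _] := g'H t tr.
have Ut := oball_sub tr; split.
  have [d ad dt] := atlas_cover (theta t).
  have [C _] := param_C1 g'I tP ad Ut dt; exact: C.
have [_ Jt] := gJ t tr; move: D Jt.
move: ('J (g' \o theta) t) ('J (g \o theta) t) => X Y D Jt.
rewrite -(subrK Y X) -addrA; apply: le_trans (ler_normD _ _) _.
by apply: le_trans (lerD D Jt) _; rewrite -lerBrDr -mulrBl.
Qed.

(** Replacing the slack [q] by the midpoint of [q] and 1 leaves room for perturbing both sheets. *)
Lemma near_double_open (M : closed_manifold R m) : C2_open (@near_double M).
Proof.
split=> [g []//|g [gI [th1 [tau1 [th2 [tau2 [q [P1 P2 dis /andP[q0 q1] [S1 S2]]]]]]]]].
suff : C2_nbhs g (@near_double M) by [].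
pose q' := (q + 1) / 2.
have qq' : q < q' by rewrite /q'; lra.
have q'1 : q' < 1 by rewrite /q'; lra.
have q'0 : 0 <= q' by exact: le_trans q0 (ltW qq').
have N1 := sheet_near gI P1 qq' S1; have N2 := sheet_near gI P2 qq' S2.
apply: filterS3 (C2_nbhs_immersion g) N1 N2 => g' g'I S1' S2'; split=> //.
exists th1, tau1, th2, tau2, q'; split=> //; by rewrite ?q'0 ?q'1.
Qed.

(** This is why [near_double] allows arbitrary parametrisations: those of [g], moved by the inverse
    of [phi], give for [g \o phi] the very same maps into R^n. *)
Lemma near_double_invariant (M : closed_manifold R m) : Diff_invariant (@near_double M).
Proof.
move=> g phi [gI [th1 [tau1 [th2 [tau2 [q [P1 P2 dis q01 [S1 S2]]]]]]]] phiD.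
split; first exact: immersion_diffeo.
have [phiC [psi [psiC phiK psiK]]] := phiD.
have E th : (g \o phi) \o (psi \o th) = g \o th.
  by apply/funext => t; rewrite /= psiK.
exists (psi \o th1), (tau1 \o phi), (psi \o th2), (tau2 \o phi), q; split.
- exact: local_param_diffeo psiC phiC psiK phiK P1.
- exact: local_param_diffeo psiC phiC psiK phiK P2.
- by move=> t s Ut Us /= /(can_inj psiK); exact: dis.
- exact: q01.
- by rewrite (E _ th1) (E _ th2).
Qed.

End NearDoublePoint.

(** * Energy near a double point and divergence *)

Section Divergence.
Context {R : realType}.

(** [rho] can be fixed before [eta] because both sheets of [g] pass exactly through the double
    point. *)
Lemma double_point_near m n (M : closed_manifold R m) (g : M -> 'rV[R]_n) (p q : M)
    (c d : chart R m M) : immersion g -> p <> q -> g p = g q ->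
  atlas c -> cdom c p -> atlas d -> cdom d q ->
  forall eps, 0 < eps -> exists2 rho, 0 < rho & forall eta, 0 < eta ->
  near_double (cfun c p) (cfun d q) (g p) (tangent_mx c g p) (tangent_mx d g q)
    rho eps eta g.
Proof.
move=> gI pq gpq ac cp ad dq eps eps0.
(* Hausdorff separation of [p] and [q] makes the two sheets disjoint in [M], although their images
   meet. *)
have [[A B] [/= Ap Bq] [oA oB AB]] : exists2 AB : set M * set M,
    (p \in AB.1 /\ q \in AB.2) & [/\ open AB.1, open AB.2 & AB.1 `&` AB.2 = set0].
  have := @carrier_hausdorff _ _ M; rewrite open_hausdorff => H.
  by have [|AB ABp [oA oB /eqP AB0]] := H p q; [exact/eqP|exists AB].
have loc (a : chart R m M) u (C : set M) : atlas a -> cdom a u -> open C -> u \in C ->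
    \forall s \near cfun a u, [/\ cimg a s, C (cinv a s), C1 (g \o cinv a) s &
      `|'J (g \o cinv a) s - tangent_mx a g u| < eps / 2].
  move=> aa au oC; rewrite inE => uC.
  have [_ Jc] := immersion_C1 gI aa au.
  have H1 := cimg_near (cimg_cfun au).
  have H2 := cinv_near au (open_nbhs_nbhs (conj oC uC)).
  have H3 : \forall s \near cfun a u, `|'J (g \o cinv a) s - tangent_mx a g u| < eps / 2.
    have K : ('J (g \o cinv a) s - tangent_mx a g u) @[s --> nbhs (cfun a u)] -->
        'J (g \o cinv a) (cfun a u) - tangent_mx a g u.
      apply: (@cvgB _ _ _ _ (nbhs_filter (cfun a u))); first exact: Jc.
      exact: cvg_cst.
    have K2 := @cvg_norm _ _ _ _ (nbhs_filter (cfun a u)) _ _ K.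
    apply: (@cvgr_lt _ _ _ (nbhs_filter (cfun a u)) _ _ K2).
    by rewrite /tangent_mx subrr normr0 divr_gt0.
  near=> s.
  have Is : cimg a s by near: s.
  split; [exact: Is|by near: s| |by near: s].
  have [cs sE] := cinvK Is.
  have := immersion_C1 gI aa cs; rewrite sE; exact.
have /nbhs_ballP[r1 /= r10 L1] := loc c p A ac cp oA Ap.
have /nbhs_ballP[r2 /= r20 L2] := loc d q B ad dq oB Bq.
pose rho := Num.min r1 r2 / 2.
have mr0 : 0 < Num.min r1 r2 by rewrite lt_min r10 r20.
have rho0 : 0 < rho by rewrite divr_gt0.
have O1 : oball (cfun c p) (2 * rho) `<=` ball (cfun c p) r1.
  move=> s; rewrite /oball /= mulrC divfK// -ball_normE/= distrC.
  by rewrite lt_min => /andP[].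
have O2 : oball (cfun d q) (2 * rho) `<=` ball (cfun d q) r2.
  move=> s; rewrite /oball /= mulrC divfK// -ball_normE/= distrC.
  by rewrite lt_min => /andP[].
exists rho => // eta eta0; split; first exact: gI.
exists (cinv c), (cfun c), (cinv d), (cfun d), (1 / 2); split.
- apply: local_param_chart => //; first exact: open_oball.
  by move=> s /O1/L1[].
- apply: local_param_chart => //; first exact: open_oball.
  by move=> s /O2/L2[].
- move=> t s /O1/L1[_ At _ _] /O2/L2[_ Bs _ _] E.
  have : (A `&` B) (cinv c t) by split=> //; rewrite E.
  by rewrite AB.
- by apply/andP; split; clear; lra.
- split; split.
  + by rewrite /= cfunK// subrr normr0 mulr_ge0// ltW.
  + move=> t tr; have [_ _ C /ltW H] := L1 _ (O1 _ (oball_sub rho0 tr)).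
    by split; [exact: C|rewrite mulrC mulrA mulr1; exact: H].
  + by rewrite /= cfunK// gpq subrr normr0 mulr_ge0// ltW.
  + move=> t tr; have [_ _ C /ltW H] := L2 _ (O2 _ (oball_sub rho0 tr)).
    by split; [exact: C|rewrite mulrC mulrA mulr1; exact: H].
Unshelve. all: by end_near. Qed.

(** Halving the scale outweighs the width of a cube: the smaller shell ends below 5/4 of its scale,
    which is at most 5/8 of the larger one. *)
Lemma dyadic_shells_disjoint (a b : nat) (r0 kap u v : R) : (a < b)%N -> 0 < r0 -> kap <= 1 / 4 ->
  u + r0 / 2 ^+ a <= v -> v < u + r0 / 2 ^+ b + kap * (r0 / 2 ^+ b) -> False.
Proof.
move=> ab r00 kap4.
have : r0 / 2 ^+ b <= r0 / 2 ^+ a / 2.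
  rewrite -mulrA -invfM -exprSr ler_wpM2l ?(ltW r00)//.
  by rewrite lef_pV2 ?posrE ?exprn_gt0// ler_weXn2l ?ler1n.
have : 0 < r0 / 2 ^+ b by rewrite divr_gt0// exprn_gt0.
have : 0 < r0 / 2 ^+ a by rewrite divr_gt0// exprn_gt0.
move: (r0 / 2 ^+ a) (r0 / 2 ^+ b) kap4 => x y; clear; nra.
Qed.

(** The parametrisations of [M'] are pushed forward by [phi] and the energy is computed on [M]
    itself, so neither the volume nor the angle has to be transported. *)
Lemma energy_near_double m n (J1 J2 : 'M[R]_(m, n)) (A : R) : (0 < m)%N ->
  row_free J1 -> row_free J2 -> exists2 eps, 0 < eps &
  forall rho, 0 < rho -> exists2 eta, 0 < eta &
  forall (M : closed_manifold R m) (o : orientation M) (f : M -> 'rV[R]_n)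
    (vol : {measure set (borel M) -> \bar R}) (M' : closed_manifold R m)
    (phi : M' -> M) t1 t2 x,
  immersion f -> injective f -> is_volume_measure f vol -> C2_diffeo phi ->
  near_double t1 t2 x J1 J2 rho eps eta (f \o phi) ->
  (A%:E <= E_KS o f vol)%E.
Proof.
move=> m0 J1f J2f.
have [i [dl [C [kap [eps0 [mu [dl0 C0 eps00 mu0 [kap0 kap4 mu4 shell]]]]]]]] :=
  two_sheets m0 J1f J2f.
have [k1 [e1 [k10 e10 G1]]] := gram_near J1f.
have [k2 [e2 [k20 e20 G2]]] := gram_near J2f.
have [c c0 energy] := @energy_ge R m m0.
pose k := Num.min k1 k2; have k0 : 0 < k by rewrite lt_min k10 k20.
pose eps := Num.min eps0 (Num.min e1 e2).
have eps_gt0 : 0 < eps by rewrite !lt_min eps00 e10 e20.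
exists eps => // rho rho0.
pose K := c * k ^+ 2 * (dl / 2) ^+ m / (n.+1%:R * C) ^+ (2 * m) * (kap / C) ^+ m.
have K0 : 0 < K.
  have nC : 0 < n.+1%:R * C by exact: mulr_gt0.
  have H1 : 0 < c * k ^+ 2 by rewrite mulr_gt0// exprn_gt0.
  have H2 : 0 < (dl / 2) ^+ m by rewrite exprn_gt0// divr_gt0.
  have H3 : 0 < (kap / C) ^+ m by rewrite exprn_gt0// divr_gt0.
  have H4 : 0 < (n.+1%:R * C) ^+ (2 * m) by exact: exprn_gt0.
  by apply: mulr_gt0 H3; apply: divr_gt0 H4; exact: mulr_gt0.
(* Each shell contributes [K], and [N] of them reach [A]. *)
pose N := (Num.truncn (A / K)).+1.
have NA : A <= N%:R * K.
  by rewrite -ler_pdivrMr//; apply/ltW/truncnS_gt.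
pose r0 := mu * (rho / 2); have r00 : 0 < r0 by rewrite mulr_gt0// divr_gt0.
pose r (j : 'I_N) := r0 / 2 ^+ j.
have r_gt0 j : 0 < r j by rewrite divr_gt0// exprn_gt0.
have r_le j : r j <= r0 by rewrite ler_pdivrMr ?exprn_gt0// ler_peMr ?(ltW r00)// exprn_ege1// ler1n.
(* Set by a scale below the smallest shell, so that [eta <= mu * r j] holds for all [N] shells at
   once. *)
pose eta := mu * (r0 / 2 ^+ N).
have eta0 : 0 < eta by rewrite mulr_gt0// divr_gt0// exprn_gt0.
have eta_le j : eta <= mu * r j.
  rewrite ler_wpM2l ?(ltW mu0)// ler_wpM2l ?(ltW r00)//.
  by rewrite lef_pV2 ?posrE ?exprn_gt0// ler_weXn2l ?ler1n// ltnW.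
exists eta => // M o f vol M' phi t1 t2 x fI f_inj fvol phiD.
move=> [_ [th1 [tau1 [th2 [tau2 [q [P1 P2 dis /andP[q0 q1] [S1 S2]]]]]]]].
have [phiC [psi [psiC phiK psiK]]] := phiD.
have P1' := local_param_diffeo phiC psiC phiK psiK P1.
have P2' := local_param_diffeo phiC psiC phiK psiK P2.
have qe : q * eps <= eps by rewrite ler_piMl ?(ltW q1) ?(ltW eps_gt0).
have qh : q * eta <= eta by rewrite ler_piMl ?(ltW q1) ?(ltW eta0).
have rho2 : rho / 2 <= rho by rewrite ler_pdivrMr// ler_peMr ?(ltW rho0)// ler1n.
have rho2l : rho / 2 < rho by rewrite ltr_pdivrMr// ltr_pMr// ltr1n.
have ee0 : eps <= eps0 by rewrite ge_min lexx.
have ee1 : eps <= e1 by rewrite !ge_min lexx /= orbT.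
have ee2 : eps <= e2 by rewrite !ge_min lexx !orbT.
(* The shells use radius [rho / 2] only, so that each point of [K1] and [K2] has a neighbourhood
   where the Jacobian is still controlled, as the volume bound requires. *)
have S1' := sheet_weaken S1 rho2 (le_trans qe ee0) qh.
have S2' := sheet_weaken S2 rho2 (le_trans qe ee0) qh.
pose K1 := [set s : 'rV[R]_m | `|s - t1| <= rho / 2].
pose K2 := [set s : 'rV[R]_m | `|s - t2| <= rho / 2].
have KU t : [set s : 'rV[R]_m | `|s - t| <= rho / 2] `<=` oball t (2 * rho).
  move=> s /= sr; apply: (oball_sub rho0); exact: le_trans sr rho2.
have near_le (t s : 'rV[R]_m) : `|s - t| <= rho / 2 -> \forall u \near s, `|u - t| <= rho.
  move=> st; have H : nbhs s (oball t rho).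
    by apply: open_nbhs_nbhs; split; [exact: open_oball|exact: le_lt_trans st rho2l].
  by near=> u; apply: ltW; near: u; exact: H.
apply: le_trans _ (energy n M f o vol _ _ _ _ _ _ k K1 K2 dl C kap N
  (fun j => t1 + r j *: delta_mx ord0 i) r fI f_inj fvol P1' P2' _ k0
  (@closed_ball_rV_compact R m t1 _) (KU t1) (@closed_ball_rV_compact R m t2 _) (KU t2)
  _ _ dl0 C0 kap0 r_gt0 _ _ _).
- by rewrite lee_fin.
- by move=> t s Ut Us /= /(can_inj phiK); exact: dis.
- move=> t Kt; have H0 := near_le _ _ Kt; near=> s.
  have sr : `|s - t1| <= rho by near: s; exact: H0.
  have [_ H] := S1; have [_ H'] := H s sr.
  apply: le_trans (_ : k1 <= _); first by rewrite ge_min lexx.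
  by apply: G1; apply: le_trans H' (le_trans qe ee1).
- move=> t Kt; have H0 := near_le _ _ Kt; near=> s.
  have sr : `|s - t2| <= rho by near: s; exact: H0.
  have [_ H] := S2; have [_ H'] := H s sr.
  apply: le_trans (_ : k2 <= _); first by rewrite ge_min lexx orbT.
  by apply: G2; apply: le_trans H' (le_trans qe ee2).
- move=> a b ab; apply/seteqP; split=> // t [/(_ i) ta /(_ i) tb].
  move: ta tb; rewrite /r !mxE !eqxx !mulr1 => /andP[a1 a2] /andP[b1 b2].
  have := ab; rewrite neq_ltn => /orP[] lt_ab.
    exact: (dyadic_shells_disjoint lt_ab r00 kap4 a1 b2).
  exact: (dyadic_shells_disjoint lt_ab r00 kap4 b1 a2).
- move=> j t /(cube_norm (mulr_ge0 (ltW kap0) (ltW (r_gt0 j)))) tj; rewrite /K1 /=.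
  have -> : t - t1 = (t - (t1 + r j *: delta_mx ord0 i)) + r j *: delta_mx ord0 i.
    by rewrite opprD addrA subrK.
  apply: le_trans (ler_normD _ _) _; rewrite normrZ gtr0_norm//.
  apply: le_trans (lerD tj (ler_piMr (ltW (r_gt0 j)) (norm_delta i))) _.
  have : r j <= rho / 8.
    by apply: le_trans (r_le j) _; rewrite /r0; move: mu4 rho0; clear; nra.
  by move: (r j) (r_gt0 j) kap4 rho0 => w; clear; nra.
- move=> j t tj.
  have [] := shell _ _ _ _ _ _ _ (r j) (divr_gt0 rho0 (ltr0Sn R 1)) S1' S2' _ (r_gt0 j)
    (r_le j) (eta_le j) t tj.
    move=> u v ur vr /= /f_inj/(can_inj phiK) E.
    exact: (dis u v (KU _ _ ur) (KU _ _ vr) E).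
  move=> s [e [e0 eC sK H]]; exists s, e; split.
  + exact: e0.
  + exact: eC.
  + exact: sK.
  + exact: H.
Unshelve. all: by end_near. Qed.

End Divergence.

Theorem theorem3p10 (R : realType) (m n : nat) (eps0 b : R)
    (N : nat -> closed_manifold R m) (f : forall k, N k -> 'rV[R]_n)
    (o : forall k, orientation (N k))
    (vol : forall k, {measure set (borel (N k)) -> \bar R})
    (Minf : closed_manifold R m) (finf : Minf -> 'rV[R]_n) :
  (1 <= m)%N -> (m <= n)%N -> 0 < eps0 -> 0 < b ->
  (forall k, embedding (f k)) ->
  (forall k, class_M2 m eps0 b (range (f k))) ->
  (forall k, is_volume_measure (f k) (vol k)) ->
  immersion finf ->
  class_M2 m eps0 b (range finf) ->
  (exists p q : Minf, p <> q /\ finf p = finf q) ->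
  C2_converges f finf ->
  (fun k => E_KS (o k) (f k) (vol k)) @ \oo --> +oo%E.
Proof.
move=> m0 _ _ _ femb _ fvol finfI _ [p [q [pq fpq]]] fcvg.
have [c ac cp] := atlas_cover p; have [d ad dq] := atlas_cover q.
apply/cvgeyPge => A.
have [eps eps_gt0 near_eps] := energy_near_double A m0
  (immersion_free finfI ac cp) (immersion_free finfI ad dq).
have [rho rho0 doubleV] := double_point_near finfI pq fpq ac cp ad dq eps_gt0.
have [eta eta0 energyA] := near_eps rho rho0.
(* Convergence is applied to this single open set; the diffeomorphism it provides varies with [k],
   but [eta] was chosen uniformly in it. *)
have H := fcvg _ (near_double_open _ _ _ _ _ rho0 eps_gt0 eta0 Minf)
  (@near_double_invariant _ _ _ _ _ _ _ _ _ _ _ _) (doubleV eta eta0).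
apply: filterS H => k [phi [phiD Vphi]].
have [fI f_inj _] := femb k.
exact: energyA fI f_inj (fvol k) phiD Vphi.
Qed.
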